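(* Let $k\ge1$. There is an injective $\mathbb{C}$-algebra homomorphism $\iota:\mathcal{A}_{2k}\to\mathcal{A}_{2k}^{\mathrm{aff}}$ from the partition algebra to the affine partition algebra given on the generators by $\iota(z)=z_0$, $\iota(s_i)=\tau_{2i}\tau_{2i+1}+e_{2i}$ for $1\le i\le k-1$, and $\iota(e_i)=e_i$ for $1\le i\le 2k-1$.
   Context: $[m]=\{1,\dots,m\}$. **Partition algebra.** $\mathcal{A}_{2k}$ is the $\mathbb{C}[z]$-algebra with $\mathbb{C}[z]$-basis the set partitions of $\{1,\dots,k\}\cup\{1',\dots,k'\}$ (drawn as diagrams with top row $1,\dots,k$ and bottom row $1',\dots,k'$), regarded as a $\mathbb{C}$-algebra; the product is $\alpha\beta=z^{m(\alpha,\beta)}\alpha\circ\beta$, where $\alpha\circ\beta$ is obtained by stacking $\alpha$ on top of $\beta$, identifying the bottom row of $\alpha$ with the top row of $\beta$, deleting the $m(\alpha,\beta)$ components lying entirely in the middle row and reading off the induced partition. $s_i$ ($i\in[k-1]$) has blocks $\{i,(i+1)'\},\{i+1,i'\}$ and $\{j,j'\}$ otherwise; $e_{2j-1}$ ($j\in[k]$) has blocks $\{j\},\{j'\}$ and $\{r,r'\}$ otherwise; $e_{2i}$ ($i\in[k-1]$) has block $\{i,i+1,i',(i+1)'\}$ and $\{r,r'\}$ otherwise. These elements together with $z$ generate $\mathcal{A}_{2k}$ as a $\mathbb{C}$-algebra. **Affine partition algebra.** $\mathcal{A}_{2k}^{\mathrm{aff}}$ is the unital associative $\mathbb{C}$-algebra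 with generators $\tau_i$ ($2\le i\le 2k-1$), $e_j$ ($1\le j\le 2k-1$), $x_r$ ($1\le r\le 2k$), $z_l$ ($l\in\mathbb{Z}_{\ge0}$) and the following relations (where no range is given, for all indices for which all generators involved are defined): (1) $\tau_{2i}^2=1-e_{2i}$, $\tau_{2i+1}^2=1-e_{2i}$ for $i\in[k-1]$. (2) $\tau_{2i+1}\tau_{2j}=\tau_{2j}\tau_{2i+1}$ for $j\ne i+1$; $\tau_{2i+1}\tau_{2j+1}=\tau_{2j+1}\tau_{2i+1}$ and $\tau_{2i}\tau_{2j}=\tau_{2j}\tau_{2i}$ for $j\ne i\pm1$; $s_is_{i+1}s_i=s_{i+1}s_is_{i+1}$ for $i\in[k-2]$, where $s_j:=\tau_{2j}\tau_{2j+1}+e_{2j}$. (3) $e_{2i-1}^2=z_0e_{2i-1}$ ($i\in[k]$); and for $i\in[k-1]$: $e_{2i}^2=e_{2i}$, $\tau_{2i+1}e_{2i}=e_{2i}\tau_{2i+1}=0$, $\tau_{2i}e_{2i}=e_{2i}\tau_{2i}=0$, $\tau_{2i}e_{2i-1}e_{2i+1}=\tau_{2i+1}e_{2i-1}e_{2i+1}$, $e_{2i+1}e_{2i-1}\tau_{2i}=e_{2i+1}e_{2i-1}\tau_{2i+1}$. (4) $e_ie_j=e_je_i$ if $|i-j|\ge2$; $\tau_{2i-1}e_{2j-1}=e_{2j-1}\tau_{2i-1}$ if $j\ne i-1,i$; $\tau_{2i-1}e_{2j}=e_{2j}\tau_{2i-1}$ if $j\ne i$; $\tau_{2i}e_{2j-1}=e_{2j-1}\tau_{2i}$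 if $j\neq i,i+1$; $\tau_{2i}e_{2j}=e_{2j}\tau_{2i}$ if $j\ne i-1$. (5) $e_ie_{i+1}e_i=e_i$, $e_{i+1}e_ie_{i+1}=e_{i+1}$ for $i\in[2k-2]$; $\tau_{2i}e_{2i-1}\tau_{2i}=\tau_{2i+1}e_{2i+1}\tau_{2i+1}$ for $i\in[k-1]$; $\tau_{2i}e_{2i-2}\tau_{2i}=\tau_{2i-1}e_{2i}\tau_{2i-1}$ for $2\le i\le k-1$. (6) $x_ix_j=x_jx_i$; $\tau_ix_j=x_j\tau_i$ for $j\ne i-1,i,i+1$; $e_ix_j=x_je_i$ for $j\ne i,i+1$. (7) $\tau_{2i-2}\tau_{2i}\tau_{2i-2}=\tau_{2i}\tau_{2i-2}\tau_{2i}(1-e_{2i-2})$; $\tau_{2i+1}\tau_{2i-1}\tau_{2i+1}=\tau_{2i-1}\tau_{2i+1}\tau_{2i-1}(1-e_{2i})$; $\tau_{2i-1}\tau_{2i}\tau_{2i-1}=\tau_{2i}-e_{2i-2}\tau_{2i}-\tau_{2i}e_{2i-2}$; $\tau_{2i}\tau_{2i-1}\tau_{2i}=\tau_{2i-1}-e_{2i}\tau_{2i-1}-\tau_{2i-1}e_{2i}$. (8) $x_{2i+1}=\tau_{2i}x_{2i-1}\tau_{2i}+e_{2i}e_{2i-1}\tau_{2i}+\tau_{2i}e_{2i-1}e_{2i}-\tau_{2i}$; $x_{2i+2}=\tau_{2i+1}x_{2i}\tau_{2i+1}+e_{2i}e_{2i+1}\tau_{2i+1}e_{2i+1}e_{2i}+\tau_{2i+1}$;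 $x_{2i}=\tau_{2i}x_{2i}\tau_{2i}+e_{2i}e_{2i-1}\tau_{2i}+\tau_{2i}e_{2i-1}e_{2i}$; $x_{2i+1}=\tau_{2i+1}x_{2i+1}\tau_{2i+1}+e_{2i}e_{2i+1}\tau_{2i+1}+\tau_{2i+1}e_{2i+1}e_{2i}$. (9) $e_i(x_i-x_{i+1})=0=(x_i-x_{i+1})e_i$ for $i\in[2k-1]$. (10) $e_1x_1^le_1=z_le_1$ for $l\ge1$; every $z_l$ ($l\ge0$) is central. *)

(* Defs.v *)
From HB Require Import structures.
From mathcomp Require Import all_boot all_order all_algebra.
From mathcomp Require Import boolp reals.
From mathcomp Require Import complex zify ring.
From mathcomp.multinomials Require Import monalg.

Set Implicit Arguments.
Unset Strict Implicit.
Unset Printing Implicit Defensive.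

Import GRing.Theory.
Local Open Scope ring_scope.

Section Diagrams.
Variable k : nat.

(* inl i is the vertex i + 1 of the top row, inr i is the vertex (i + 1)' of the
   bottom row. *)
Definition vertex : Type := ('I_k + 'I_k)%type.
HB.instance Definition _ := Finite.on vertex.

Record diagram := Diagram {
  blocks :> {set {set vertex}};
  blocksP : partition blocks [set: vertex] }.

HB.instance Definition _ := [isSub for blocks].
HB.instance Definition _ := [Finite of diagram by <:].

(* The set partition into the non-empty fibres of f. *)
Definition fibre_diagram (L : eqType) (f : vertex -> L) : diagram :=
  Diagram (preim_partitionP f [set: vertex]).

(* Vertices of the stack of two diagrams: inl (inl i), inl (inr i) and inr i
   lie in its top, middle and bottom row. *)
Definition svertex : Type := (vertex + 'I_k)%type.
HB.instance Definition _ := Finite.on svertex.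

(* The bottom row of the upper diagram is identified with the top row of the
   lower one; [outer] embeds the vertices of the composite. *)
Definition upper (p : vertex) : svertex := inl p.
Definition lower (p : vertex) : svertex :=
  match p with inl i => inl (inr i) | inr i => inr i end.
Definition outer (p : vertex) : svertex :=
  match p with inl i => inl (inl i) | inr i => inr i end.
Definition middle : {set svertex} := [set inl (inr i) | i : 'I_k].

(* u and v lie in a common block of the upper or of the lower diagram. *)
Definition stack (a b : diagram) : rel svertex :=
  fun u v => [exists B in [set upper @: B | B : {set vertex} in blocks a] :|:
                          [set lower @: B | B : {set vertex} in blocks b],
                (u \in B) && (v \in B)].

Definition components (a b : diagram) : {set {set svertex}} :=
  equivalence_partition (connect (stack a b)) [set: svertex].

Definition nmiddle (a b : diagram) : nat :=
  #|[set C in components a b | C \subset middle]|.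

Lemma stack_sym a b : symmetric (stack a b).
Proof. by move=> u v; apply: eq_existsb => B; rewrite [(v \in B) && _]andbC. Qed.

Lemma connect_stack_equiv a b : equivalence_rel (connect (stack a b)).
Proof.
move=> x y z; split; first exact: connect0.
by move=> xy; apply: (same_connect (sym_connect_sym (@stack_sym a b)) xy).
Qed.

Lemma outer_equiv a b :
  equivalence_rel (fun p q => connect (stack a b) (outer p) (outer q)).
Proof. by move=> x y z; apply: connect_stack_equiv. Qed.

Lemma compose_subproof a b : partition
  (equivalence_partition (fun p q => connect (stack a b) (outer p) (outer q))
     [set: vertex]) [set: vertex].
Proof. by apply: equivalence_partitionP => x y z _ _ _; apply: outer_equiv. Qed.

(* [a] is on top of [b]. *)
Definition compose (a b : diagram) : diagram := Diagram (compose_subproof a b).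

Definition id_diagram : diagram :=
  fibre_diagram (fun p => match p with inl i | inr i => i end).

Definition same (a : diagram) : rel vertex := fun p q => q \in pblock a p.

Lemma in_cover a p : p \in cover (blocks a).
Proof. by rewrite (cover_partition (blocksP a)) inE. Qed.

Lemma same_refl a p : same a p p.
Proof. by rewrite /same mem_pblock in_cover. Qed.

Lemma sameP a p q :
  reflect (exists2 B, B \in blocks a & (p \in B) && (q \in B)) (same a p q).
Proof.
have /and3P[_ tr _] := blocksP a.
apply: (iffP idP) => [h|[B Ba /andP[pB qB]]].
  exists (pblock a p); first by rewrite pblock_mem // in_cover.
  by rewrite mem_pblock in_cover.
by rewrite /same (def_pblock tr Ba pB).
Qed.

Lemma same_sym a : symmetric (same a).
Proof.
by move=> p q; apply/sameP/sameP => -[B Ba]; rewrite andbC; exists B.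
Qed.

Lemma same_inj a b : same a =2 same b -> a = b.
Proof.
move=> eab; apply: val_inj => /=.
rewrite -(equivalence_partition_pblock (blocksP a)).
rewrite -(equivalence_partition_pblock (blocksP b)).
rewrite /equivalence_partition; apply: eq_imset => p.
by apply/setP => q; rewrite !inE; apply: eab.
Qed.

Lemma same_fibre (L : eqType) (f : vertex -> L) p q :
  same (fibre_diagram f) p q = (f p == f q).
Proof.
rewrite /same /fibre_diagram /= /preim_partition pblock_equivalence_partition //.
by move=> x y z _ _ _; split => //= /eqP ->.
Qed.

Lemma same_compose a b p q :
  same (compose a b) p q = connect (stack a b) (outer p) (outer q).
Proof.
rewrite /same /compose /= pblock_equivalence_partition //.
by move=> x y z _ _ _; apply: outer_equiv.
Qed.

Lemma stackE a b u v : reflect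
  ((exists p q, [/\ same a p q, u = upper p & v = upper q]) \/
   (exists p q, [/\ same b p q, u = lower p & v = lower q])) (stack a b u v).
Proof.
apply: (iffP existsP) => [[B /andP[]]|].
  rewrite inE => /orP[] /imsetP[D Da ->] /andP[/imsetP[p pD ->] /imsetP[q qD ->]].
    by left; exists p, q; split => //; apply/sameP; exists D; rewrite ?pD.
  by right; exists p, q; split => //; apply/sameP; exists D; rewrite ?pD.
case=> -[p [q [/sameP[D Da /andP[pD qD]] -> ->]]].
  exists (upper @: D); apply/and3P; split; try exact: imset_f.
  by rewrite inE; apply/orP; left; apply: imset_f.
exists (lower @: D); apply/and3P; split; try exact: imset_f.
by rewrite inE; apply/orP; right; apply: imset_f.
Qed.

Definition join (f g : {set 'I_k}) : {set vertex} :=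
  [set p | match p with inl i => i \in f | inr i => i \in g end].

(* The union of the top vertices in f and of the bottom vertices in g is a union
   of blocks of [a]. The matrices [sat a] satisfy
   sat a *m sat b = 2 ^ nmiddle a b *: sat (compose a b), whence associativity. *)
Definition sat (a : diagram) (f g : {set 'I_k}) : bool :=
  [forall p, forall q, same a p q ==> ((p \in join f g) == (q \in join f g))].

Lemma satP a f g : reflect
  (forall p q, same a p q -> (p \in join f g) = (q \in join f g)) (sat a f g).
Proof.
apply: (iffP forallP) => [h p q apq|h p].
  by have /forallP/(_ q)/implyP/(_ apq)/eqP := h p.
by apply/forallP => q; apply/implyP => /h ->.
Qed.

Lemma sat_inj a b : sat a =2 sat b -> a = b.
Proof.
have sub c d p q : sat c =2 sat d -> same c p q -> same d p q.
  move=> ecd cpq.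
  pose S := pblock d p; pose f := [set i | inl i \in S]; pose g := [set i | inr i \in S].
  have jE r : (r \in join f g) = (r \in S) by rewrite inE; case: r => i; rewrite inE.
  have /satP/(_ _ _ cpq) : sat c f g.
    rewrite ecd; apply/satP => r s drs; rewrite !jE.
    have /and3P[_ tr _] := blocksP d.
    move: drs; rewrite /same => drs.
    apply/idP/idP => h; first by rewrite /S -(same_pblock tr h).
    by rewrite /S -(same_pblock tr h) (same_pblock tr drs); apply: same_refl.
  by rewrite !jE -[p \in S]/(same d p p) same_refl => /esym.
move=> eab; apply: same_inj => p q; apply/idP/idP; exact: sub.
Qed.

Section Count.
Variables (a b : diagram) (f h : {set 'I_k}).
Let con := connect (stack a b).

Let J (g : {set 'I_k}) : {set svertex} :=
  [set u | match u with
           | inl (inl i) => i \in f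
           | inl (inr i) => i \in g
           | inr i => i \in h end].

Let Jouter g p : (outer p \in J g) = (p \in join f h).
Proof. by case: p => i; rewrite !inE. Qed.

Let sat2P g : reflect (forall u v : svertex, con u v -> (u \in J g) = (v \in J g))
  (sat a f g && sat b g h).
Proof.
apply: (iffP andP) => [[/satP sa /satP sb] u v|Jc].
  move/connectP=> [s]; elim: s u => [|w s IHs] u /=; first by move=> _ ->.
  move=> /andP[/stackE uw sp] vE; rewrite -(IHs w) //.
  case: uw => -[p [q [pq -> ->]]].
    by have := sa _ _ pq; rewrite !inE; case: p {pq} => i; case: q => j.
  by have := sb _ _ pq; rewrite !inE; case: p {pq} => i; case: q => j.
split; apply/satP => p q pq.
  have /connect1/Jc : stack a b (upper p) (upper q).
    by apply/stackE; left; exists p, q.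
  by rewrite !inE; case: p {pq} => i; case: q => j.
have /connect1/Jc : stack a b (lower p) (lower q).
  by apply/stackE; right; exists p, q.
by rewrite !inE; case: p {pq} => i; case: q => j.
Qed.

Let D := [set C in components a b | C \subset middle].

Let con_refl (u : svertex) : con u u.
Proof. exact: connect0. Qed.

Let con_sym (u v : svertex) : con u v = con v u.
Proof. exact: (sym_connect_sym (@stack_sym a b)). Qed.

Let con_tr (u v w : svertex) : con u v -> con v w -> con u w.
Proof. exact: connect_trans. Qed.

Let cl (u : svertex) : {set svertex} := [set v | con u v].

Let compP C : reflect (exists u, C = cl u) (C \in components a b).
Proof.
apply: (iffP imsetP) => [[u _ ->]|[u ->]]; exists u => //;
  by apply/setP => v; rewrite !inE.
Qed.

Let clE u v : con u v -> cl u = cl v.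
Proof.
move=> uv; apply/setP => w; rewrite !inE; apply/idP/idP; apply: con_tr => //.
by rewrite con_sym.
Qed.

Let S0 : {set svertex} := [set u | [exists p in join f h, con (outer p) u]].

Let G (Q : {set {set svertex}}) : {set 'I_k} :=
  [set i | inl (inr i) \in S0 :|: cover Q].

Let outerNmid p : outer p \notin middle.
Proof. by apply/imsetP => -[i _]; case: p. Qed.

Let outer_or_mid u : u \notin middle -> exists p, u = outer p.
Proof.
case: u => [[i|i]|i].
- by exists (inl i).
- by rewrite imset_f.
- by exists (inr i).
Qed.

Let coverQP (Q : {set {set svertex}}) u : Q \subset D -> reflect (cl u \in Q) (u \in cover Q).
Proof.
move=> /subsetP QD; apply: (iffP bigcupP) => [[C CQ uC]|clQ].
  have := QD _ CQ; rewrite inE => /andP[/compP[v CE] _].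
  by move: uC CQ; rewrite CE inE => /clE ->.
by exists (cl u) => //; rewrite inE con_refl.
Qed.

Let JG (Q : {set {set svertex}}) : sat (compose a b) f h -> Q \subset D -> J (G Q) = S0 :|: cover Q.
Proof.
move=> /satP sc QD; apply/setP => u.
have oE p : (p \in join f h) = (outer p \in S0 :|: cover Q).
  rewrite in_setU; apply/idP/orP => [pj|[]].
  - by left; rewrite inE; apply/existsP; exists p; rewrite pj con_refl.
  - rewrite inE => /existsP[q /andP[qj qp]].
    by rewrite -(sc q p) // same_compose.
  - move=> /(coverQP _ QD)/(subsetP QD); rewrite inE => /andP[_ /subsetP].
    by move=> /(_ (outer p)); rewrite inE con_refl (negbTE (outerNmid p)) => /(_ isT).
have [/imsetP[i _ ->]|/outer_or_mid[p ->]] := boolP (u \in middle).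
  by rewrite [in LHS]inE [in LHS]inE.
by rewrite -oE Jouter.
Qed.

Lemma sat_compose : (\sum_(g : {set 'I_k}) sat a f g * sat b g h =
  2 ^ nmiddle a b * sat (compose a b) f h)%N.
Proof.
have [sc|nsc] := boolP (sat (compose a b) f h); last first.
  rewrite muln0 big1 // => g _; rewrite mulnb.
  case: (boolP (_ && _)) => // /sat2P Jc; case/satP: nsc => p q.
  by rewrite same_compose => /Jc; rewrite !Jouter.
rewrite muln1 /nmiddle -/D -card_powerset.
rewrite (eq_bigr (fun g => (sat a f g && sat b g h : nat))); last first.
  by move=> g _; rewrite mulnb.
rewrite -big_mkcond sum1_card -(@card_in_imset _ _ G (powerset D)).
  apply: eq_card => g; apply/idP/imsetP => [|[Q]].
    move=> sg; have /sat2P Jc : sat a f g && sat b g h by [].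
    pose Q := [set C in D | C \subset J g].
    have QD : Q \subset D by apply/subsetP => C; rewrite inE => /andP[].
    exists Q; first by rewrite inE.
    suff E : J g = S0 :|: cover Q.
      by apply/setP => i; rewrite [in RHS]inE -E inE.
    apply/setP => u; rewrite in_setU; apply/idP/orP => [ug|[]].
    - have [cm|] := boolP (cl u \subset middle).
        right; apply/(coverQP _ QD); rewrite !inE cm andbT.
        apply/andP; split; first by apply/compP; exists u.
        by apply/subsetP => v; rewrite inE => /Jc <-.
      move/subsetPn => [v]; rewrite inE => uv /outer_or_mid[p vE].
      left; rewrite inE; apply/existsP; exists p.
      by rewrite -(Jouter g) -vE -(Jc _ _ uv) ug con_sym.
    - by rewrite inE => /existsP[p /andP[pj /Jc <-]]; rewrite Jouter.
    - move=> /(coverQP _ QD); rewrite inE => /andP[_ /subsetP]; apply.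
      by rewrite inE con_refl.
  rewrite inE => QD ->; apply/sat2P => u v uv; rewrite (JG sc QD) !inE.
  congr (_ || _); last by apply/(coverQP _ QD)/(coverQP _ QD); rewrite (clE uv).
  apply: eq_existsb => p; congr (_ && _).
  by apply/idP/idP => pu; apply: con_tr pu _ => //; rewrite con_sym.
move=> Q1 Q2; rewrite !inE => Q1D Q2D eG.
have E : S0 :|: cover Q1 = S0 :|: cover Q2 by rewrite -!JG // eG.
have aux (Q Q' : {set {set svertex}}) C : Q \subset D -> Q' \subset D -> S0 :|: cover Q = S0 :|: cover Q' ->
    C \in Q -> C \in Q'.
  move=> QD Q'D EQ CQ.
  have := subsetP QD _ CQ; rewrite inE => /andP[/compP[u CE] Cm].
  have : u \in S0 :|: cover Q by rewrite inE [u \in cover Q](introT (coverQP _ QD)) ?orbT // -CE.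
  rewrite EQ inE => /orP[|/(coverQP _ Q'D)]; last by rewrite CE.
  rewrite inE => /existsP[p /andP[_ pu]].
  have := subsetP Cm (outer p); rewrite CE inE con_sym pu => /(_ isT).
  by rewrite (negbTE (outerNmid p)).
by apply/setP => C; apply/idP/idP; apply: aux.
Qed.

End Count.

Lemma sat_id f g : sat id_diagram f g = (f == g).
Proof.
apply/satP/eqP => [s|-> p q].
  apply/setP => i; have := s (inl i) (inr i); rewrite same_fibre eqxx => /(_ isT).
  by rewrite !inE.
by rewrite same_fibre => /eqP; rewrite !inE; case: p => i; case: q => j ->.
Qed.

Lemma sat00 a : sat a set0 set0.
Proof. by apply/satP => p q _; rewrite !inE; case: p => i; case: q => j; rewrite !inE. Qed.

Lemma sat_pow_inj a b m n :
  (forall f g, 2 ^ m * sat a f g = 2 ^ n * sat b f g)%N -> m = n /\ a = b.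
Proof.
move=> E; have mn : m = n.
  by have /eqP := E set0 set0; rewrite !sat00 !muln1 eqn_exp2l // => /eqP.
split=> //; apply: sat_inj => f g; have /eqP := E f g.
by rewrite mn eqn_pmul2l ?expn_gt0 //; case: (sat a f g); case: (sat b f g).
Qed.

Lemma composeA a b c :
  ((nmiddle a b + nmiddle (compose a b) c)%N = (nmiddle b c + nmiddle a (compose b c))%N)
  /\ compose (compose a b) c = compose a (compose b c).
Proof.
apply: (@sat_pow_inj (compose (compose a b) c) (compose a (compose b c))) => f h.
have := sat_compose a (compose b c) f h; have := sat_compose (compose a b) c f h.
have := sat_compose b c; have := sat_compose a b.
move: (nmiddle a b) (nmiddle b c) (nmiddle _ c) (nmiddle a _) => m1 m2 m3 m4.
move: (compose (compose a b) c) (compose a (compose b c)) => abc abc'.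
move: (compose a b) (compose b c) => ab bc e1 e2 e3 e4.
rewrite !expnD -!mulnA -e3 -e4 !big_distrr /=.
transitivity (\sum_i \sum_j sat a f j * sat b j i * sat c i h)%N.
  by apply: eq_bigr => i _; rewrite mulnA -e1 big_distrl.
rewrite exchange_big; apply: eq_bigr => j _ /=.
rewrite mulnCA -e2 big_distrr /=.
by apply: eq_bigr => i _; rewrite mulnA.
Qed.

Lemma compose1d a : nmiddle id_diagram a = 0%N /\ compose id_diagram a = a.
Proof.
apply: sat_pow_inj => f h; rewrite -sat_compose (bigD1 f) //= sat_id eqxx expn0 addnC.
by rewrite big1 // => g gf; rewrite sat_id eq_sym (negbTE gf).
Qed.

Lemma composed1 a : nmiddle a id_diagram = 0%N /\ compose a id_diagram = a.
Proof.
apply: sat_pow_inj => f h; rewrite -sat_compose (bigD1 h) //= sat_id eqxx expn0 addnC.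
rewrite big1 ?muln1 ?mul1n // => g gh; by rewrite sat_id (negbTE gh) muln0.
Qed.

End Diagrams.

Section TwistedProduct.
Variables (R : comNzRingType) (D : finType) (comp : D -> D -> D) (c : D -> D -> R).
Local Notation A := {ffun D -> R^o}.

Definition delta (d : D) : A := [ffun d' => (d' == d)%:R].

Definition twisted_mul (x y : A) : A :=
  \sum_a \sum_b (x a * y b * c a b) *: delta (comp a b).

Lemma delta_at d d' : delta d d' = (d' == d)%:R.
Proof. by rewrite ffunE. Qed.

Lemma deltaE (x : A) : x = \sum_d x d *: delta d.
Proof.
apply/ffunP => d; rewrite sum_ffunE (bigD1 d) //= big1 ?addr0 => [|d' nd].
  by rewrite !ffunE eqxx /GRing.scale /= mulr1.
by rewrite !ffunE eq_sym (negbTE nd) /GRing.scale /= mulr0.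
Qed.

Lemma delta_neq0 d : delta d != 0.
Proof.
by apply/eqP => /ffunP/(_ d)/eqP; rewrite !ffunE eqxx oner_eq0.
Qed.

Lemma twisted_mulDl : left_distributive twisted_mul +%R.
Proof.
move=> x y z; rewrite /twisted_mul -big_split; apply: eq_bigr => a _.
rewrite -big_split; apply: eq_bigr => b _ /=.
by rewrite ffunE !mulrDl scalerDl.
Qed.

Lemma twisted_mulDr : right_distributive twisted_mul +%R.
Proof.
move=> x y z; rewrite /twisted_mul -big_split; apply: eq_bigr => a _.
rewrite -big_split; apply: eq_bigr => b _ /=.
by rewrite ffunE mulrDr mulrDl scalerDl.
Qed.

Lemma twisted_mulZl r (x y : A) : twisted_mul (r *: x) y = r *: twisted_mul x y.
Proof.
rewrite /twisted_mul scaler_sumr; apply: eq_bigr => a _.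
rewrite scaler_sumr; apply: eq_bigr => b _.
by rewrite ffunE scalerA /GRing.scale /= !mulrA.
Qed.

Lemma twisted_mulZr r (x y : A) : twisted_mul x (r *: y) = r *: twisted_mul x y.
Proof.
rewrite /twisted_mul scaler_sumr; apply: eq_bigr => a _.
rewrite scaler_sumr; apply: eq_bigr => b _.
by rewrite ffunE scalerA /GRing.scale /= mulrCA !mulrA.
Qed.

Lemma twisted_mulx0 (x : A) : twisted_mul x 0 = 0.
Proof. by rewrite -(scale0r (0 : A)) twisted_mulZr !scale0r. Qed.

Lemma twisted_mul0x (x : A) : twisted_mul 0 x = 0.
Proof. by rewrite -(scale0r (0 : A)) twisted_mulZl !scale0r. Qed.

Lemma twisted_mul_suml y (F : D -> A) :
  twisted_mul (\sum_i F i) y = \sum_i twisted_mul (F i) y.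
Proof.
exact: (big_morph (twisted_mul^~ y) (fun u v => twisted_mulDl u v y)
  (twisted_mul0x y)).
Qed.

Lemma twisted_mul_sumr x (F : D -> A) :
  twisted_mul x (\sum_i F i) = \sum_i twisted_mul x (F i).
Proof.
exact: (big_morph (twisted_mul x) (twisted_mulDr x) (twisted_mulx0 x)).
Qed.

Lemma twisted_mul_delta a b :
  twisted_mul (delta a) (delta b) = c a b *: delta (comp a b).
Proof.
rewrite /twisted_mul (bigD1 a) //= [X in _ + X]big1 ?addr0 => [|a' na]; last first.
  by rewrite big1 // => b' _; rewrite delta_at (negbTE na) !mul0r scale0r.
rewrite (bigD1 b) //= [X in _ + X]big1 ?addr0 => [|b' nb].
  by rewrite !delta_at !eqxx !mul1r.
by rewrite [delta b b']delta_at (negbTE nb) mulr0 mul0r scale0r.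
Qed.

Lemma twisted_mulA : associative comp ->
  (forall a b d, c a b * c (comp a b) d = c b d * c a (comp b d)) ->
  associative twisted_mul.
Proof.
move=> cA cc; have := (twisted_mulZl, twisted_mulZr, twisted_mul_delta).
move: twisted_mul twisted_mul_suml twisted_mul_sumr.
move=> mul suml sumr mulE x y z.
rewrite [x]deltaE [y]deltaE [z]deltaE.
rewrite !suml; apply: eq_bigr => a _.
rewrite [LHS]sumr (sumr (x a *: _)) suml.
apply: eq_bigr => b _; rewrite !sumr; apply: eq_bigr => d _.
rewrite !mulE cA !scalerA; congr (_ *: _).
move: (x a : R) (y b : R) (z d : R) (cc a b d) => u v w E.
transitivity (u * v * w * (c b d * c a (comp b d))); first by ring.
by rewrite -E; ring.
Qed.

Lemma twisted_mul1x e : left_id e comp -> (forall d, c e d = 1) ->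
  left_id (delta e) twisted_mul.
Proof.
move=> e1 c1 x; rewrite [x]deltaE twisted_mul_sumr; apply: eq_bigr => d _.
by rewrite twisted_mulZr twisted_mul_delta e1 c1 scale1r.
Qed.

Lemma twisted_mulx1 e : right_id e comp -> (forall d, c d e = 1) ->
  right_id (delta e) twisted_mul.
Proof.
move=> e1 c1 x; rewrite [x]deltaE twisted_mul_suml; apply: eq_bigr => d _.
by rewrite twisted_mulZl twisted_mul_delta e1 c1 scale1r.
Qed.

End TwistedProduct.

(* The R-algebra with basis the diagrams and parameter q. *)
Definition part_alg (R : comNzRingType) (q : R) (k : nat) : Type :=
  {ffun diagram k -> R^o}.

Section PartitionAlgebra.
Variables (R : comNzRingType) (q : R) (k : nat).
Local Notation A := (part_alg q k).

HB.instance Definition _ := GRing.Lmodule.on A.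

Definition part_basis (d : diagram k) : A := delta R d.

Definition part_mul : A -> A -> A :=
  twisted_mul (@compose k) (fun a b => q ^+ nmiddle a b).

Lemma part_mulA : associative part_mul.
Proof.
apply: twisted_mulA => [a b d|a b d]; first by case: (composeA a b d).
by rewrite -!exprD; case: (composeA a b d) => ->.
Qed.

Lemma part_mul1x : left_id (part_basis (id_diagram k)) part_mul.
Proof.
by apply: twisted_mul1x => d; case: (compose1d d) => // ->; rewrite expr0.
Qed.

Lemma part_mulx1 : right_id (part_basis (id_diagram k)) part_mul.
Proof.
by apply: twisted_mulx1 => d; case: (composed1 d) => // ->; rewrite expr0.
Qed.

HB.instance Definition _ := GRing.Zmodule_isNzRing.Build A
  part_mulA part_mul1x part_mulx1 (@twisted_mulDl _ _ _ _) (@twisted_mulDr _ _ _ _) (delta_neq0 _ _).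
HB.instance Definition _ := GRing.Lmodule_isLalgebra.Build R A
  (fun c x y => esym (twisted_mulZl _ _ c x y)).
HB.instance Definition _ := GRing.Lalgebra_isAlgebra.Build R A
  (fun c x y => esym (twisted_mulZr _ _ c x y)).

Lemma part_basisM a b :
  part_basis a * part_basis b = q ^+ nmiddle a b *: part_basis (compose a b).
Proof. exact: twisted_mul_delta. Qed.

End PartitionAlgebra.

(* The {poly K}-algebra with parameter z = 'X, regarded as a K-algebra. *)
Definition polypart_alg (K : comNzRingType) (k : nat) : Type :=
  part_alg ('X : {poly K}) k.

Section PartitionAlgebraPoly.
Variables (K : comNzRingType) (k : nat).
Local Notation A := (polypart_alg K k).
Local Notation A' := (part_alg ('X : {poly K}) k).

HB.instance Definition _ := GRing.NzRing.on A.

Let scale (c : K) (x : A) : A := c%:P *: (x : A').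

Let scaleA c d x : scale c (scale d x) = scale (c * d) x.
Proof. by rewrite /scale scalerA polyCM. Qed.
Let scale1 : left_id 1 scale.
Proof. by move=> x; rewrite /scale scale1r. Qed.
Let scaleDr : right_distributive scale +%R.
Proof. by move=> c x y; rewrite /scale scalerDr. Qed.
Let scaleDl x : {morph scale^~ x : c d / c + d}.
Proof. by move=> c d; rewrite /scale polyCD scalerDl. Qed.
HB.instance Definition _ :=
  GRing.Zmodule_isLmodule.Build K A scaleA scale1 scaleDr scaleDl.

Let scaleAl c (x y : A) : c *: (x * y) = c *: x * y.
Proof. exact: (scalerAl c%:P (x : A') y). Qed.
HB.instance Definition _ := GRing.Lmodule_isLalgebra.Build K A scaleAl.

Let scaleAr c (x y : A) : c *: (x * y) = x * (c *: y).
Proof. exact: (scalerAr c%:P (x : A') y). Qed.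
HB.instance Definition _ := GRing.Lalgebra_isAlgebra.Build K A scaleAr.

Definition part_z : A := 'X *: (1 : A').

(* The blocks are the sets of vertices with the same label. *)
Definition s_diagram (i : nat) : diagram k :=
  fibre_diagram (fun p : vertex k => match p with
    | inl r => r.+1
    | inr r => if r.+1 == i then i.+1 else if r.+1 == i.+1 then i else r.+1
    end).

(* e_{2j-1}; no top vertex has label 0. *)
Definition e_odd_diagram (j : nat) : diagram k :=
  fibre_diagram (fun p : vertex k => match p with
    | inl r => r.+1
    | inr r => if r.+1 == j then 0%N else r.+1
    end).

(* e_{2i} *)
Definition e_even_diagram (i : nat) : diagram k :=
  fibre_diagram (fun p : vertex k => match p with
    | inl r | inr r => if r.+1 == i.+1 then i else r.+1
    end).

(* The indices of s_i and e_i start at 1, as those of the vertices. *)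
Definition part_s (i : nat) : A := part_basis 'X (s_diagram i).
Definition part_e (i : nat) : A :=
  part_basis 'X (if odd i then e_odd_diagram i.+1./2 else e_even_diagram i./2).

End PartitionAlgebraPoly.

Inductive two_sided_ideal (A : nzRingType) (rel : A -> A -> Prop) : A -> Prop :=
| tsi_rel u v : rel u v -> two_sided_ideal rel (u - v)
| tsi_0 : two_sided_ideal rel 0
| tsi_sub u v :
    two_sided_ideal rel u -> two_sided_ideal rel v -> two_sided_ideal rel (u - v)
| tsi_mul a u b : two_sided_ideal rel u -> two_sided_ideal rel (a * u * b).

Inductive generator := GTau of nat | GE of nat | GX of nat | GZ of nat.

Definition generator_code g : nat * nat :=
  match g with
  | GTau i => (0, i) | GE i => (1, i) | GX i => (2, i) | GZ l => (3, l)
  end.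
Definition generator_decode (c : nat * nat) : generator :=
  match c with
  | (0, i) => GTau i | (1, i) => GE i | (2, i) => GX i | (_, l) => GZ l
  end.
Lemma generator_codeK : cancel generator_code generator_decode.
Proof. by case. Qed.
HB.instance Definition _ := Choice.copy generator (can_type generator_codeK).

Definition gen_defined (k : nat) (g : generator) : bool :=
  match g with
  | GTau i => 2 <= i <= k.*2.-1
  | GE j => 1 <= j <= k.*2.-1
  | GX r => 1 <= r <= k.*2
  | GZ _ => true
  end%N.

Section AffineRelations.
Variables (A : nzRingType) (k : nat) (tau e x z : nat -> A).

Local Notation s i := (tau i.*2 * tau i.*2.+1 + e i.*2).
Local Notation def gs := (all (gen_defined k) gs).

(* [def] says that all generators involved in a relation are defined; it stands
   for the range of indices of the relations given without an explicit range.
   Truncated predecessors are harmless: they produce the index 0, for which no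
   tau, e or x is defined. *)
Inductive aff_rel : A -> A -> Prop :=
| ar_tau_even_sqr i : (1 <= i <= k.-1)%N -> aff_rel (tau i.*2 ^+ 2) (1 - e i.*2)
| ar_tau_odd_sqr i : (1 <= i <= k.-1)%N -> aff_rel (tau i.*2.+1 ^+ 2) (1 - e i.*2)
| ar_tau_odd_tau_even_comm i j : def [:: GTau i.*2.+1; GTau j.*2] -> j != i.+1 ->
    aff_rel (tau i.*2.+1 * tau j.*2) (tau j.*2 * tau i.*2.+1)
| ar_tau_odd_comm i j : def [:: GTau i.*2.+1; GTau j.*2.+1] -> j != i.-1 -> j != i.+1 ->
    aff_rel (tau i.*2.+1 * tau j.*2.+1) (tau j.*2.+1 * tau i.*2.+1)
| ar_tau_even_comm i j : def [:: GTau i.*2; GTau j.*2] -> j != i.-1 -> j != i.+1 ->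
    aff_rel (tau i.*2 * tau j.*2) (tau j.*2 * tau i.*2)
| ar_s_braid i : (1 <= i <= k.-2)%N -> aff_rel (s i * s i.+1 * s i) (s i.+1 * s i * s i.+1)
| ar_e_odd_sqr i : (1 <= i <= k)%N -> aff_rel (e i.*2.-1 ^+ 2) (z 0 * e i.*2.-1)
| ar_e_even_sqr i : (1 <= i <= k.-1)%N -> aff_rel (e i.*2 ^+ 2) (e i.*2)
| ar_tau_odd_e_even0 i : (1 <= i <= k.-1)%N -> aff_rel (tau i.*2.+1 * e i.*2) 0
| ar_e_even_tau_odd0 i : (1 <= i <= k.-1)%N -> aff_rel (e i.*2 * tau i.*2.+1) 0
| ar_tau_even_e_even0 i : (1 <= i <= k.-1)%N -> aff_rel (tau i.*2 * e i.*2) 0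
| ar_e_even_tau_even0 i : (1 <= i <= k.-1)%N -> aff_rel (e i.*2 * tau i.*2) 0
| ar_tau_e_e i : (1 <= i <= k.-1)%N ->
    aff_rel (tau i.*2 * e i.*2.-1 * e i.*2.+1) (tau i.*2.+1 * e i.*2.-1 * e i.*2.+1)
| ar_e_e_tau i : (1 <= i <= k.-1)%N ->
    aff_rel (e i.*2.+1 * e i.*2.-1 * tau i.*2) (e i.*2.+1 * e i.*2.-1 * tau i.*2.+1)
| ar_e_comm i j : def [:: GE i; GE j] -> ((i + 2 <= j) || (j + 2 <= i))%N ->
    aff_rel (e i * e j) (e j * e i)
| ar_tau_odd_e_odd_comm i j : def [:: GTau i.*2.-1; GE j.*2.-1] -> j != i.-1 -> j != i ->
    aff_rel (tau i.*2.-1 * e j.*2.-1) (e j.*2.-1 * tau i.*2.-1)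
| ar_tau_odd_e_even_comm i j : def [:: GTau i.*2.-1; GE j.*2] -> j != i ->
    aff_rel (tau i.*2.-1 * e j.*2) (e j.*2 * tau i.*2.-1)
| ar_tau_even_e_odd_comm i j : def [:: GTau i.*2; GE j.*2.-1] -> j != i -> j != i.+1 ->
    aff_rel (tau i.*2 * e j.*2.-1) (e j.*2.-1 * tau i.*2)
| ar_tau_even_e_even_comm i j : def [:: GTau i.*2; GE j.*2] -> j != i.-1 ->
    aff_rel (tau i.*2 * e j.*2) (e j.*2 * tau i.*2)
| ar_e_eS_e i : (1 <= i <= k.*2.-2)%N -> aff_rel (e i * e i.+1 * e i) (e i)
| ar_eS_e_eS i : (1 <= i <= k.*2.-2)%N -> aff_rel (e i.+1 * e i * e i.+1) (e i.+1)
| ar_tau_e_odd_tau i : (1 <= i <= k.-1)%N ->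
    aff_rel (tau i.*2 * e i.*2.-1 * tau i.*2) (tau i.*2.+1 * e i.*2.+1 * tau i.*2.+1)
| ar_tau_e_even_tau i : (2 <= i <= k.-1)%N ->
    aff_rel (tau i.*2 * e i.*2.-2 * tau i.*2) (tau i.*2.-1 * e i.*2 * tau i.*2.-1)
| ar_x_comm i j : def [:: GX i; GX j] -> aff_rel (x i * x j) (x j * x i)
| ar_tau_x_comm i j : def [:: GTau i; GX j] -> j != i.-1 -> j != i -> j != i.+1 ->
    aff_rel (tau i * x j) (x j * tau i)
| ar_e_x_comm i j : def [:: GE i; GX j] -> j != i -> j != i.+1 ->
    aff_rel (e i * x j) (x j * e i)
| ar_tau_even_braid i : def [:: GTau i.*2.-2; GTau i.*2; GE i.*2.-2] ->
    aff_rel (tau i.*2.-2 * tau i.*2 * tau i.*2.-2)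
            (tau i.*2 * tau i.*2.-2 * tau i.*2 * (1 - e i.*2.-2))
| ar_tau_odd_braid i : def [:: GTau i.*2.+1; GTau i.*2.-1; GE i.*2] ->
    aff_rel (tau i.*2.+1 * tau i.*2.-1 * tau i.*2.+1)
            (tau i.*2.-1 * tau i.*2.+1 * tau i.*2.-1 * (1 - e i.*2))
| ar_tau_odd_even_odd i : def [:: GTau i.*2.-1; GTau i.*2; GE i.*2.-2] ->
    aff_rel (tau i.*2.-1 * tau i.*2 * tau i.*2.-1)
            (tau i.*2 - e i.*2.-2 * tau i.*2 - tau i.*2 * e i.*2.-2)
| ar_tau_even_odd_even i : def [:: GTau i.*2; GTau i.*2.-1; GE i.*2] ->
    aff_rel (tau i.*2 * tau i.*2.-1 * tau i.*2)
            (tau i.*2.-1 - e i.*2 * tau i.*2.-1 - tau i.*2.-1 * e i.*2)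
| ar_x_odd_rec i : def [:: GX i.*2.+1; GTau i.*2; GX i.*2.-1; GE i.*2; GE i.*2.-1] ->
    aff_rel (x i.*2.+1)
      (tau i.*2 * x i.*2.-1 * tau i.*2 + e i.*2 * e i.*2.-1 * tau i.*2
       + tau i.*2 * e i.*2.-1 * e i.*2 - tau i.*2)
| ar_x_even_rec i : def [:: GX i.*2.+2; GTau i.*2.+1; GX i.*2; GE i.*2; GE i.*2.+1] ->
    aff_rel (x i.*2.+2)
      (tau i.*2.+1 * x i.*2 * tau i.*2.+1
       + e i.*2 * e i.*2.+1 * tau i.*2.+1 * e i.*2.+1 * e i.*2 + tau i.*2.+1)
| ar_x_even_tau_even i : def [:: GX i.*2; GTau i.*2; GE i.*2; GE i.*2.-1] ->
    aff_rel (x i.*2)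
      (tau i.*2 * x i.*2 * tau i.*2 + e i.*2 * e i.*2.-1 * tau i.*2
       + tau i.*2 * e i.*2.-1 * e i.*2)
| ar_x_odd_tau_odd i : def [:: GX i.*2.+1; GTau i.*2.+1; GE i.*2; GE i.*2.+1] ->
    aff_rel (x i.*2.+1)
      (tau i.*2.+1 * x i.*2.+1 * tau i.*2.+1 + e i.*2 * e i.*2.+1 * tau i.*2.+1
       + tau i.*2.+1 * e i.*2.+1 * e i.*2)
| ar_e_x_sub0 i : (1 <= i <= k.*2.-1)%N -> aff_rel (e i * (x i - x i.+1)) 0
| ar_x_sub_e0 i : (1 <= i <= k.*2.-1)%N -> aff_rel ((x i - x i.+1) * e i) 0
| ar_e_x_exp_e l : (1 <= l)%N -> aff_rel (e 1 * x 1 ^+ l * e 1) (z l * e 1)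
| ar_z_central l (u : A) : aff_rel (z l * u) (u * z l).

End AffineRelations.

Section Character.
(* tau_i -> 1, e_j -> 0, x_{2i+1} -> - i, x_{2i} -> i, z_l -> 0 respects the
   relations, so that the affine partition algebra is non-trivial. *)
Variables (A : nzRingType) (K : comNzRingType) (k : nat).
Variables (tau e x z : nat -> A) (ev : {rmorphism A -> K}).
Hypothesis ev_tau : forall i, (2 <= i <= k.*2.-1)%N -> ev (tau i) = 1.
Hypothesis ev_e : forall i, ev (e i) = 0.
Hypothesis ev_z : forall i, ev (z i) = 0.
Hypothesis ev_x : forall r, (1 <= r <= k.*2)%N ->
  ev (x r) = if odd r then - r./2%:R else r./2%:R.

Lemma aff_rel_ev u v : aff_rel k tau e x z u v -> ev u = ev v.
Proof.
case=> *; rewrite ?(rmorphM, rmorphXn, rmorphD, rmorphB, rmorphN, rmorph1, rmorph0) /=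
  ?(ev_e, ev_z) ?(mulr0, mul0r, addr0, add0r, subr0, expr0n) //=;
  try (by rewrite mulrC).
all: try match goal with h : is_true (all _ _) |- _ => rewrite /= in h end.
all: try (by rewrite !ev_tau ?expr1n ?mulr1 //; lia).
all: match goal with i : nat, h : is_true (_ && _) |- _ =>
  destruct i; rewrite ?doubleS /= in h *; try lia end.
all: rewrite !ev_tau ?ev_x ?mul1r ?mulr1 /= ?odd_double /= ?negbK; try lia.
all: rewrite ?uphalf_double ?doubleK -?natr1 ?opprD //.
Qed.

End Character.

Section AffinePartitionAlgebra.
Variables (K : comNzRingType) (k : nat).

(* The free associative K-algebra on the generators. *)
Definition free_aff : Type := {malg K[{fmonom {g : generator | gen_defined k g}}]}.
HB.instance Definition _ := GRing.Lalgebra.on free_aff.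
Local Notation F := free_aff.

Let free_scaleAr c (u v : F) : c *: (u * v) = u * (c *: v).
Proof.
have cC : c%:MP * u = u * c%:MP :> F.
  rewrite [LHS]fgmulUg [RHS]fgmulgU; apply: eq_bigr => m _.
  by rewrite mulrC mul1m mulm1.
transitivity ((c%:MP : F) * (u * v)); first exact/esym/mul_malgC.
by rewrite mulrA cC -mulrA; congr (_ * _); apply: mul_malgC.
Qed.
HB.instance Definition _ := GRing.Lalgebra_isAlgebra.Build K F free_scaleAr.

(* Junk value 0 on an undefined generator. *)
Definition gen (g : generator) : F :=
  if insub g is Some h then mkmalgU (fmu h) 1 else 0.

Definition free_rel : F -> F -> Prop :=
  aff_rel k (fun i => gen (GTau i)) (fun j => gen (GE j))
    (fun r => gen (GX r)) (fun l => gen (GZ l)).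

Definition aff_ideal : {pred F} := fun u => `[< two_sided_ideal free_rel u >].

Let idealP u : reflect (two_sided_ideal free_rel u) (u \in aff_ideal).
Proof. exact: asboolP. Qed.

Let ideal_zmod_closed : zmod_closed aff_ideal.
Proof.
split; first by apply/idealP/tsi_0.
by move=> u v /idealP Iu /idealP Iv; apply/idealP/tsi_sub.
Qed.
HB.instance Definition _ := GRing.isZmodClosed.Build F aff_ideal ideal_zmod_closed.

Let idealMl u v : v \in aff_ideal -> u * v \in aff_ideal.
Proof. by move=> /idealP Iv; rewrite -[u * v]mulr1; apply/idealP/tsi_mul. Qed.

Let idealMr u v : u \in aff_ideal -> u * v \in aff_ideal.
Proof. by move=> /idealP Iu; rewrite -[u]mul1r; apply/idealP/tsi_mul. Qed.

Let chi (g : generator) : K :=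
  match g with
  | GTau _ => 1
  | GX r => if odd r then - r./2%:R else r./2%:R
  | _ => 0
  end.

Let chim (m : {fmonom {g : generator | gen_defined k g}}) : K :=
  \prod_(g <- fmonom_val m) chi (val g).

Let chim_morph : mmorphism chim.
Proof.
split=> [m n|]; last by rewrite /chim fm1 big_nil.
by rewrite /chim fmM big_cat.
Qed.
HB.instance Definition _ := isMultiplicative.Build _ K chim chim_morph.

Let ev : {rmorphism F -> K} := mmap idfun chim.

Let ev_gen g : ev (gen g) = if gen_defined k g then chi g else 0.
Proof.
rewrite /gen; case: insubP => [h dg hE|/negbTE ->]; last by rewrite rmorph0.
by rewrite dg /ev /= mmapU mul1r /chim fmU big_seq1 hE.
Qed.

Let ideal1 : 1 \notin aff_ideal.
Proof.
apply/idealP => I1; suff /eqP : ev 1 = 0 by rewrite rmorph1 oner_eq0.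
elim: I1 => [u v uv||u v _ u0 _ v0|a u b _ u0]; rewrite ?rmorph0 //.
- rewrite rmorphB; apply/eqP; rewrite subr_eq0; apply/eqP.
  by apply: aff_rel_ev uv => i; rewrite ev_gen //= ?if_same // => ->.
- by rewrite rmorphB u0 v0 subrr.
- by rewrite !rmorphM u0 mulr0 mul0r.
Qed.

Definition aff_part_alg : Type := Quotient.quot aff_ideal.
Local Notation Q := aff_part_alg.
HB.instance Definition _ := GRing.Zmodule.on Q.
HB.instance Definition _ := EqQuotient.on Q.

Definition aff_pi (u : F) : Q := \pi_(Quotient.quot aff_ideal)%qT u.

Let piP u v : reflect (aff_pi u = aff_pi v) (u - v \in aff_ideal).
Proof. by rewrite Quotient.idealrBE; apply: eqP. Qed.

Let piK (q : Q) : aff_pi (repr (q : Quotient.quot aff_ideal)) = q.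
Proof. exact: reprK. Qed.

Let lift (q : Q) : F := repr (q : Quotient.quot aff_ideal).

Let piD u v : aff_pi (u + v) = aff_pi u + aff_pi v.
Proof. exact: Quotient.pi_add. Qed.

Let mul (p q : Q) : Q := aff_pi (lift p * lift q).
Let scale (c : K) (q : Q) : Q := aff_pi (c *: lift q).

Let pi_mul u v : mul (aff_pi u) (aff_pi v) = aff_pi (u * v).
Proof.
apply/piP; set u' := lift _; set v' := lift _.
have -> : u' * v' - u * v = (u' - u) * v' + u * (v' - v).
  by rewrite mulrBl mulrBr addrA subrK.
by apply: rpredD; [apply: idealMr|apply: idealMl]; apply/piP/piK.
Qed.

Let pi_scale c u : scale c (aff_pi u) = aff_pi (c *: u).
Proof.
apply/piP; rewrite -scalerBr -mulr_algl.
by apply: idealMl; apply/piP/piK.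
Qed.

Let piE (P : Q -> Prop) : (forall u, P (aff_pi u)) -> forall q, P q.
Proof. by move=> h q; rewrite -(piK q). Qed.

Let mulA : associative mul.
Proof.
by elim/piE=> u; elim/piE=> v; elim/piE=> w; rewrite !pi_mul mulrA.
Qed.
Let mul1 : left_id (aff_pi 1) mul.
Proof. by elim/piE=> u; rewrite pi_mul mul1r. Qed.
Let mulx1 : right_id (aff_pi 1) mul.
Proof. by elim/piE=> u; rewrite pi_mul mulr1. Qed.
Let mulDl : left_distributive mul +%R.
Proof.
by elim/piE=> u; elim/piE=> v; elim/piE=> w; rewrite -piD !pi_mul -piD mulrDl.
Qed.
Let mulDr : right_distributive mul +%R.
Proof.
by elim/piE=> u; elim/piE=> v; elim/piE=> w; rewrite -piD !pi_mul -piD mulrDr.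
Qed.
Let one_neq0 : aff_pi 1 != 0.
Proof.
apply/eqP => h; case/negP: ideal1; rewrite -[1]subr0; apply/piP.
by rewrite h; apply/esym/(addIr (aff_pi 0)); rewrite -piD !add0r.
Qed.
HB.instance Definition _ := GRing.Zmodule_isNzRing.Build Q
  mulA mul1 mulx1 mulDl mulDr one_neq0.

Let scaleA c d q : scale c (scale d q) = scale (c * d) q.
Proof. by elim/piE: q => u; rewrite !pi_scale scalerA. Qed.
Let scale1 : left_id 1 scale.
Proof. by elim/piE=> u; rewrite pi_scale scale1r. Qed.
Let scaleDr : right_distributive scale +%R.
Proof.
by move=> c; elim/piE=> u; elim/piE=> v; rewrite -piD !pi_scale -piD scalerDr.
Qed.
Let scaleDl q : {morph scale^~ q : c d / c + d}.
Proof. by elim/piE: q => u c d; rewrite !pi_scale -piD scalerDl. Qed.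
HB.instance Definition _ :=
  GRing.Zmodule_isLmodule.Build K Q scaleA scale1 scaleDr scaleDl.

Let scaleAl c (p q : Q) : c *: (p * q) = c *: p * q.
Proof.
elim/piE: p => u; elim/piE: q => v; rewrite -[LHS]/(scale c (mul _ _)).
by rewrite -[RHS]/(mul (scale c _) _) !(pi_mul, pi_scale) scalerAl.
Qed.
HB.instance Definition _ := GRing.Lmodule_isLalgebra.Build K Q scaleAl.

Let scaleAr c (p q : Q) : c *: (p * q) = p * (c *: q).
Proof.
elim/piE: p => u; elim/piE: q => v; rewrite -[LHS]/(scale c (mul _ _)).
rewrite -[RHS]/(mul _ (scale c _)) !(pi_mul, pi_scale).
by rewrite scalerAr.
Qed.
HB.instance Definition _ := GRing.Lalgebra_isAlgebra.Build K Q scaleAr.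

Lemma aff_pi_is_zmod_morphism : zmod_morphism aff_pi.
Proof. by move=> u v; apply: (addIr (aff_pi v)); rewrite -piD !subrK.
Qed.
Lemma aff_pi_is_monoid_morphism : monoid_morphism aff_pi.
Proof.
split; first exact: erefl.
by move=> u v; apply/esym; apply: pi_mul. Qed.
Lemma aff_pi_is_scalable : scalable aff_pi.
Proof. by move=> c u; apply/esym; apply: pi_scale. Qed.
HB.instance Definition _ := GRing.isZmodMorphism.Build F Q aff_pi aff_pi_is_zmod_morphism.
HB.instance Definition _ := GRing.isMonoidMorphism.Build F Q aff_pi aff_pi_is_monoid_morphism.
HB.instance Definition _ := GRing.isScalable.Build K F Q *:%R aff_pi aff_pi_is_scalable.

Lemma aff_pi_eq u v : aff_pi u = aff_pi v <-> two_sided_ideal free_rel (u - v).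
Proof. by split=> [/piP/idealP|/idealP/piP]. Qed.

Definition aff_tau (i : nat) : Q := aff_pi (gen (GTau i)).
Definition aff_e (j : nat) : Q := aff_pi (gen (GE j)).
Definition aff_x (r : nat) : Q := aff_pi (gen (GX r)).
Definition aff_z (l : nat) : Q := aff_pi (gen (GZ l)).

End AffinePartitionAlgebra.

(* Main.v *)
(* The relations (8), (9) of x give e_{2i} e_{2i-1} tau_{2i} = e_{2i} e_{2i+1} tau_{2i+1},
   and with it the elements s_i, e_i and z_0 satisfy the relations of the
   partition algebra. In any ring where these relations hold, every product of
   generators is z^m times a normal form joins * cuts * permutation * joins, and
   two normal forms that present the same diagram are equal; this attaches an
   element of the affine algebra to each diagram.

   The affine algebra acts on the functions on words over N letters, the tensor
   powers of the permutation module, compatibly with the action of the diagrams.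
   Comparing actions for N = 2 shows that products of normal forms follow the
   composition of diagrams, so that the map on diagrams is a homomorphism. When
   N >= 2k the operators of distinct diagrams are linearly independent and z acts
   as N, so that the coefficients of an element of the kernel, which are
   polynomials in z, vanish at infinitely many points. *)
From HB Require Import structures.
Require Import Defs.
From mathcomp Require Import all_boot all_order all_algebra all_fingroup.
From mathcomp Require Import boolp reals.
From mathcomp Require Import zify ring.
From mathcomp.multinomials Require Import monalg.
Set Implicit Arguments.
Unset Strict Implicit.
Unset Printing Implicit Defensive.
Import GRing.Theory Num.Theory.
Local Open Scope ring_scope.

(** * Words in the symmetric group *)

(** The partition algebra is built on its basis of diagrams and comes without a presentation, so
    [iota] cannot be defined by generators and relations: it is defined on the basis, and
    multiplicativity has to be proved for arbitrary pairs of diagrams. The relations only show that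
    a product of two normal forms is some [z ^+ m] times some normal form; the rewriting does not
    reveal which. The action identifies both afterwards. A set partition is determined by its unions
    of blocks, so two colours separate diagrams, and the constant colouring, which respects every
    diagram, isolates [2 ^ m]. This yields an identity in the affine algebra only because normal
    forms of the same diagram are already known to be equal there. The action has to be given on all
    generators, [tau] and [x] included, because it must respect every affine relation to descend to
    the quotient. The bound 2k on the number of letters is the number of vertices: each block can
    then receive a colour of its own. *)

Lemma exists_perm_map (T : finType) (u v : seq T) :
  uniq u -> uniq v -> size u = size v -> exists f : {perm T}, map f u = v.
Proof.
elim: u v => [|x u IHu] [|y v] //=; first by exists 1%g.
move=> /andP[xu uu] /andP[yv uv] [suv]; have [f fuv] := IHu v uu uv suv.
(* Products act from left to right: the transposition corrects the value at [x] and fixes all of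
   [v], which contains neither [f x] nor [y]. *)
exists (f * tperm (f x) y)%g; rewrite permM tpermL; congr cons.
rewrite -[RHS]fuv; apply/eq_in_map => a au.
rewrite permM tpermD //; first by rewrite (inj_eq perm_inj); apply: contraNneq xu => ->.
by apply: contraNneq yv => ->; rewrite -fuv map_f.
Qed.

Lemma tperm_braid (T : finType) (x y w : T) : x != y -> x != w -> y != w ->
  (tperm x y * (tperm y w * tperm x y) = tperm y w * (tperm x y * tperm y w))%g.
Proof.
move=> xy xw yw; apply/permP => a; rewrite !permM.
have exy : tperm x y w = w by rewrite tpermD.
have eyw : tperm y w x = x by rewrite tpermD // eq_sym.
have [->|ax] := eqVneq a x; first by do !rewrite ?tpermL ?tpermR ?exy ?eyw.
have [->|ay] := eqVneq a y; first by do !rewrite ?tpermL ?tpermR ?exy ?eyw.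
have [->|aw] := eqVneq a w; first by do !rewrite ?tpermL ?tpermR ?exy ?eyw.
by do 3![rewrite !(@tpermD _ _ _ a) 1?eq_sym //].
Qed.

Section SymmetricGroup.
Variable n : nat.
Implicit Types f g : 'S_n.+1.

Definition adj i : 'S_n.+1 := tperm (inord i) (inord i.+1).

Lemma adj_id i : (adj i * adj i = 1)%g. Proof. exact: tperm2. Qed.

Lemma adjK i f : (adj i * (adj i * f) = f)%g.
Proof. by rewrite mulgA adj_id mul1g. Qed.

Lemma adjML i f : (adj i * f)%g (inord i) = f (inord i.+1).
Proof. by rewrite permM tpermL. Qed.

Lemma adjMR i f : (adj i * f)%g (inord i.+1) = f (inord i).
Proof. by rewrite permM tpermR. Qed.

Lemma inord_eq i j : (i <= n)%N -> (j <= n)%N ->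
  (inord i == inord j :> 'I_n.+1) = (i == j).
Proof. by move=> *; rewrite -val_eqE /= !inordK. Qed.

Lemma adjMD i j f : (i < n)%N -> (j <= n)%N -> j != i -> j != i.+1 ->
  (adj i * f)%g (inord j) = f (inord j).
Proof.
by move=> iltn jn ji ji1; rewrite permM tpermD // inord_eq ?(ltnW iltn) // eq_sym.
Qed.

Definition desc f i := (f (inord i.+1) < f (inord i))%N.

Lemma descN f i : (i < n)%N -> ~~ desc f i = (f (inord i) < f (inord i.+1))%N.
Proof.
move=> iltn; rewrite /desc -leqNgt leq_eqVlt orb_idl // => /eqP E.
have /eqP : inord i = inord i.+1 :> 'I_n.+1 by apply: (@perm_inj _ f); apply: val_inj.
by rewrite inord_eq ?(ltnW iltn) // (ltn_eqF (ltnSn i)).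
Qed.

Lemma desc_adj f i : (i < n)%N -> desc (adj i * f)%g i = ~~ desc f i.
Proof. by move=> iltn; rewrite descN // /desc adjML adjMR. Qed.

Lemma descD f i j : (i < n)%N -> (j < n)%N -> (i.+1 < j)%N || (j.+1 < i)%N ->
  desc (adj i * f)%g j = desc f j.
Proof. by move=> iltn jltn ij; rewrite /desc !adjMD //; lia. Qed.

(** A termination measure in place of the Coxeter length: earlier positions weigh more, so
    exchanging a descent moves the smaller value to the heavier position. *)
Definition perm_weight f := (\sum_(i : 'I_n.+1) (n - i) * f i)%N.

Lemma perm_weight_desc f i : (i < n)%N -> desc f i ->
  (perm_weight (adj i * f)%g < perm_weight f)%N.
Proof.
move=> iltn; rewrite /desc /perm_weight => d.
have nii : inord i.+1 != inord i :> 'I_n.+1 by rewrite inord_eq ?(ltnW iltn) // (gtn_eqF (ltnSn i)).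
rewrite !(bigD1 (inord i) isT) /= !(bigD1 (inord i.+1) nii) /= adjML adjMR.
rewrite [X in (_ + (_ + X) < _)%N](eq_bigr (fun j : 'I_n.+1 => (n - j) * f j)%N);
  last first => [j /andP[ji ji1]|].
  by rewrite permM tpermD // eq_sym.
rewrite !addnA ltn_add2r !inordK ?ltnS ?(ltnW iltn) //.
have -> : (n - i = (n - i.+1).+1)%N by rewrite subnSK.
by rewrite !mulSn; lia.
Qed.

Lemma no_desc f : (forall i, (i < n)%N -> ~~ desc f i) -> f = 1%g.
Proof.
move=> nd; have lo i : (i <= n)%N -> (i <= f (inord i))%N.
  elim: i => // i IHi iltn; apply: leq_ltn_trans (IHi (ltnW iltn)) _.
  by rewrite -descN //; apply: nd.
have hi i : (i <= n)%N -> (f (inord (n - i)) <= n - i)%N.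
  elim: i => [|i IHi] iltn; first by rewrite subn0 leq_ord.
  have := nd (n - i.+1)%N; rewrite subnSK // => /(_ (leq_subr _ _)).
  rewrite descN; last by rewrite ltn_subLR; lia.
  by rewrite subnSK // => h; have := leq_trans h (IHi (ltnW iltn)); lia.
apply/permP => i; rewrite perm1; apply/val_inj/eqP; rewrite eqn_leq.
have := hi (n - i)%N (leq_subr _ _); have := lo i (leq_ord i).
by rewrite subKn ?leq_ord // inord_val => -> ->.
Qed.

(** Induction along reduced expressions: a letter is only put in front at an ascent. *)
Lemma adj_ind (P : 'S_n.+1 -> Prop) : P 1%g ->
  (forall i f, (i < n)%N -> ~~ desc f i -> P f -> P (adj i * f)%g) -> forall f, P f.
Proof.
move=> P1 PS f; have [m] := ubnP (perm_weight f); elim: m f => // m IHm f fm.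
have [/existsP[i di]|/existsPn nd] := boolP [exists i : 'I_n, desc f i].
  rewrite -(adjK i f); apply: PS => //; first by rewrite desc_adj // di.
  by apply: IHm; apply: leq_trans (perm_weight_desc _ di) _.
by rewrite (@no_desc f) // => i iltn; apply: (nd (Ordinal iltn)).
Qed.

(** * Lifting permutations along the Coxeter relations *)

Section Coxeter.
Variables (B : nzRingType) (s : nat -> B).
Hypothesis s_sqr : forall i, (i < n)%N -> s i * s i = 1.
Hypothesis s_comm : forall i j, (i.+1 < j < n)%N -> s i * s j = s j * s i.
Hypothesis s_braid : forall i, (i.+1 < n)%N ->
  s i * s i.+1 * s i = s i.+1 * s i * s i.+1.

(** [x] is the product of the [s i] along some reduced expression of [f]. A relation and not a
    function, since independence of the expression (Matsumoto's theorem) is proved below. *)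
Inductive cox : 'S_n.+1 -> B -> Prop :=
| cox_1 : cox 1%g 1
| cox_adj i f x : (i < n)%N -> ~~ desc f i -> cox f x -> cox (adj i * f)%g (s i * x).

Lemma cox_exists f : exists x, cox f x.
Proof.
elim/adj_ind: f => [|i f iltn di [x fx]]; first by exists 1; apply: cox_1.
by exists (s i * x); apply: cox_adj.
Qed.

Lemma cox_desc f i x : (i < n)%N -> desc f i -> cox (adj i * f)%g x -> cox f (s i * x).
Proof.
move=> iltn di fx; rewrite -(adjK i f); apply: cox_adj => //.
by rewrite desc_adj // di.
Qed.

(* Newman's lemma: two descents i, j of f are completed to a common reduced
   expression, by a commutation if |i - j| > 1 and by a braid if |i - j| = 1. *)
Lemma cox_uniq f x y : cox f x -> cox f y -> x = y.
Proof.
have [m] := ubnP (perm_weight f); elim: m f x y => // m IHm f x y fm fx fy.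
have inv z : cox f z -> (f = 1%g /\ z = 1) \/
    exists i u, [/\ (i < n)%N, desc f i, cox (adj i * f)%g u & z = s i * u].
  case=> [|i g u iltn di gu]; [by left|right; exists i, u; split => //].
    by rewrite desc_adj.
  by rewrite adjK.
have nd1 i : (i < n)%N -> desc f i -> f <> 1%g.
  by move=> iltn di f1; move: di; rewrite f1 /desc !perm1 !inordK ?ltnS ?(ltnW iltn) //; lia.
have {}IHm i u v : (i < n)%N -> desc f i -> cox (adj i * f)%g u ->
    cox (adj i * f)%g v -> u = v.
  by move=> iltn di; apply: IHm; apply: leq_trans (perm_weight_desc _ di) _.
case: (inv x fx) => [[f1 ->]|[i [u [iltn di fu ->]]]].
  case: (inv y fy) => [[_ ->] //|[j [v [jn dj _ _]]]].
  by case: (nd1 j jn dj).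
case: (inv y fy) => [[f1 _]|[j [v [jn dj fv ->]]]]; first by case: (nd1 i iltn di).
clear inv fx fy.
have main i0 j0 u0 v0 : (i0 < j0)%N -> (j0 < n)%N -> desc f i0 -> desc f j0 ->
    cox (adj i0 * f)%g u0 -> cox (adj j0 * f)%g v0 -> s i0 * u0 = s j0 * v0.
  clear i j u v iltn di fu jn dj fv.
  move: i0 j0 u0 v0 => i j u v ij jn di dj fu fv.
  have iltn := ltn_trans ij jn.
  have [ij1|nij1] := eqVneq j i.+1.
    subst j; move: di dj; rewrite /desc => di dj.
    (* [t] lifts what is left of [f] once the values at i, i+1, i+2 are sorted; the two sides of the
       braid relation are the two ways back to [f]. *)
    have [t ct] := cox_exists (adj i * (adj i.+1 * (adj i * f)))%g.
    have E : (adj i * (adj i.+1 * (adj i * f)) = adj i.+1 * (adj i * (adj i.+1 * f)))%g.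
      rewrite !mulgA; congr (_ * f)%g; rewrite -!mulgA; apply: tperm_braid;
        by rewrite inord_eq //; lia.
    have -> : u = s i.+1 * (s i * t).
      apply: (IHm i) => //; apply: cox_desc => //.
        by rewrite /desc adjMR adjMD //; lia.
      apply: cox_desc => //.
      rewrite /desc adjML [in X in (_ < X)%N]adjMD ?adjML ?[in X in (X < _)%N]adjMD //; lia.
    have -> : v = s i * (s i.+1 * t).
      apply: (IHm i.+1) => //; apply: cox_desc => //.
        by rewrite /desc adjML adjMD //; lia.
      apply: cox_desc => //.
        rewrite /desc [in X in (X < _)%N]adjMD ?adjMR ?[in X in (_ < X)%N]adjMD //; lia.
      by rewrite -E.
    by rewrite !mulrA s_braid.
  have ij2 : (i.+1 < j)%N by rewrite ltn_neqAle eq_sym nij1.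
  have C : (adj i * (adj j * f) = adj j * (adj i * f))%g.
    rewrite !mulgA; congr (_ * f)%g.
    by rewrite [LHS]conjgC tpermJ !tpermD // inord_eq //; lia.
  have [t ct] := cox_exists (adj i * (adj j * f))%g.
  have -> : v = s i * t.
    by apply: (IHm j) => //; apply: cox_desc => //; rewrite descD //; lia.
  have -> : u = s j * t.
    apply: (IHm i) => //; apply: cox_desc => //; last by rewrite -C.
    by rewrite descD //; lia.
  by rewrite !mulrA s_comm // ij2.
have [ij|ji|eij] := ltngtP i j.
- exact: main.
- exact/esym/main.
by subst j; rewrite (IHm i u v).
Qed.

Definition perm_lift f : B := projT1 (cid (cox_exists f)).

Lemma cox_perm_lift f : cox f (perm_lift f).
Proof. exact: projT2 (cid (cox_exists f)). Qed.

Lemma perm_lift1 : perm_lift 1%g = 1.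
Proof. exact: cox_uniq (cox_perm_lift _) cox_1. Qed.

(** At a descent the lift of [f] itself begins with [s i], and the two factors cancel by [s_sqr]. *)
Lemma perm_lift_adjM i f : (i < n)%N -> perm_lift (adj i * f)%g = s i * perm_lift f.
Proof.
move=> iltn; have [di|di] := boolP (desc f i); last first.
  exact: cox_uniq (cox_perm_lift _) (cox_adj iltn di (cox_perm_lift f)).
have := cox_uniq (cox_desc iltn di (cox_perm_lift _)) (cox_perm_lift f).
by move=> <-; rewrite mulrA s_sqr ?mul1r.
Qed.

Lemma perm_lift_adj i : (i < n)%N -> perm_lift (adj i) = s i.
Proof. by move=> iltn; rewrite -[adj i]mulg1 perm_lift_adjM // perm_lift1 mulr1. Qed.

Lemma perm_liftM f g : perm_lift (f * g)%g = perm_lift f * perm_lift g.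
Proof.
elim/adj_ind: f => [|i f iltn _ IHf]; first by rewrite mul1g perm_lift1 mul1r.
by rewrite -mulgA !perm_lift_adjM // IHf mulrA.
Qed.

End Coxeter.
End SymmetricGroup.

(** * Normal forms in the partition algebra *)

(** With strands numbered from 0, [s i] crosses and [b i] joins the strands i and i+1, and [p i]
    cuts the strand i. Several relations are only required at the strands 0, 1, 2: conjugation by
    permutations carries them to all other strands. *)
Record partition_relations (B : nzRingType) (n : nat) (s b p : nat -> B) (z : B) : Prop :=
  PartitionRelations {
    pr_s_sqr : forall i, (i < n)%N -> s i * s i = 1;
    pr_s_comm : forall i j, (i.+1 < j < n)%N -> s i * s j = s j * s i;
    pr_s_braid : forall i, (i.+1 < n)%N -> s i * s i.+1 * s i = s i.+1 * s i * s i.+1;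
    pr_b_idem : forall i, (i < n)%N -> b i * b i = b i;
    pr_b_comm : forall i j, (i < n)%N -> (j < n)%N -> b i * b j = b j * b i;
    pr_bs : forall i, (i < n)%N -> b i * s i = b i;
    pr_sb : forall i, (i < n)%N -> s i * b i = b i;
    pr_b0_s_comm : forall i, (1 < i < n)%N -> b 0 * s i = s i * b 0;
    pr_b_shift : forall i, (i.+1 < n)%N -> s i * s i.+1 * b i = b i.+1 * (s i * s i.+1);
    pr_p_sqr : forall i, (i <= n)%N -> p i * p i = z * p i;
    pr_p_comm : forall i j, (i <= n)%N -> (j <= n)%N -> p i * p j = p j * p i;
    pr_p_shift : forall i, (i < n)%N -> s i * p i = p i.+1 * s i;
    pr_p_s_comm : forall i j, (i < n)%N -> (j <= n)%N -> j != i -> j != i.+1 ->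
      p j * s i = s i * p j;
    pr_p2_b0_comm : (1 < n)%N -> p 2 * b 0 = b 0 * p 2;
    pr_pbp : (0 < n)%N -> p 0 * b 0 * p 0 = p 0;
    pr_bpb : (0 < n)%N -> b 0 * p 0 * b 0 = b 0;
    pr_spp : (0 < n)%N -> s 0 * (p 0 * p 1) = p 0 * p 1;
    pr_z_central : forall x, z * x = x * z }.

Lemma prod_perm_eq (B : pzRingType) (I : eqType) (F : I -> B) (u v : seq I) :
  (forall i j, F i * F j = F j * F i) -> perm_eq u v ->
  \prod_(i <- u) F i = \prod_(i <- v) F i.
Proof.
move=> FC; elim: u v => [|x u IHu] v; first by rewrite perm_sym => /perm_nilP ->.
move=> uv; have xv : x \in v by rewrite -(perm_mem uv) mem_head.
move: uv; case/splitPr: xv => v1 v2; rewrite perm_sym -cat1s perm_catCA cat1s perm_cons perm_sym => uv.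
rewrite big_cons (IHu _ uv) !big_cat big_seq1 /= !mulrA; congr (_ * _).
elim: v1 {uv} => [|y v1 IHv]; first by rewrite big_nil mulr1 mul1r.
by rewrite big_cons mulrA FC -mulrA IHv mulrA.
Qed.

Lemma same_trans k (d : diagram k) u v w : same d u v -> same d v w -> same d u w.
Proof. by have /and3P[_ tr _] := blocksP d; rewrite /same => /(same_pblock tr) ->. Qed.

Section Words.
Variables (B : nzRingType) (n : nat) (s b p : nat -> B) (z : B).
Hypothesis R : partition_relations n s b p z.
Local Notation I := 'I_n.+1.
Implicit Types (f g : 'S_n.+1) (J : {set I}).
Local Notation T := (@perm_lift n B s).

Let T1 : T 1%g = 1.
Proof. exact: perm_lift1 (pr_s_comm R) (pr_s_braid R). Qed.

Let TM f g : T (f * g)%g = T f * T g.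
Proof. exact: perm_liftM (pr_s_sqr R) (pr_s_comm R) (pr_s_braid R) f g. Qed.

Let Tadj i : (i < n)%N -> T (adj n i) = s i.
Proof. exact: perm_lift_adj (pr_s_sqr R) (pr_s_comm R) (pr_s_braid R) i. Qed.

Let TV f : T f^-1%g * T f = 1. Proof. by rewrite -TM mulVg T1. Qed.
Let TVr f : T f * T f^-1%g = 1. Proof. by rewrite -TM mulgV T1. Qed.

Lemma cut_perm_shift (i : I) (f : 'S_n.+1) : p i * T f = T f * p (f i).
Proof.
elim/adj_ind: f i => [i|j f jn _ IHf i]; first by rewrite T1 perm1 mulr1 mul1r.
suff E : p i * s j = s j * p (adj n j i).
  by rewrite TM Tadj // mulrA E -!mulrA IHf permM.
have jK : (inord j : I) = j :> nat by rewrite inordK // ltnS ltnW.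
have j1K : (inord j.+1 : I) = j.+1 :> nat by rewrite inordK.
rewrite /adj; case: tpermP => [->|->|ij ij1]; rewrite ?jK ?j1K.
- rewrite -[LHS]mul1r -(pr_s_sqr R jn) -!mulrA (mulrA _ (p j)) (pr_p_shift R jn).
  by rewrite -mulrA (pr_s_sqr R jn) mulr1.
- by rewrite (pr_p_shift R jn).
- rewrite (pr_p_s_comm R jn) ?leq_ord //; apply/eqP => E; [case: ij|case: ij1];
    by apply: val_inj; rewrite /= ?jK ?j1K.
Qed.

Let cj f x := T f^-1%g * x * T f.

Let cjM f x y : cj f (x * y) = cj f x * cj f y.
Proof. by rewrite /cj !mulrA -(mulrA _ (T f)) TVr mulr1. Qed.

Let p_cj f (i : I) : p (f i) = cj f (p i).
Proof. by rewrite /cj -mulrA cut_perm_shift mulrA TV mul1r. Qed.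

Let T_cj f (i j : I) : T (tperm (f i) (f j)) = cj f (T (tperm i j)).
Proof. by rewrite -tpermJ /cj -!TM /conjg mulgA. Qed.

(** This makes [bb] independent of the permutation chosen to move 0, 1 to i, j. A reduced expression
    of a permutation fixing 0 and 1 starts with some [adj i], i > 1: starting with [adj 0] or
    [adj 1] contradicts the ascent condition. *)
Let b0_comm (f : 'S_n.+1) : (0 < n)%N -> f (inord 0) = inord 0 -> f (inord 1) = inord 1 ->
  b 0 * T f = T f * b 0.
Proof.
move=> n0; elim/adj_ind: f => [|i f iltn di IHf]; first by rewrite T1 mulr1 mul1r.
move: di; rewrite descN // => di f0 f1.
have [i2|i2] := ltnP 1 i.
  rewrite TM Tadj // mulrA (pr_b0_s_comm R) ?i2 // -mulrA IHf ?mulrA //.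
    by move: f0; rewrite adjMD //; lia.
  by move: f1; rewrite adjMD //; lia.
case: i iltn di f0 f1 i2 => [|[|//]] iltn di f0 f1 _.
  by move: di f0 f1; rewrite adjML adjMR => + E1 E0; rewrite E1 E0 !inordK.
have ne k l : (k <= n)%N -> (l <= n)%N -> k != l -> f (inord k) != f (inord l).
  by move=> kn ln kl; rewrite (inj_eq perm_inj) inord_eq.
have f0' : f (inord 0) = inord 0 by move: f0; rewrite adjMD.
have f2' : f (inord 2) = inord 1 by move: f1; rewrite adjML.
move: di; rewrite f2' (inordK (_ : 1 < n.+1)%N) // ltnS leqn0 => /eqP f1'.
have := ne 1%N 0%N n0 isT isT; rewrite f0' => /eqP[].
by apply: val_inj; rewrite /= f1' inordK.
Qed.

(* bb i j is the diagram joining the strands i and j. *)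
Definition frame (i j : I) : 'S_n.+1 :=
  (tperm (inord 0) i * tperm (tperm (inord 0) i (inord 1)) j)%g.

Definition bb (i j : I) : B :=
  if i == j then 1 else T (frame i j)^-1%g * b 0 * T (frame i j).

Let frame0 i j : (0 < n)%N -> i != j -> frame i j (inord 0) = i.
Proof.
move=> n0 ij; rewrite permM tpermL; apply: tpermD; last by rewrite eq_sym.
by rewrite -[X in _ != X](tpermL (inord 0) i) (inj_eq perm_inj) inord_eq.
Qed.

Let frame1 i j : frame i j (inord 1) = j.
Proof. by rewrite permM tpermL. Qed.

Let bbE f : (0 < n)%N -> bb (f (inord 0)) (f (inord 1)) = cj f (b 0).
Proof.
move=> n0; have ne : f (inord 0) != f (inord 1) by rewrite (inj_eq perm_inj) inord_eq.
rewrite /bb (negbTE ne); set g := frame _ _.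
have : b 0 * T (f * g^-1)%g = T (f * g^-1)%g * b 0.
  apply: b0_comm => //; rewrite permM; apply: (canLR (permK _)).
    by rewrite frame0.
  by rewrite frame1.
rewrite TM => E; transitivity (T f^-1%g * (T f * T g^-1%g * b 0) * T g).
  by rewrite !mulrA TV mul1r.
by rewrite -E !mulrA -(mulrA _ (T g^-1%g)) TV mulr1.
Qed.

(** The transport principle of this section: an identity about a few distinct strands is conjugate
    to its instance at the strands 0, 1, 2, ..., where it is one of the given relations. *)
Lemma frames (t : seq I) : uniq t ->
  (size t <= n.+1)%N /\ exists f : 'S_n.+1, forall r, (r < size t)%N ->
    f (inord r) = nth ord0 t r.
Proof.
move=> ut; have st : (size t <= n.+1)%N.
  by rewrite -[X in (_ <= X)%N]card_ord -(card_uniqP ut) max_card.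
split=> //; have [||f ft] := @exists_perm_map _ (map inord (iota 0 (size t)) : seq I) t _ ut.
- rewrite map_inj_in_uniq ?iota_uniq // => i j; rewrite !mem_iota /= => it jt /eqP.
  by rewrite inord_eq => [/eqP| |]; lia.
- by rewrite size_map size_iota.
exists f => r rt.
by rewrite -ft (nth_map ord0) ?size_map ?size_iota // (nth_map 0%N) ?size_iota // nth_iota.
Qed.

Let frames2 i j : i != j -> exists f : 'S_n.+1,
  [/\ (0 < n)%N, i = f (inord 0) & j = f (inord 1)].
Proof.
move=> ij; have /frames[st [f ft]] : uniq [:: i; j] by rewrite /= inE ij.
by exists f; rewrite (ft 0%N) // (ft 1%N).
Qed.

Let frames3 i j l : uniq [:: i; j; l] -> exists f : 'S_n.+1,
  [/\ (1 < n)%N, i = f (inord 0), j = f (inord 1) & l = f (inord 2)].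
Proof.
by move=> /frames[st [f ft]]; exists f; rewrite (ft 0%N) // (ft 1%N) // (ft 2%N).
Qed.

Lemma bbii i : bb i i = 1. Proof. by rewrite /bb eqxx. Qed.

Lemma join_perm_shift i j f : bb i j * T f = T f * bb (f i) (f j).
Proof.
have [->|ij] := eqVneq i j; first by rewrite !bbii mulr1 mul1r.
have [g [n0 -> ->]] := frames2 ij; rewrite -!permM !bbE // /cj invMg !TM.
by rewrite !mulrA TVr mul1r.
Qed.

Let bb_cj f i j : bb (f i) (f j) = cj f (bb i j).
Proof. by rewrite /cj -mulrA join_perm_shift mulrA TV mul1r. Qed.

Lemma bb_adj i : (i < n)%N -> bb (inord i) (inord i.+1) = b i.
Proof.
elim: i => [|i IHi] iltn.
  by rewrite -[inord 0]perm1 -[inord 1]perm1 bbE // /cj invg1 T1 mulr1 mul1r.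
have iltn' := ltnW iltn; pose g := (adj n i * adj n i.+1)%g.
have Tg : T g = s i * s i.+1 by rewrite TM !Tadj.
have gi : g (inord i.+1) = inord i by rewrite permM tpermR tpermD // inord_eq //; lia.
have gi1 : g (inord i.+2) = inord i.+1.
  by rewrite permM [adj n i _]tpermD ?tpermR // inord_eq //; lia.
have := join_perm_shift (inord i.+1) (inord i.+2) g.
rewrite gi gi1 IHi // Tg (pr_b_shift R) // -Tg => /(congr1 ( *%R^~ (T g^-1%g))).
by rewrite -!mulrA !TVr !mulr1.
Qed.

Lemma bbC i j : bb i j = bb j i.
Proof.
have [->//|ij] := eqVneq i j; have [f [n0 -> ->]] := frames2 ij.
rewrite !bb_cj; congr (cj f _); rewrite bb_adj //.
have := join_perm_shift (inord 1) (inord 0) (adj n 0).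
rewrite /adj tpermL tpermR bb_adj // Tadj // (pr_sb R) // => /(congr1 ( *%R^~ (s 0))).
by rewrite -mulrA (pr_s_sqr R) // mulr1 => ->; rewrite (pr_bs R).
Qed.

Lemma bb_idem i j : bb i j * bb i j = bb i j.
Proof.
have [->|ij] := eqVneq i j; first by rewrite bbii mulr1.
have [f [n0 -> ->]] := frames2 ij.
by rewrite !bb_cj -cjM bb_adj // (pr_b_idem R).
Qed.

Lemma bb_comm i j l m : bb i j * bb l m = bb l m * bb i j.
Proof.
have [->|ij] := eqVneq i j; first by rewrite bbii mulr1 mul1r.
have [->|lm] := eqVneq l m; first by rewrite bbii mulr1 mul1r.
have share (a c e : I) : a != c -> c != e -> bb a c * bb c e = bb c e * bb a c.
  move=> ac ce; have [->|ae] := eqVneq a e; first by rewrite (bbC e c).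
  have /frames3[f [n1 -> -> ->]] : uniq [:: a; c; e] by rewrite /= !inE negb_or ac ae ce.
  rewrite !bb_cj -!cjM; congr (cj f _).
  by rewrite !bb_adj 1?(pr_b_comm R) // ltnW.
have [il|il] := eqVneq i l; first by subst l; rewrite (bbC i j) share // eq_sym.
have [im|im] := eqVneq i m.
  by subst m; rewrite (bbC i j) (bbC l i) share // 1?eq_sym.
have [jl|jl] := eqVneq j l; first by subst l; rewrite share.
have [jm|jm] := eqVneq j m; first by subst m; rewrite (bbC l j) share // eq_sym.
have /frames[st [f ft]] : uniq [:: i; j; l; m].
  by rewrite /= !inE !negb_or ij il im jl jm lm.
rewrite -[i](ft 0%N isT) -[j](ft 1%N isT) -[l](ft 2%N isT) -[m](ft 3%N isT).
rewrite !bb_cj -!cjM; congr (cj f _).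
by rewrite !bb_adj 1?(pr_b_comm R) //; move: st => /=; lia.
Qed.

Lemma bb_tperm i j : bb i j * T (tperm i j) = bb i j.
Proof.
have [->|ij] := eqVneq i j; first by rewrite tperm1 T1 mulr1.
have [f [n0 -> ->]] := frames2 ij.
by rewrite T_cj bb_cj -cjM bb_adj // Tadj // (pr_bs R).
Qed.

Lemma tperm_bb i j : T (tperm i j) * bb i j = bb i j.
Proof.
have := join_perm_shift j i (tperm i j); rewrite tpermL tpermR => <-.
by rewrite (bbC j i) bb_tperm.
Qed.

(** [bb i j] absorbs the transposition of i and j; pulling this transposition through the second
    join moves its end from j to i. *)
Lemma bb_tri i j l : bb i j * bb j l = bb i j * bb i l.
Proof.
have [->//|ij] := eqVneq i j.
have [->|jl] := eqVneq l j; first by rewrite bbii mulr1 bb_idem.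
have [->|il] := eqVneq l i; first by rewrite bbii mulr1 (bbC j) bb_idem.
have E : T (tperm i j) * bb j l = bb i l * T (tperm i j).
  by rewrite join_perm_shift tpermL tpermD // eq_sym.
by rewrite -{1}(bb_tperm i j) -mulrA E mulrA bb_comm -mulrA bb_tperm bb_comm.
Qed.

Lemma bb_tri_absorb i j l : bb i l * (bb i j * bb j l) = bb i j * bb j l.
Proof. by rewrite bb_tri mulrA [bb i l * _]bb_comm -mulrA bb_idem. Qed.

Lemma p_bb_comm (l i j : I) : l != i -> l != j -> p l * bb i j = bb i j * p l.
Proof.
have [->|ij] := eqVneq i j; first by rewrite bbii mulr1 mul1r.
move=> li lj; have /frames3[f [n1 -> -> ->]] : uniq [:: i; j; l].
  by rewrite /= !inE negb_or ij ![_ == l]eq_sym li lj.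
rewrite !p_cj bb_cj -!cjM; congr (cj f _); rewrite bb_adj 1?ltnW //.
by rewrite inordK // (pr_p2_b0_comm R).
Qed.

Lemma pbp (i j : I) : i != j -> p i * bb i j * p i = p i.
Proof.
move=> /frames2[f [n0 -> ->]]; rewrite p_cj bb_cj -!cjM bb_adj // inordK //.
by rewrite (pr_pbp R).
Qed.

Lemma bpb (i j : I) : i != j -> bb i j * p i * bb i j = bb i j.
Proof.
move=> /frames2[f [n0 -> ->]]; rewrite p_cj bb_cj -!cjM bb_adj // inordK //.
by rewrite (pr_bpb R).
Qed.

Lemma pI_comm (i j : I) : p i * p j = p j * p i.
Proof. by rewrite (pr_p_comm R) ?leq_ord. Qed.

Lemma tperm_pp (i j : I) : i != j -> T (tperm i j) * (p i * p j) = p i * p j.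
Proof.
move=> /frames2[f [n0 -> ->]]; rewrite !p_cj T_cj -!cjM Tadj // !inordK ?ltnS ?(ltnW n0) //.
by rewrite (pr_spp R).
Qed.

Definition joins (L : seq (I * I)) : B := \prod_(e <- L) bb e.1 e.2.
Definition cuts (J : {set I}) : B := \prod_(i <- enum J) p i.

Lemma joins_cons e L : joins (e :: L) = bb e.1 e.2 * joins L.
Proof. exact: big_cons. Qed.

Lemma bb_joins i j L : bb i j * joins L = joins L * bb i j.
Proof.
elim: L => [|e L IHL]; first by rewrite /joins big_nil mulr1 mul1r.
by rewrite joins_cons mulrA bb_comm -!mulrA IHL.
Qed.

Lemma joins_absorb e L : e \in L -> bb e.1 e.2 * joins L = joins L.
Proof.
elim: L => // a L IHL; rewrite inE => /orP[/eqP ->|eL].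
  by rewrite joins_cons mulrA bb_idem.
by rewrite joins_cons mulrA bb_comm -mulrA IHL.
Qed.

Lemma joins_absorbl x L : (forall e, e \in L -> bb e.1 e.2 * x = x) -> joins L * x = x.
Proof.
elim: L => [|e L IHL] xL; first by rewrite /joins big_nil mul1r.
rewrite joins_cons -mulrA IHL ?xL ?mem_head // => a aL.
by rewrite xL // inE aL orbT.
Qed.

Lemma joins_absorbr x L : (forall e, e \in L -> x * bb e.1 e.2 = x) -> x * joins L = x.
Proof.
elim: L => [|e L IHL] xL; first by rewrite /joins big_nil mulr1.
rewrite joins_cons mulrA xL ?mem_head // IHL // => a aL.
by rewrite xL // inE aL orbT.
Qed.

Lemma joins_shift (f : 'S_n.+1) L :
  joins L * T f = T f * joins [seq (f e.1, f e.2) | e <- L].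
Proof.
elim: L => [|e L IHL] /=; first by rewrite /joins !big_nil mulr1 mul1r.
by rewrite !joins_cons -mulrA IHL mulrA join_perm_shift mulrA.
Qed.

Lemma cuts_shift (f : 'S_n.+1) J : cuts J * T f = T f * cuts (f @: J).
Proof.
have -> : cuts (f @: J) = \prod_(i <- map f (enum J)) p i.
  apply: prod_perm_eq => [i j|]; first exact: pI_comm.
  apply: uniq_perm; rewrite ?(map_inj_uniq perm_inj) ?enum_uniq // => i.
  rewrite mem_enum; apply/imsetP/mapP => -[j Jj ->]; exists j => //.
    by rewrite mem_enum.
  by rewrite -mem_enum.
rewrite /cuts; elim: (enum J) => [|i t IHt] /=; first by rewrite !big_nil mulr1 mul1r.
by rewrite !big_cons -mulrA IHt mulrA cut_perm_shift mulrA.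
Qed.

Lemma cutsU1 i (J : {set I}) : i \notin J -> cuts (i |: J) = p i * cuts J.
Proof.
move=> iJ; rewrite -[RHS](big_cons _ _ i (enum J) xpredT (fun j : I => p j)).
apply: prod_perm_eq => [j l|]; first exact: pI_comm.
apply: uniq_perm; rewrite /= ?mem_enum ?iJ ?enum_uniq // => j.
by rewrite !inE !mem_enum !inE.
Qed.

Lemma cutsD1 i (J : {set I}) : i \in J -> cuts J = p i * cuts (J :\ i).
Proof. by move=> iJ; rewrite -cutsU1 ?setD1K // !inE eqxx. Qed.

Lemma p_cuts_in (i : I) (J : {set I}) : i \in J -> p i * cuts J = z * cuts J.
Proof. by move=> /cutsD1 ->; rewrite mulrA (pr_p_sqr R) ?leq_ord // mulrA. Qed.

Lemma bb_cuts i j (J : {set I}) : i \notin J -> j \notin J ->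
  bb i j * cuts J = cuts J * bb i j.
Proof.
rewrite -(mem_enum J i) -(mem_enum J j) /cuts; elim: (enum J) => [|l t IHt]; first by rewrite big_nil mulr1 mul1r.
rewrite !inE !negb_or => /andP[il it] /andP[jl jt].
by rewrite big_cons mulrA -p_bb_comm 1?eq_sym // -!mulrA IHt.
Qed.

Lemma cuts_tperm (J : {set I}) i j : i \in J -> j \in J -> cuts J * T (tperm i j) = cuts J.
Proof.
have [->|ij] := eqVneq i j; first by rewrite tperm1 T1 mulr1.
move=> iJ jJ; rewrite cuts_shift.
have -> : tperm i j @: J = J.
  apply/setP => l; rewrite -{1}[l](tpermK i j) mem_imset; last exact: perm_inj.
  by case: tpermP => [->|->|]; rewrite ?iJ ?jJ.
rewrite (cutsD1 iJ) (@cutsD1 j) ?mulrA; last by rewrite !inE eq_sym ij.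
by rewrite -(mulrA _ (p i)) tperm_pp.
Qed.

(** Induction on the number of moved points: splitting off [tperm i (f i)], whose two points are
    cut, leaves a permutation that also fixes [f i]. *)
Lemma cuts_perm (J : {set I}) f : (forall i, i \notin J -> f i = i) -> cuts J * T f = cuts J.
Proof.
have [m] := ubnP #|[set i | f i != i]|; elim: m f => // m IHm f fm fJ.
have [/existsP[i fi]|/existsPn f1] := boolP [exists i, f i != i]; last first.
  by rewrite (_ : f = 1%g) ?T1 ?mulr1 //; apply/permP => i; rewrite perm1; apply/eqP/negPn/f1.
have inJ l : f l != l -> l \in J by apply: contraR => /fJ ->.
have ffi : f (f i) != f i by rewrite (inj_eq perm_inj).
pose g := (tperm i (f i) * f)%g.
have -> : f = (tperm i (f i) * g)%g by rewrite mulgA tperm2 mul1g.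
rewrite TM mulrA cuts_tperm ?inJ // IHm //; last first.
  move=> l lJ; rewrite permM tpermD; first exact: fJ.
    by apply: contraNneq lJ => <-; apply: inJ.
  by apply: contraNneq lJ => <-; apply: inJ.
rewrite -ltnS; apply: leq_trans fm; rewrite ltnS; apply: proper_card; apply/properP; split.
  apply/subsetP => l; rewrite !inE; apply: contra => /eqP fl.
  rewrite permM tpermD ?fl //; first by apply: contraNneq fi => ->; rewrite fl.
  by apply: contraNneq ffi => ->; rewrite fl.
by exists (f i); rewrite !inE // negbK permM tpermR.
Qed.

(** Cuts are recorded by top positions: a strand [i] outside [wcut] runs from top [i] to bottom
    [wperm i], and for [i] in [wcut] these two ends are detached. The lists of joins may be
    redundant. *)
Record word := Word {
  wtop : seq (I * I); wcut : {set I}; wperm : 'S_n.+1; wbot : seq (I * I) }.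

Definition word_eval (q : word) : B :=
  joins (wtop q) * cuts (wcut q) * T (wperm q) * joins (wbot q).

Definition zmultiple x := exists m q, x = z ^+ m * word_eval q.

Let zx x : z * x = x * z. Proof. exact: (pr_z_central R). Qed.
Let zm m x : z ^+ m * x = x * z ^+ m.
Proof. by apply/esym; apply: (@commrX _ x z); rewrite /GRing.comm zx. Qed.

Lemma zmultiple_joins L q : zmultiple (joins L * word_eval q).
Proof.
exists 0%N, (Word (L ++ wtop q) (wcut q) (wperm q) (wbot q)).
by rewrite expr0 mul1r /word_eval /= /joins big_cat /= !mulrA.
Qed.

Lemma zmultiple_perm f q : zmultiple (T f * word_eval q).
Proof.
case: q => L J g M; exists 0%N; exists (Word
  [seq ((f^-1)%g e.1, (f^-1)%g e.2) | e <- L] ((f^-1)%g @: J) (f * g)%g M).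
rewrite expr0 mul1r /word_eval /= TM !mulrA; congr (_ * _ * _).
rewrite -[RHS]mulrA cuts_shift -imset_comp (@eq_imset _ _ _ id) => [|i]; last first.
  by rewrite /= permKV.
rewrite imset_id mulrA joins_shift -map_comp; congr (_ * joins _ * _).
by rewrite -[LHS]map_id; apply: eq_map => -[i j]; rewrite /= !permKV.
Qed.

Definition touches (l : I) (e : I * I) := (e.1 != e.2) && ((l == e.1) || (l == e.2)).

Lemma p_joins (l : I) L : ~~ has (touches l) L -> p l * joins L = joins L * p l.
Proof.
elim: L => [|[i j] L IHL] /=; first by rewrite /joins big_nil mulr1 mul1r.
rewrite negb_or => /andP[lij lL]; rewrite joins_cons /= mulrA.
suff -> : p l * bb i j = bb i j * p l by rewrite -!mulrA IHL.
move: lij; rewrite /touches /= negb_and negbK => /orP[/eqP ->|].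
  by rewrite bbii mulr1 mul1r.
by rewrite negb_or => /andP[li lj]; apply: p_bb_comm.
Qed.

Let repl (l l' i : I) := if i == l then l' else i.

(** Next to [bb l l'] each join ending at [l] can be redirected to [l']; this frees [l] for the
    passage of [p l]. *)
Lemma joins_repl l l' L :
  bb l l' * joins L = bb l l' * joins [seq (repl l l' e.1, repl l l' e.2) | e <- L].
Proof.
elim: L => [|[i j] L IHL] //=; rewrite !joins_cons /= !mulrA.
have -> : bb l l' * bb i j = bb l l' * bb (repl l l' i) (repl l l' j).
  rewrite /repl; case: eqVneq => [->|il]; case: eqVneq => [->|jl] //.
  - by rewrite !bbii.
  - by rewrite bb_tri.
  - by rewrite (bbC l) (bbC i) bb_tri (bbC i).
by rewrite ![bb l l' * _]bb_comm -!mulrA IHL.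
Qed.

(** Next to [bb l l'] the strand [l] can be assumed cut. If only [l'] is cut, the two strands are
    exchanged; if neither is, [bpb] creates a cut at [l], and the extra join it produces is moved to
    the bottom. *)
Let uncut l l' (J : {set I}) f M : l != l' ->
  exists (J' : {set I}) f' M', l \in J' /\
  bb l l' * cuts J * T f * joins M = bb l l' * cuts J' * T f' * joins M'.
Proof.
move=> ll'; have [lJ|lJ] := boolP (l \in J); first by exists J, f, M.
have [l'J|l'J] := boolP (l' \in J).
  exists (tperm l l' @: J), (tperm l l' * f)%g, M; split.
    by apply/imsetP; exists l'; rewrite ?tpermR.
  rewrite TM !mulrA; congr (_ * _ * _).
  rewrite -[RHS]mulrA cuts_shift -imset_comp (@eq_imset _ _ _ id) => [|i].
    by rewrite imset_id mulrA bb_tperm.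
  by rewrite /= tpermK.
exists (l |: J), f, ((f l, f l') :: M); split; first by rewrite !inE eqxx.
rewrite cutsU1 // joins_cons /= -{1}(bpb ll').
rewrite -!mulrA (mulrA (bb l l') (cuts J)) bb_cuts // -!mulrA; congr (_ * (_ * (_ * _))).
by rewrite !mulrA join_perm_shift.
Qed.

(** If no join touches [l], then [p l] reaches the cuts and either adds one or yields a factor [z].
    Otherwise all joins at [l] are redirected except one [bb l l'], the strand is made cut, and
    [pbp] removes that last join. *)
Lemma zmultiple_cut (l : I) q : zmultiple (p l * word_eval q).
Proof.
case: q => L J f M; rewrite /word_eval /=.
have [/hasP[[i j] ijL /andP[/= ij lij]]|hL] := boolP (has (touches l) L); last first.
  rewrite !mulrA p_joins // -(mulrA _ (p l)).
  have [lJ|lJ] := boolP (l \in J).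
    by exists 1%N, (Word L J f M); rewrite p_cuts_in // expr1 /word_eval !mulrA zx.
  by exists 0%N, (Word L (l |: J) f M); rewrite expr0 mul1r /word_eval /= cutsU1.
have [l' ll' lL] : exists2 l', l != l' & bb l l' * joins L = joins L.
  case/orP: lij => /eqP->; [exists j => //|exists i; first by rewrite eq_sym].
    exact: (joins_absorb ijL).
  by rewrite bbC; apply: (joins_absorb ijL).
pose L' := [seq (repl l l' e.1, repl l l' e.2) | e <- L].
have nl i' : l != repl l l' i' by rewrite /repl; case: (eqVneq i' l) => // ; rewrite eq_sym.
have pL' : p l * joins L' = joins L' * p l.
  apply: p_joins; apply/hasPn => e /mapP[e' _ ->]; rewrite /touches /=.
  by rewrite !(negbTE (nl _)) andbF.
have [J' [f' [M' [lJ' E]]]] := uncut J f M ll'.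
exists 0%N, (Word L' J' f' M'); rewrite expr0 mul1r /word_eval /=.
rewrite -lL joins_repl bb_joins -/L' -!mulrA (mulrA _ (cuts J)) !(mulrA _ (T f)) E.
rewrite !mulrA pL' (cutsD1 lJ') !mulrA; congr (_ * _ * _ * _).
by rewrite -2!mulrA (mulrA (p l)) pbp.
Qed.

(** The factors of the left word are absorbed one at a time. Exponent and word stay existential
    here; the action on words determines them later. *)
Lemma word_evalM q q' : zmultiple (word_eval q * word_eval q').
Proof.
have step x : (forall q, zmultiple (x * word_eval q)) ->
    forall y, zmultiple y -> zmultiple (x * y).
  move=> xq y [m [q1 ->]]; have [m' [q2 E]] := xq q1.
  by exists (m + m')%N, q2; rewrite mulrA -zm -mulrA E mulrA exprD.
case: q => L J f M; rewrite {1}/word_eval /= -!mulrA.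
apply: (step) => [q1|]; first exact: zmultiple_joins.
suff cutsq q1 : zmultiple (cuts J * word_eval q1).
  apply: (step) => //; apply: (step) => [q1|]; first exact: zmultiple_perm.
  exact: zmultiple_joins.
rewrite /cuts; elim: (enum J) => [|i t IHt].
  by rewrite big_nil mul1r; exists 0%N, q1; rewrite expr0 mul1r.
rewrite big_cons -mulrA; apply: (step) => // q2; exact: zmultiple_cut.
Qed.

Definition respects (q : word) (c : vertex n.+1 -> bool) : Prop :=
  [/\ forall e, e \in wtop q -> c (inl e.1) = c (inl e.2),
      forall e, e \in wbot q -> c (inr e.1) = c (inr e.2) &
      forall i, i \notin wcut q -> c (inl i) = c (inr (wperm q i))].

(** A set partition is determined by the two-valued functions constant on its blocks, so the
    equivalence relation generated by the pieces of the word need not be formed. *)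
Definition presents (d : diagram n.+1) (q : word) : Prop :=
  forall c : vertex n.+1 -> bool,
    respects q c <-> forall u v, same d u v -> c u = c v.

Section Presentation.
Variables (d : diagram n.+1) (q : word).
Hypothesis dq : presents d q.
Local Notation D := (word_eval q).
Local Notation f := (wperm q).

Let top i j := bb i j * D = D.
Let bot i j := D * bb i j = D.

Let topC i j : top i j -> top j i. Proof. by rewrite /top bbC. Qed.
Let botC i j : bot i j -> bot j i. Proof. by rewrite /bot bbC. Qed.

Let top_trans j i l : top i j -> top j l -> top i l.
Proof.
rewrite /top => ij jl; have E : bb i j * bb j l * D = D by rewrite -mulrA jl.
by rewrite -E mulrA bb_tri_absorb.
Qed.

Let bot_trans j i l : bot i j -> bot j l -> bot i l.
Proof.
rewrite /bot => ij jl; have E : D * (bb i j * bb j l) = D by rewrite mulrA ij.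
rewrite -E -mulrA -(mulrA (bb i j)) (bb_comm j l) (mulrA (bb i j)) (bb_comm i j).
by rewrite -(mulrA (bb i l)) bb_tri_absorb.
Qed.

Let top_bot i j : i \notin wcut q -> j \notin wcut q -> bb i j * D = D * bb (f i) (f j).
Proof.
move=> iJ jJ; rewrite /word_eval !mulrA bb_joins -(mulrA _ (bb i j)) bb_cuts //.
rewrite mulrA -(mulrA _ (bb i j) (T f)) join_perm_shift !mulrA.
by rewrite -(mulrA _ (bb (f i) _)) bb_joins !mulrA.
Qed.

Let topE e : e \in wtop q -> top e.1 e.2.
Proof. by move=> eL; rewrite /top /word_eval !mulrA joins_absorb. Qed.

Let botE e : e \in wbot q -> bot e.1 e.2.
Proof. by move=> eM; rewrite /bot /word_eval -!mulrA -bb_joins joins_absorb. Qed.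

Let top_equiv i j l : top j l -> `[< top i j >] = `[< top i l >].
Proof.
by move=> jl; apply: asbool_equiv_eq; split=> /top_trans; apply=> //; apply: topC.
Qed.

Let bot_equiv i j l : bot j l -> `[< bot i j >] = `[< bot i l >].
Proof.
by move=> jl; apply: asbool_equiv_eq; split=> /bot_trans; apply=> //; apply: botC.
Qed.

Let topii i : top i i. Proof. by rewrite /top bbii mul1r. Qed.
Let botii i : bot i i. Proof. by rewrite /bot bbii mulr1. Qed.

(* Colour the vertices by whether the word absorbs the join with [inl i], on
   the left or, after crossing an uncut strand, on the right. *)
Lemma same_top i j : same d (inl i) (inl j) -> bb i j * D = D.
Proof.
pose c (u : vertex n.+1) := match u with
  | inl a => `[< top i a >]
  | inr a => `[< exists2 a0, a0 \notin wcut q & top i a0 /\ bot (f a0) a >] end.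
have rc : respects q c.
  split=> [e /topE eL|e /botE eM|a aJ] /=; first exact: top_equiv.
    by apply: asbool_equiv_eq; split=> -[a0 a0J [ia0 a0e]]; exists a0 => //; split=> //;
      apply: bot_trans a0e _ => //; apply: botC.
  apply: asbool_equiv_eq; split=> [ia|[a0 a0J [ia0 a0a]]]; first by exists a.
  by apply: top_trans ia0 _; rewrite /top top_bot.
by move=> /((dq c).1 rc) /=; rewrite (asboolT (topii i)) => /esym/asboolP.
Qed.

Lemma same_bot i j : same d (inr i) (inr j) -> D * bb i j = D.
Proof.
pose c (u : vertex n.+1) := match u with
  | inr a => `[< bot i a >]
  | inl a => `[< exists2 a0, a0 \notin wcut q & bot i (f a0) /\ top a0 a >] end.
have rc : respects q c.
  split=> [e /topE eL|e /botE eM|a aJ] /=; last 2 first.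
  - exact: bot_equiv.
  - apply: asbool_equiv_eq; split=> [[a0 a0J [ia0 a0a]]|ia]; last by exists a.
    by apply: bot_trans ia0 _; rewrite /bot -top_bot.
  by apply: asbool_equiv_eq; split=> -[a0 a0J [ia0 a0e]]; exists a0 => //; split=> //;
    apply: top_trans a0e _ => //; apply: topC.
by move=> /((dq c).1 rc) /=; rewrite (asboolT (botii i)) => /esym/asboolP.
Qed.

Let respects_same u : respects q (same d u).
Proof.
apply/dq => v w vw; apply/idP/idP => /same_trans; apply=> //.
by rewrite same_sym.
Qed.

Lemma same_cross i : i \notin wcut q -> same d (inl i) (inr (f i)).
Proof. by move=> iJ; have [_ _ <- //] := respects_same (inl i); apply: same_refl. Qed.

(** If all strands of the block were cut, the indicator of its top vertices would respect the word
    and yet separate [inl i] from [inr j]. *)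
Lemma same_uncut i j : same d (inl i) (inr j) ->
  exists2 i0, i0 \notin wcut q & same d (inl i) (inl i0).
Proof.
move=> ij; apply: contrapT => ncut.
pose c (u : vertex n.+1) := if u is inl a then same d (inl i) (inl a) else false.
have rc : respects q c.
  split=> //= [e eL|a aJ]; first by have [-> // _ _] := respects_same (inl i).
  by apply/negP => ia; case: ncut; exists a.
by have := (dq c).1 rc _ _ ij; rewrite /c same_refl.
Qed.

Lemma same_wtop e : e \in wtop q -> same d (inl e.1) (inl e.2).
Proof. by move=> eL; have [<- // _ _] := respects_same (inl e.1); apply: same_refl. Qed.

Lemma same_wbot e : e \in wbot q -> same d (inr e.1) (inr e.2).
Proof. by move=> eM; have [_ <- // _] := respects_same (inr e.1); apply: same_refl. Qed.

End Presentation.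

Section NormalForm.
Variable d : diagram n.+1.

Let dtr u v w : same d u v -> same d v w -> same d u w. Proof. exact: same_trans. Qed.

Let dsym u v : same d u v -> same d v u. Proof. by rewrite same_sym. Qed.

(** All pairs inside blocks are taken, not a spanning set: [E] and [F] then depend on [d] only and
    absorb every join of a word presenting [d]. *)
Let tops := [seq e <- enum {: I * I} | same d (inl e.1) (inl e.2)].
Let bots := [seq e <- enum {: I * I} | same d (inr e.1) (inr e.2)].
Let E := joins tops.
Let F := joins bots.

Let Ebb i j : same d (inl i) (inl j) -> E * bb i j = E.
Proof.
move=> ij; rewrite -bb_joins; apply: (@joins_absorb (i, j)).
by rewrite mem_filter ij mem_enum.
Qed.

Let bbF i j : same d (inr i) (inr j) -> bb i j * F = F.
Proof.
by move=> ij; apply: (@joins_absorb (i, j)); rewrite mem_filter ij mem_enum.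
Qed.

Let X (J : {set I}) f := E * cuts J * T f * F.

(** Uncut strands stay inside blocks, and each block meeting both rows keeps at least one of them;
    under [exact] it keeps exactly one. *)
Let valid (J : {set I}) f :=
  (forall i, i \notin J -> same d (inl i) (inr (f i))) /\
  (forall i j, same d (inl i) (inr j) ->
    exists2 i0, i0 \notin J & same d (inl i) (inl i0)).

Let exact (J : {set I}) := forall i j, i \notin J -> j \notin J ->
  same d (inl i) (inl j) -> i = j.

(** The word absorbs [E] and [F], and these absorb the joins of the word, so [E * word_eval q * F]
    equals both sides. Only the cuts and the permutation remain to be compared between two
    presentations. *)
Let presents_X q : presents d q -> word_eval q = X (wcut q) (wperm q) /\ valid (wcut q) (wperm q).
Proof.
move=> dq; split; last by split; [exact: same_cross|exact: same_uncut].
have EL : E * joins (wtop q) = E.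
  by apply: joins_absorbr => e /(same_wtop dq) eL; apply: Ebb.
have MF : joins (wbot q) * F = F.
  by apply: joins_absorbl => e /(same_wbot dq) eM; apply: bbF.
rewrite /X -EL -MF; transitivity (E * word_eval q * F); last by rewrite /word_eval !mulrA.
have -> : E * word_eval q = word_eval q.
  apply: joins_absorbl => e; rewrite mem_filter => /andP[+ _]; exact: same_top.
by apply/esym/joins_absorbr => e; rewrite mem_filter => /andP[+ _]; apply: same_bot.
Qed.

(** Of two uncut strands in one block one is redundant: this is [bpb] read backwards, with both
    joins supplied by [E] and [F]. *)
Let X_cut J f i j : i != j -> i \notin J -> j \notin J ->
  same d (inl i) (inl j) -> same d (inr (f i)) (inr (f j)) -> X J f = X (i |: J) f.
Proof.
move=> ij iJ jJ sij sfij; rewrite /X cutsU1 // -(Ebb sij) -(bbF sfij) -[in LHS](bpb ij).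
rewrite -!mulrA (mulrA (bb i j) (cuts J)) bb_cuts // -!mulrA.
by rewrite (mulrA (bb i j) (T f)) join_perm_shift -!mulrA !(bbF sfij).
Qed.

Let E_tperm i j : same d (inl i) (inl j) -> E * T (tperm i j) = E.
Proof. by move=> /Ebb Eij; rewrite -Eij -mulrA bb_tperm. Qed.

Let F_tperm i j : same d (inr i) (inr j) -> T (tperm i j) * F = F.
Proof. by move=> /bbF Fij; rewrite -Fij mulrA tperm_bb. Qed.

Let X_top J f i j : same d (inl i) (inl j) -> X J f = X (tperm i j @: J) (tperm i j * f)%g.
Proof.
move=> sij; rewrite /X -{1}(E_tperm sij) TM !mulrA; congr (_ * _ * _).
rewrite -mulrA -[in RHS]mulrA [in RHS]cuts_shift -imset_comp (@eq_imset _ _ _ id) => [|l].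
  by rewrite imset_id mulrA.
by rewrite /= tpermK.
Qed.

Let X_bot J f i j : same d (inr i) (inr j) -> X J f = X J (f * tperm i j)%g.
Proof. by move=> sij; rewrite /X TM -[in RHS]mulrA -(mulrA (T f)) F_tperm // mulrA. Qed.

Let exactify J f : valid J f -> exists J', [/\ X J f = X J' f, valid J' f & exact J'].
Proof.
have [m] := ubnP #|~: J|; elim: m J => // m IHm J Jm vJ.
have [ex|nex] := pselect (exact J); first by exists J.
have [i [j [ij iJ jJ sij]]] : exists i j,
    [/\ i != j, i \notin J, j \notin J & same d (inl i) (inl j)].
  apply: contrapT => nij; apply: nex => i j iJ jJ sij.
  by apply/eqP/negPn/negP => ij; apply: nij; exists i, j.
have [vJ1 vJ2] := vJ.
rewrite (@X_cut J f i j) //; last first.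
  exact: dtr (dsym (vJ1 i iJ)) (dtr sij (vJ1 j jJ)).
apply: IHm.
  rewrite -ltnS; apply: leq_trans Jm; rewrite ltnS; apply: proper_card.
  apply/properP; split; first by apply/subsetP => l; rewrite !inE negb_or => /andP[].
  by exists i; rewrite !inE ?eqxx.
split=> [l|l l' ll']; first by rewrite !inE negb_or => /andP[_]; apply: vJ1.
have [l0 l0J ll0] := vJ2 _ _ ll'; have [l0i|l0i] := eqVneq l0 i.
  exists j; first by rewrite !inE negb_or eq_sym ij.
  by subst l0; apply: dtr ll0 sij.
by exists l0 => //; rewrite !inE negb_or l0i.
Qed.

(** Redundant strands are cut until each crossing block keeps one. Transpositions inside blocks,
    absorbed by [E] and [F], then align the second pair with the first; the induction counts the
    uncut strands of [J] on which they differ. *)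
Lemma presents_uniq q q' : presents d q -> presents d q' -> word_eval q = word_eval q'.
Proof.
move=> /presents_X[-> vq] /presents_X[-> vq'].
have [J [-> vJ eJ]] := exactify vq; have [J' [-> vJ' eJ']] := exactify vq'.
move: (wperm q) (wperm q') vJ vJ' => f f' {q q' vq vq'} vJ.
have [m] := ubnP #|[set i in ~: J | (i \in J') || (f i != f' i)]|.
elim: m J' f' eJ' => // m IHm J' f' eJ' Jm vJ'.
have [vJ1 vJ2] := vJ; have [vJ1' vJ2'] := vJ'.
have [/existsP[i]|/existsPn dis0] := boolP [exists i, i \in
    [set i in ~: J | (i \in J') || (f i != f' i)]]; last first.
  have {}dis0 i : i \notin J -> i \notin J' /\ f i = f' i.
    by move=> iJ; have := dis0 i; rewrite !inE iJ negb_or negbK => /andP[-> /eqP].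
  (* A strand uncut only in [J'] shares its block with one uncut in [J]; by agreement the latter is
     uncut in [J'] as well, against exactness of [J']. *)
  have JJ' : J = J'.
    apply/setP => i; apply/idP/idP => [iJ|]; last by apply: contraTT => /dis0[].
    apply/negPn/negP => iJ'; have [i0 i0J ii0] := vJ2 _ _ (vJ1' i iJ').
    by move: iJ; rewrite (eJ' i i0) ?(negbTE i0J) //; case: (dis0 i0 i0J).
  (* The permutations now differ on cut strands only, and [cuts_perm] absorbs the difference. *)
  rewrite /X -JJ'; have -> : T f' = T (f' * f^-1)%g * T f by rewrite -TM mulgKV.
  congr (_ * F); rewrite [in RHS]mulrA -[in RHS](mulrA E) cuts_perm // => i iJ.
  by rewrite permM -(dis0 i iJ).2 permK.
rewrite !inE => /andP[iJ di].
(* [i'] is the strand of the second pair in the block of [i]. Transposing i, i' at the top and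
   [f' i'], [f i] at the bottom makes the pairs agree at [i]. *)
have [i' i'J' ii'] := vJ2' _ _ (vJ1 i iJ).
set t := tperm i i'; have sim a : same d (inl (t a)) (inl a).
  by rewrite /t; case: tpermP => [->|->|]; rewrite ?same_refl // same_sym.
have tJ a : (a \in t @: J') = (t a \in J').
  by rewrite -{1}[a](tpermK i i') mem_imset //; apply: perm_inj.
have sfi : same d (inr (f' i')) (inr (f i)).
  exact: dtr (dsym (vJ1' i' i'J')) (dtr (dsym ii') (vJ1 i iJ)).
have simr a : same d (inr a) (inr (tperm (f' i') (f i) a)).
  by case: tpermP => [->|->|]; rewrite ?same_refl // same_sym.
rewrite (X_top J' f' ii') -/t [RHS](X_bot _ _ sfi); apply: IHm.
- move=> a a'; rewrite !tJ => taJ ta'J aa'; apply: (@perm_inj _ t).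
  by apply: eJ' => //; apply: dtr (sim a) (dtr aa' (dsym (sim a'))).
- rewrite -ltnS; apply: leq_trans Jm; rewrite ltnS; apply: proper_card; apply/properP; split.
    apply/subsetP => a; rewrite !inE tJ => /andP[aJ]; rewrite aJ /=; apply: contraLR.
    rewrite !negb_or !negbK => /andP[aJ' /eqP faa].
    (* No agreement is lost: a strand [a] that already agrees differs from [i], and from [i'] by
       exactness of [J], so neither transposition affects it. *)
    have ai : a != i by apply: contraTneq di => <-; rewrite negb_or aJ' faa eqxx.
    have ai' : a != i'.
      by apply: contraNneq ai => ai'; rewrite (eJ a i) // ai' dsym.
    have ta : t a = a by rewrite /t tpermD // eq_sym.
    rewrite ta aJ' !permM -/t ta -faa tpermD // ?(inj_eq perm_inj) 1?eq_sym //.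
      by rewrite eqxx.
    by rewrite faa (inj_eq perm_inj).
  by exists i; rewrite !inE iJ //= tJ !permM /t !tpermL negb_or i'J' eqxx.
split=> [a|a j aj].
  rewrite tJ => /vJ1' taf; rewrite !permM.
  exact: dtr (dsym (sim a)) (dtr taf (simr _)).
have [a0 a0J' aa0] := vJ2' _ _ aj; exists (t a0); first by rewrite tJ tpermK.
exact: dtr aa0 (dsym (sim a0)).
Qed.

Lemma presents_exists : exists q, presents d q.
Proof.
have /and3P[_ tr _] := blocksP d.
pose top (C : {set vertex n.+1}) := odflt ord0 [pick i | inl i \in C].
pose bot (C : {set vertex n.+1}) := odflt ord0 [pick i | inr i \in C].
pose cross (C : {set vertex n.+1}) := [exists i, inl i \in C] && [exists i, inr i \in C].
pose Cs := [seq C <- enum (blocks d) | cross C].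
have inCs C : C \in Cs -> [/\ C \in blocks d, inl (top C) \in C & inr (bot C) \in C].
  rewrite mem_filter mem_enum => /andP[/andP[/existsP[i iC] /existsP[j jC]] Cd]; split=> //.
    by rewrite /top; case: pickP => [//|/(_ i)]; rewrite iC.
  by rewrite /bot; case: pickP => [//|/(_ j)]; rewrite jC.
have [f ft] : exists f : 'S_n.+1, map f (map top Cs) = map bot Cs.
  have uCs : uniq Cs by apply: filter_uniq; apply: enum_uniq.
  apply: exists_perm_map; rewrite ?size_map // map_inj_in_uniq //.
    move=> C C' /inCs[Cd tC _] /inCs[C'd tC' _] CC'.
    by rewrite -(def_pblock tr Cd tC) CC' (def_pblock tr C'd tC').
  move=> C C' /inCs[Cd _ bC] /inCs[C'd _ bC'] CC'.
  by rewrite -(def_pblock tr Cd bC) CC' (def_pblock tr C'd bC').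
have {}ft C : C \in Cs -> f (top C) = bot C.
  by move: ft; rewrite -map_comp => /eq_in_map; apply.
exists (Word tops [set i | i \notin map top Cs] f bots) => c; split=> [[/= ct cb cx]|sc].
  have ctt i j : same d (inl i) (inl j) -> c (inl i) = c (inl j).
    by move=> ij; apply: (ct (i, j)); rewrite mem_filter ij mem_enum.
  have cbb i j : same d (inr i) (inr j) -> c (inr i) = c (inr j).
    by move=> ij; apply: (cb (i, j)); rewrite mem_filter ij mem_enum.
  have ctb i j : same d (inl i) (inr j) -> c (inl i) = c (inr j).
    move=> ij; have CCs : pblock d (inl i) \in Cs.
      rewrite mem_filter mem_enum pblock_mem ?in_cover // andbT.
      apply/andP; split; apply/existsP; [exists i|exists j] => //.
      exact: same_refl.
    have [Cd iC jC] := inCs _ CCs.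
    have := cx (top (pblock d (inl i))); rewrite inE negbK map_f // ft // => /(_ isT).
    rewrite (ctt i (top (pblock d (inl i)))) // => ->; apply: cbb.
    by apply: dtr (dsym jC) ij.
  case=> i [] j ij; [exact: ctt|exact: ctb| |exact: cbb].
  exact/esym/ctb/dsym.
split=> /= [e|e|i].
- by rewrite mem_filter => /andP[+ _]; apply: sc.
- by rewrite mem_filter => /andP[+ _]; apply: sc.
rewrite inE negbK => /mapP[C CCs ->]; rewrite ft //; have [Cd tC bC] := inCs C CCs.
by apply: sc; rewrite /same (def_pblock tr Cd tC).
Qed.

End NormalForm.
End Words.

(** * The action on words *)

Section LinearOperators.
Variables (K : comNzRingType) (X : Type).

Record linop := Linop {
  linop_fun :> (X -> K) -> X -> K;
  linopP : forall c f g x,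
    linop_fun (fun y => c * f y + g y) x = c * linop_fun f x + linop_fun g x }.

Lemma linop_eq (S T : linop) : (forall f x, S f x = T f x) -> S = T.
Proof.
case: S T => [S PS] [T PT] /= ST; have E : S = T by apply/funext => f; apply/funext => x.
by subst T; congr Linop; apply: Prop_irrelevance.
Qed.

HB.instance Definition _ := gen_eqMixin linop.
HB.instance Definition _ := gen_choiceMixin linop.

Program Definition linop0 := @Linop (fun _ _ => 0) _.
Next Obligation. by rewrite mulr0 addr0. Qed.
Program Definition linop_opp (S : linop) := @Linop (fun f x => - S f x) _.
Next Obligation. by rewrite linopP; ring. Qed.
Program Definition linop_add (S T : linop) := @Linop (fun f x => S f x + T f x) _.
Next Obligation. by rewrite !linopP; ring. Qed.
Program Definition linop1 := @Linop (fun f x => f x) _.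
Program Definition linop_mul (S T : linop) := @Linop (fun f x => S (T f) x) _.
Next Obligation.
rewrite -linopP; congr (linop_fun S _ x); apply/funext => y; exact: linopP.
Qed.
Program Definition linop_scalar (a : K) := @Linop (fun f x => a * f x) _.
Next Obligation. ring. Qed.

Fact linop_addA : associative linop_add.
Proof. by move=> S T U; apply: linop_eq => f x; apply: addrA. Qed.
Fact linop_addC : commutative linop_add.
Proof. by move=> S T; apply: linop_eq => f x; apply: addrC. Qed.
Fact linop_add0 : left_id linop0 linop_add.
Proof. by move=> S; apply: linop_eq => f x; apply: add0r. Qed.
Fact linop_addN : left_inverse linop0 linop_opp linop_add.
Proof. by move=> S; apply: linop_eq => f x; apply: addNr. Qed.

HB.instance Definition _ :=
  GRing.isZmodule.Build linop linop_addA linop_addC linop_add0 linop_addN.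

Lemma linop_ext (S : linop) f g x : f =1 g -> S f x = S g x.
Proof. by move=> fg; congr (linop_fun S _ x); apply/funext. Qed.

Lemma linopD (S : linop) f g x : S (fun y => f y + g y) x = S f x + S g x.
Proof. by rewrite -[S f x]mul1r -linopP; apply: linop_ext => y; rewrite mul1r. Qed.

Lemma linop_fun0 (S : linop) x : S (fun=> 0) x = 0.
Proof.
apply: (addrI (S (fun=> 0) x)); rewrite [RHS]addr0 -linopD.
by apply: linop_ext => y; rewrite addr0.
Qed.

Lemma linopZ (S : linop) a f x : S (fun y => a * f y) x = a * S f x.
Proof.
rewrite -[RHS]addr0 -[in RHS](linop_fun0 S x) -linopP.
by apply: linop_ext => y; rewrite addr0.
Qed.

Lemma linop_sum (S : linop) (I : Type) (r : seq I) (P : pred I) (F : I -> X -> K) x :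
  S (fun y => \sum_(i <- r | P i) F i y) x = \sum_(i <- r | P i) S (F i) x.
Proof.
elim: r => [|i r IHr].
  by rewrite big_nil -[RHS](linop_fun0 S x); apply: linop_ext => y; rewrite big_nil.
rewrite big_cons -IHr; case Pi: (P i).
  by rewrite -linopD; apply: linop_ext => y; rewrite big_cons Pi.
by apply: linop_ext => y; rewrite big_cons Pi.
Qed.

End LinearOperators.

(* The base point only ensures that the ring is non-trivial. *)
Definition linop_ring (K : comNzRingType) (X : Type) (x0 : X) : Type := linop K X.

Section LinearOperatorRing.
Variables (K : comNzRingType) (X : Type) (x0 : X).
Local Notation A := (linop_ring K x0).
HB.instance Definition _ := GRing.Zmodule.on A.

Fact linop_mulA : associative (@linop_mul K X).
Proof. by move=> S T U; apply: linop_eq. Qed.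
Fact linop_mul1 : left_id (linop1 K X) (@linop_mul K X).
Proof. by move=> S; apply: linop_eq. Qed.
Fact linop_mulx1 : right_id (linop1 K X) (@linop_mul K X).
Proof. by move=> S; apply: linop_eq. Qed.
Fact linop_mulDl : left_distributive (@linop_mul K X) (@linop_add K X).
Proof. by move=> S T U; apply: linop_eq. Qed.
Fact linop_mulDr : right_distributive (@linop_mul K X) (@linop_add K X).
Proof. by move=> S T U; apply: linop_eq => f x; apply: linopD. Qed.
Fact linop_1_neq0 : linop1 K X != 0 :> linop K X.
Proof.
apply/eqP => /(congr1 (fun S : linop K X => S (fun=> 1) x0)) /= /eqP.
by rewrite oner_eq0.
Qed.

HB.instance Definition _ := GRing.Zmodule_isNzRing.Build A
  linop_mulA linop_mul1 linop_mulx1 linop_mulDl linop_mulDr linop_1_neq0.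

Lemma linop_addE (S T : A) f x : (S + T) f x = S f x + T f x. Proof. by []. Qed.
Lemma linop_oppE (S : A) f x : (- S) f x = - S f x. Proof. by []. Qed.
Lemma linop_mulE (S T : A) f x : (S * T) f x = S (T f) x. Proof. by []. Qed.
Lemma linop_1E f x : (1 : A) f x = f x. Proof. by []. Qed.
Lemma linop_0E f x : (0 : A) f x = 0. Proof. by []. Qed.

Definition linopE := (linop_addE, linop_oppE, linop_mulE, linop_1E, linop_0E).

Definition linop_C (a : K) : A := linop_scalar X a.

Lemma linop_CE a f x : linop_C a f x = a * f x. Proof. by []. Qed.

Fact linop_C_zmod_morphism : zmod_morphism linop_C.
Proof. by move=> a b; apply: linop_eq => f x; apply: mulrBl. Qed.
Fact linop_C_monoid_morphism : monoid_morphism linop_C.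
Proof.
split; first by apply: linop_eq => f x; apply: mul1r.
by move=> a b; apply: linop_eq => f x; apply/esym/mulrA.
Qed.
HB.instance Definition _ := GRing.isZmodMorphism.Build K A linop_C linop_C_zmod_morphism.
HB.instance Definition _ := GRing.isMonoidMorphism.Build K A linop_C linop_C_monoid_morphism.

Lemma linop_C_comm a (S : A) : GRing.comm (linop_C a) S.
Proof. by apply: linop_eq => f x; rewrite !linopE /= linopZ. Qed.

End LinearOperatorRing.

(** * Recolouring operators and the affine relations *)

Section TensorOperators.
Variables (K : comNzRingType) (N : nat).
Local Notation C := 'I_N.+1.
Local Notation W := (nat -> C).

(** Words are infinite, so that the operators at position [a] are the same for all k. *)
Definition word0 : W := fun=> ord0.
Local Notation A := (linop_ring K word0).

Definition sw (a b c : C) : C := if c == a then b else if c == b then a else c.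

Lemma swC a b c : sw a b c = sw b a c.
Proof. by rewrite /sw; case: eqVneq => [->|]; case: eqVneq => // ->. Qed.

Lemma swL a b : sw a b a = b. Proof. by rewrite /sw eqxx. Qed.
Lemma swR a b : sw a b b = a. Proof. by rewrite swC swL. Qed.

Lemma swK a b : involutive (sw a b).
Proof.
move=> c; rewrite {2}/sw; case: eqVneq => [->|ca]; first by rewrite swR.
by case: eqVneq => [->|cb]; rewrite ?swL // /sw (negbTE ca) (negbTE cb).
Qed.

Lemma sw_inj a b : injective (sw a b). Proof. exact: inv_inj (swK a b). Qed.

Definition glue m (u v : W) : W := fun j => if (j < m)%N then u j else v j.
Definition act m (g : C -> C) (w : W) : W := glue m (g \o w) w.
Definition upd (w : W) i c : W := fun j => if j == i then c else w j.

Let sumK (I : finType) (P : pred I) c (F G : I -> K) :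
  \sum_(i | P i) (c * F i + G i) = c * (\sum_(i | P i) F i) + \sum_(i | P i) G i.
Proof. by rewrite big_split /= mulr_sumr. Qed.

(* tau_even a and tau_odd a apply the transposition of the colours w a and w a.+1
   to the letters of index < a and < a + 2 respectively, so that
   tau_even a * tau_odd a + e_even a exchanges the letters w a and w a.+1; x_odd
   and x_even are sums of such transpositions, as Jucys-Murphy elements are. The
   letter of index a is the vertex a + 1 of the diagrams. *)
Program Definition tau_even a : A := @Linop K W (fun f w =>
  if w a == w a.+1 then 0 else f (act a (sw (w a) (w a.+1)) w)) _.
Next Obligation. by case: eqP => _ //; rewrite mulr0 addr0. Qed.
Program Definition tau_odd a : A := @Linop K W (fun f w =>
  if w a == w a.+1 then 0 else f (act a.+2 (sw (w a) (w a.+1)) w)) _.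
Next Obligation. by case: eqP => _ //; rewrite mulr0 addr0. Qed.
Program Definition e_even a : A := @Linop K W (fun f w =>
  if w a == w a.+1 then f w else 0) _.
Next Obligation. by case: eqP => _ //; rewrite mulr0 addr0. Qed.
#[local] Obligation Tactic := move=> *; exact: sumK.
Program Definition e_odd a : A := @Linop K W (fun f w => \sum_c f (upd w a c)) _.
Program Definition x_odd a : A := @Linop K W (fun f w =>
  \sum_(c | c != w a) f (act a (sw c (w a)) w)) _.
Program Definition x_even a : A := @Linop K W (fun f w =>
  \sum_(c | c != w a) f (act a.+1 (sw c (w a)) w)) _.

(* S reads the letters of index < i, in a way that does not depend on the names
   of the colours, and modifies only those of index < m. *)
Definition inner m i (S : A) : Prop :=
  (m <= i)%N /\
  (forall f u, S f u = S (fun u' => f (glue m u' u)) u) /\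
  (forall f g u v, injective g ->
     S f (glue i (g \o u) v) = S (fun u' => f (glue i (g \o u') v)) u).

(* S recolours the letters of index < i and modifies the others, in a way that
   only depends on the letters of index >= m. *)
Definition outer m i (S : A) : Prop :=
  exists (T : finType) (c : T -> W -> K) (g : T -> W -> C -> C) (v : T -> W -> W),
  [/\ forall f w, S f w = \sum_t c t w * f (glue i (g t w \o w) (v t w)),
      forall t w, injective (g t w) &
      forall t w w', (forall j, (m <= j)%N -> w j = w' j) ->
        [/\ c t w = c t w', g t w = g t w' &
            forall j, (i <= j)%N -> v t w j = v t w' j]].

(** On the letters that [S] reads, [T] is an injective recolouring, with which [S] commutes; the
    letters that select this recolouring are not modified by [S]. *)
Lemma inner_outer_comm m i m' i' (S T : A) : (m <= m')%N -> (i <= i')%N ->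
  inner m i S -> outer m' i' T -> S * T = T * S.
Proof.
move=> mm' ii' [mi [Sfix Seqv]] [I [c [g [v [TE ginj dep]]]]].
apply: linop_eq => f w; rewrite !linop_mulE TE Sfix.
have -> : S (fun u => T f (glue m u w)) w = S (fun u => \sum_t c t w *
    f (glue i' (g t w \o glue m u w) (v t w))) w.
  apply: linop_ext => u; rewrite TE; apply: eq_bigr => t _.
  have [j m'j|<- <- vv] := dep t w (glue m u w).
    by rewrite /glue ltnNge (leq_trans mm' m'j).
  congr (_ * f _); apply/funext => j; rewrite /glue; case: (ltnP j i') => // i'j.
  by rewrite vv.
rewrite linop_sum; apply: eq_bigr => t _; rewrite linopZ; congr (_ * _).
set v1 := glue i' (g t w \o w) (v t w).
rewrite -(Sfix (fun u => f (glue i' (g t w \o u) (v t w)))).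
have -> : v1 = glue i (g t w \o w) v1.
  apply/funext => j; rewrite /glue; case: (ltnP j i) => // ji.
  by rewrite /v1 /glue (leq_trans ji ii').
rewrite Seqv // [RHS]Sfix [LHS]Sfix; apply: linop_ext => u; congr f; apply/funext => j.
rewrite /v1 /glue /=; case: (ltnP j i) => [ji|ij].
  by rewrite (leq_trans ji ii').
by rewrite (ltnNge j m) (leq_trans mi ij).
Qed.

Let gluel i j u v : (j < i)%N -> glue i u v j = u j.
Proof. by rewrite /glue => ->. Qed.

Let sw_morph (g : C -> C) a b c : injective g -> sw (g a) (g b) (g c) = g (sw a b c).
Proof. by move=> gI; rewrite /sw !(inj_eq gI); case: ifP => // _; case: ifP. Qed.

Ltac word_cases := let j := fresh "j" in apply/funext => j; rewrite /act /upd /glue /=;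
  repeat match goal with
  | |- context [(j < ?m)%N] => case: (ltnP j m) => ? //=; try lia
  | |- context [j == ?m] => case: (eqVneq j m) => ? //=; try lia
  end.

Lemma inner_tau_even a : inner a a.+2 (tau_even a).
Proof.
split; [by lia|split=> [f u|f g u v gI] /=].
  by case: eqP => // _; congr f; word_cases.
rewrite !gluel // /= (inj_eq gI); case: eqP => // _; congr f; word_cases.
by rewrite sw_morph.
Qed.

Lemma inner_tau_odd a : inner a.+2 a.+2 (tau_odd a).
Proof.
split; [by lia|split=> [f u|f g u v gI] /=].
  by case: eqP => // _; congr f; word_cases.
rewrite !gluel // /= (inj_eq gI); case: eqP => // _; congr f; word_cases.
by rewrite sw_morph.
Qed.

Lemma inner_e_even a : inner 0 a.+2 (e_even a).
Proof.
split; [by lia|split=> [f u|f g u v gI] /=]; first by case: eqP.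
by rewrite !gluel // /= (inj_eq gI).
Qed.

Lemma inner_e_odd a : inner a.+1 a.+1 (e_odd a).
Proof.
split; [by lia|split=> [f u|f g u v gI] /=].
  by apply: eq_bigr => c _; congr f; word_cases.
by rewrite (reindex_inj gI); apply: eq_bigr => c _; congr f; word_cases.
Qed.

Lemma inner_x_odd a : inner a a.+1 (x_odd a).
Proof.
split; [by lia|split=> [f u|f g u v gI] /=].
  by apply: eq_bigr => c _; congr f; word_cases.
rewrite !gluel // (reindex_inj gI); apply: eq_big => [c|c _] /=; first by rewrite (inj_eq gI).
by congr f; word_cases; rewrite sw_morph.
Qed.

Lemma inner_x_even a : inner a.+1 a.+1 (x_even a).
Proof.
split; [by lia|split=> [f u|f g u v gI] /=].
  by apply: eq_bigr => c _; congr f; word_cases.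
rewrite !gluel // (reindex_inj gI); apply: eq_big => [c|c _] /=; first by rewrite (inj_eq gI).
by congr f; word_cases; rewrite sw_morph.
Qed.

Lemma outer_tau_even a : outer a a (tau_even a).
Proof.
exists unit, (fun _ w => (w a != w a.+1)%:R), (fun _ w => sw (w a) (w a.+1)), (fun _ w => w).
split=> [f w|_ w|_ w w' ww'].
- rewrite /= big_const card_unit /= addr0; case: eqP => _; rewrite ?mul0r ?mul1r //.
- exact: sw_inj.
- by split=> [||j aj]; rewrite ?ww'.
Qed.

Lemma outer_tau_odd a : outer a a.+2 (tau_odd a).
Proof.
exists unit, (fun _ w => (w a != w a.+1)%:R), (fun _ w => sw (w a) (w a.+1)), (fun _ w => w).
split=> [f w|_ w|_ w w' ww'].
- rewrite /= big_const card_unit /= addr0; case: eqP => _; rewrite ?mul0r ?mul1r //.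
- exact: sw_inj.
- by split=> [||j aj]; rewrite ?ww' //; lia.
Qed.

Lemma outer_e_even a i : (a <= i)%N -> outer a i (e_even a).
Proof.
move=> ai; exists unit, (fun _ w => (w a == w a.+1)%:R), (fun _ _ => id), (fun _ w => w).
split=> [f w|_ w|_ w w' ww'] //.
- rewrite /= big_const card_unit /= addr0; case: eqP => _; rewrite ?mul0r ?mul1r //.
  by congr f; word_cases.
- by split=> [||j aj]; rewrite ?ww' //; lia.
Qed.

Lemma outer_e_odd a : outer a a (e_odd a).
Proof.
exists C, (fun _ _ => 1), (fun _ _ => id), (fun c w => upd w a c).
split=> [f w|_ w|c w w' ww'] //.
- by apply: eq_bigr => c _; rewrite mul1r; congr f; word_cases.
- by split=> // j aj; rewrite /upd ww'.
Qed.

Lemma outer_x_odd a : outer a a (x_odd a).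
Proof.
exists C, (fun c w => (c != w a)%:R), (fun c w => sw c (w a)), (fun _ w => w).
split=> [f w|c w|c w w' ww'].
- by rewrite /= big_mkcond; apply: eq_bigr => c _; case: eqP; rewrite ?mul1r ?mul0r.
- exact: sw_inj.
- by split=> [||j aj]; rewrite ?ww'.
Qed.

Lemma outer_x_even a : outer a a.+1 (x_even a).
Proof.
exists C, (fun c w => (c != w a)%:R), (fun c w => sw c (w a)), (fun _ w => w).
split=> [f w|c w|c w w' ww'].
- by rewrite /= big_mkcond; apply: eq_bigr => c _; case: eqP; rewrite ?mul1r ?mul0r.
- exact: sw_inj.
- by split=> [||j aj]; rewrite ?ww' //; lia.
Qed.

(** Words with the letters at a, a+1 (in [word3] also a+2) displayed between a prefix and a tail: an
    operator identity becomes a case analysis on the displayed colours. *)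
Definition word2 a (p : W) b c (r : W) : W :=
  fun j => if (j < a)%N then p j else if j == a then b else if j == a.+1 then c else r j.

Definition word3 a (p : W) b c d (r : W) : W := fun j =>
  if (j < a)%N then p j else if j == a then b else if j == a.+1 then c
  else if j == a.+2 then d else r j.

Lemma word2E a w : w = word2 a w (w a) (w a.+1) w.
Proof. by rewrite /word2; word_cases; subst. Qed.

Lemma word3E a w : w = word3 a w (w a) (w a.+1) (w a.+2) w.
Proof. by rewrite /word3; word_cases; subst. Qed.

Ltac letter := rewrite /word2 /word3;
  repeat (case: ltnP => ? //=; try lia); repeat (case: eqVneq => ? //=; try lia).

Let word2a a p b c r : word2 a p b c r a = b. Proof. by letter. Qed.
Let word2a1 a p b c r : word2 a p b c r a.+1 = c. Proof. by letter. Qed.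
Let word3a a p b c d r : word3 a p b c d r a = b. Proof. by letter. Qed.
Let word3a1 a p b c d r : word3 a p b c d r a.+1 = c. Proof. by letter. Qed.
Let word3a2 a p b c d r : word3 a p b c d r a.+2 = d. Proof. by letter. Qed.

Ltac word_eq := congr (_ _); rewrite /word2 /word3; word_cases; subst;
  rewrite ?swL ?swR.

Lemma tau_even2 a f p b c r : tau_even a f (word2 a p b c r) =
  if b == c then 0 else f (word2 a (sw b c \o p) b c r).
Proof. by rewrite /= word2a word2a1; case: eqP => // _; word_eq. Qed.

Lemma tau_odd2 a f p b c r : tau_odd a f (word2 a p b c r) =
  if b == c then 0 else f (word2 a (sw b c \o p) c b r).
Proof. by rewrite /= word2a word2a1; case: eqP => // _; word_eq. Qed.

Lemma e_even2 a f p b c r : e_even a f (word2 a p b c r) =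
  if b == c then f (word2 a p b c r) else 0.
Proof. by rewrite /= word2a word2a1. Qed.

Lemma e_odd2 a f p b c r : e_odd a f (word2 a p b c r) = \sum_d f (word2 a p d c r).
Proof. by apply: eq_bigr => d _; word_eq. Qed.

Lemma e_odd2S a f p b c r : e_odd a.+1 f (word2 a p b c r) = \sum_d f (word2 a p b d r).
Proof. by apply: eq_bigr => d _; word_eq. Qed.

Lemma x_odd2 a f p b c r : x_odd a f (word2 a p b c r) =
  \sum_(d | d != b) f (word2 a (sw d b \o p) b c r).
Proof. by rewrite /= word2a; apply: eq_bigr => d _; word_eq. Qed.

Lemma x_even2 a f p b c r : x_even a f (word2 a p b c r) =
  \sum_(d | d != b) f (word2 a (sw d b \o p) d c r).
Proof. by rewrite /= word2a; apply: eq_bigr => d _; word_eq. Qed.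

Lemma x_odd2S a f p b c r : x_odd a.+1 f (word2 a p b c r) =
  \sum_(d | d != c) f (word2 a (sw d c \o p) (sw d c b) c r).
Proof. by rewrite /= word2a1; apply: eq_bigr => d _; word_eq. Qed.

Lemma x_even2S a f p b c r : x_even a.+1 f (word2 a p b c r) =
  \sum_(d | d != c) f (word2 a (sw d c \o p) (sw d c b) d r).
Proof. by rewrite /= word2a1; apply: eq_bigr => d _; word_eq. Qed.

Lemma tau_even3 a f p b c d r : tau_even a f (word3 a p b c d r) =
  if b == c then 0 else f (word3 a (sw b c \o p) b c d r).
Proof. by rewrite /= word3a word3a1; case: eqP => // _; word_eq. Qed.

Lemma tau_even3S a f p b c d r : tau_even a.+1 f (word3 a p b c d r) =
  if c == d then 0 else f (word3 a (sw c d \o p) (sw c d b) c d r).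
Proof. by rewrite /= word3a1 word3a2; case: eqP => // _; word_eq. Qed.

Lemma tau_odd3 a f p b c d r : tau_odd a f (word3 a p b c d r) =
  if b == c then 0 else f (word3 a (sw b c \o p) c b d r).
Proof. by rewrite /= word3a word3a1; case: eqP => // _; word_eq. Qed.

Lemma tau_odd3S a f p b c d r : tau_odd a.+1 f (word3 a p b c d r) =
  if c == d then 0 else f (word3 a (sw c d \o p) (sw c d b) d c r).
Proof. by rewrite /= word3a1 word3a2; case: eqP => // _; word_eq. Qed.

Lemma e_even3 a f p b c d r : e_even a f (word3 a p b c d r) =
  if b == c then f (word3 a p b c d r) else 0.
Proof. by rewrite /= word3a word3a1. Qed.

Lemma e_even3S a f p b c d r : e_even a.+1 f (word3 a p b c d r) =
  if c == d then f (word3 a p b c d r) else 0.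
Proof. by rewrite /= word3a1 word3a2. Qed.

Lemma linop2_eq a (S T : A) :
  (forall f p b c r, S f (word2 a p b c r) = T f (word2 a p b c r)) -> S = T.
Proof. by move=> ST; apply: linop_eq => f w; rewrite (word2E a w). Qed.

Lemma linop3_eq a (S T : A) :
  (forall f p b c d r, S f (word3 a p b c d r) = T f (word3 a p b c d r)) -> S = T.
Proof. by move=> ST; apply: linop_eq => f w; rewrite (word3E a w). Qed.

Let sw_compK b c (p : W) : sw b c \o (sw b c \o p) = p.
Proof. by apply/funext => j /=; rewrite swK. Qed.

Let op2 := (tau_even2, tau_odd2, e_even2, e_odd2, e_odd2S, x_odd2, x_even2, x_odd2S, x_even2S).
Let op3 := (tau_even3, tau_even3S, tau_odd3, tau_odd3S, e_even3, e_even3S).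

Let sum_pick (b : C) (F : C -> K) : \sum_c (if c == b then F c else 0) = F b.
Proof. by rewrite -big_mkcond big_pred1_eq. Qed.

Let sum_pick' (b : C) (F : C -> K) : \sum_c (if b == c then F c else 0) = F b.
Proof. by under eq_bigr do rewrite eq_sym; apply: sum_pick. Qed.

Lemma tau_even_sqr a : tau_even a ^+ 2 = 1 - e_even a.
Proof.
apply: (@linop2_eq a) => f p b c r; rewrite expr2 !linopE !op2.
by case: eqVneq => bc; rewrite ?subrr ?subr0 // sw_compK.
Qed.

Lemma tau_odd_sqr a : tau_odd a ^+ 2 = 1 - e_even a.
Proof.
apply: (@linop2_eq a) => f p b c r; rewrite expr2 !linopE !op2 (eq_sym c).
case: eqVneq => bc; rewrite ?subrr ?subr0 //; congr (f (word2 _ _ _ _ _)).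
by apply/funext => j /=; rewrite swC swK.
Qed.

Lemma e_odd_sqr a : e_odd a ^+ 2 = linop_C word0 N.+1%:R * e_odd a.
Proof.
apply: (@linop2_eq a) => f p b c r; rewrite expr2 !linopE linop_CE !op2.
under eq_bigr do rewrite op2.
by rewrite sumr_const card_ord mulr_natl.
Qed.

Lemma e_even_sqr a : e_even a ^+ 2 = e_even a.
Proof.
by apply: (@linop2_eq a) => f p b c r; rewrite expr2 !linopE !op2; case: eqP.
Qed.

Lemma tau_odd_e_even a : tau_odd a * e_even a = 0.
Proof.
by apply: (@linop2_eq a) => f p b c r; rewrite !linopE !op2 (eq_sym c); case: eqP.
Qed.

Lemma e_even_tau_odd a : e_even a * tau_odd a = 0.
Proof. by apply: (@linop2_eq a) => f p b c r; rewrite !linopE !op2; case: eqP. Qed.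

Lemma tau_even_e_even a : tau_even a * e_even a = 0.
Proof. by apply: (@linop2_eq a) => f p b c r; rewrite !linopE !op2; case: eqP. Qed.

Lemma e_even_tau_even a : e_even a * tau_even a = 0.
Proof. by apply: (@linop2_eq a) => f p b c r; rewrite !linopE !op2; case: eqP. Qed.

Lemma tau_e_e a : tau_even a * e_odd a * e_odd a.+1 = tau_odd a * e_odd a * e_odd a.+1.
Proof.
apply: (@linop2_eq a) => f p b c r; rewrite !linopE !op2; case: eqP => // _.
under eq_bigr do rewrite op2; under [in RHS]eq_bigr do rewrite op2.
by [].
Qed.

Lemma e_e_tau a : e_odd a.+1 * e_odd a * tau_even a = e_odd a.+1 * e_odd a * tau_odd a.
Proof.
apply: (@linop2_eq a) => f p b c r; rewrite !linopE !op2.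
under eq_bigr => d _ do [rewrite op2; under eq_bigr do rewrite op2].
rewrite exchange_big; apply: eq_bigr => d _; cbv beta; rewrite op2; apply: eq_bigr => d' _.
rewrite op2 eq_sym; case: eqP => // _; congr (f (word2 _ _ _ _ _)).
by apply/funext => j /=; rewrite swC.
Qed.

Lemma e_odd_even_odd a : e_odd a * e_even a * e_odd a = e_odd a.
Proof.
apply: (@linop2_eq a) => f p b c r; rewrite !linopE !op2.
by under eq_bigr do rewrite !op2; rewrite sum_pick.
Qed.

Lemma e_even_oddS_even a : e_even a * e_odd a.+1 * e_even a = e_even a.
Proof.
apply: (@linop2_eq a) => f p b c r; rewrite !linopE !op2.
under eq_bigr do rewrite !op2; rewrite sum_pick'.
by case: eqP => [->|].
Qed.

Lemma e_even_odd_even a : e_even a * e_odd a * e_even a = e_even a.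
Proof.
apply: (@linop2_eq a) => f p b c r; rewrite !linopE !op2.
under eq_bigr do rewrite !op2; rewrite sum_pick.
by case: eqP => [->|].
Qed.

Lemma e_oddS_even_oddS a : e_odd a.+1 * e_even a * e_odd a.+1 = e_odd a.+1.
Proof.
apply: (@linop2_eq a) => f p b c r; rewrite !linopE !op2.
by under eq_bigr do rewrite !op2; rewrite sum_pick'.
Qed.

Lemma tau_e_odd_tau a :
  tau_even a * e_odd a * tau_even a = tau_odd a * e_odd a.+1 * tau_odd a.
Proof.
apply: (@linop2_eq a) => f p b c r; rewrite !linopE !op2; case: eqVneq => // _.
apply: eq_bigr => d _; rewrite !op2 eq_sym; case: eqP => // _.
by congr (f (word2 _ _ _ _ _)); apply/funext => j /=; rewrite (swC d).
Qed.

Ltac colour_cases := repeat match goal with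
  | H : is_true (?x != ?x) |- _ => by rewrite eqxx in H
  | |- context [?x == ?x] => rewrite (eqxx x) /=
  | |- context [?x == ?y] => is_var x; is_var y; case: (eqVneq x y) => ? /=; subst
  end => //.

(** All equalities between the displayed colours are decided; the prefixes are then compared at one
    letter, whose colour is decided too. *)
Ltac word3_cases p := rewrite !linopE ?op3 ?linopE ?op3 /sw /=; colour_cases;
  rewrite ?subr0 ?subrr ?oppr0 ?addr0 //;
  match goal with |- ?f (word3 ?a ?q _ _ _ _) = ?f (word3 ?a ?q' _ _ _ _) =>
    have -> : q = q' by let j := fresh "j" in apply/funext => j /=; move: (p j) => ?; colour_cases
  | _ => idtac end => //.

Lemma tau_e_even_tau a :
  tau_even a.+1 * e_even a * tau_even a.+1 = tau_odd a * e_even a.+1 * tau_odd a.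
Proof. by apply: (@linop3_eq a) => f p b c d r; word3_cases p. Qed.

Lemma tau_even_braid a : tau_even a * tau_even a.+1 * tau_even a =
  tau_even a.+1 * tau_even a * tau_even a.+1 * (1 - e_even a).
Proof. by apply: (@linop3_eq a) => f p b c d r; word3_cases p. Qed.

Lemma tau_odd_braid a : tau_odd a.+1 * tau_odd a * tau_odd a.+1 =
  tau_odd a * tau_odd a.+1 * tau_odd a * (1 - e_even a.+1).
Proof. by apply: (@linop3_eq a) => f p b c d r; word3_cases p. Qed.

Lemma tau_odd_even_odd a : tau_odd a * tau_even a.+1 * tau_odd a =
  tau_even a.+1 - e_even a * tau_even a.+1 - tau_even a.+1 * e_even a.
Proof. by apply: (@linop3_eq a) => f p b c d r; word3_cases p. Qed.

Lemma tau_even_odd_even a : tau_even a.+1 * tau_odd a * tau_even a.+1 =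
  tau_odd a - e_even a.+1 * tau_odd a - tau_odd a * e_even a.+1.
Proof. by apply: (@linop3_eq a) => f p b c d r; word3_cases p. Qed.

Lemma swap2 a f p b c r : (tau_even a * tau_odd a + e_even a) f (word2 a p b c r) =
  f (word2 a p c b r).
Proof.
rewrite !linopE !op2; case: eqVneq => [->|bc]; rewrite ?add0r ?addr0 //.
by rewrite sw_compK.
Qed.

Let swap3 a f p b c d r : (tau_even a * tau_odd a + e_even a) f (word3 a p b c d r) =
  f (word3 a p c b d r).
Proof.
rewrite !linopE !op3; case: eqVneq => [->|bc]; rewrite ?add0r ?addr0 //.
by rewrite sw_compK.
Qed.

Let swap3S a f p b c d r : (tau_even a.+1 * tau_odd a.+1 + e_even a.+1) f (word3 a p b c d r) =
  f (word3 a p b d c r).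
Proof.
rewrite !linopE !op3; case: eqVneq => [->|bc]; rewrite ?add0r ?addr0 //.
by rewrite sw_compK swK.
Qed.

Lemma swap_braid a (s := fun a => tau_even a * tau_odd a + e_even a) :
  s a * s a.+1 * s a = s a.+1 * s a * s a.+1.
Proof.
by apply: (@linop3_eq a) => f p b c d r; rewrite !linop_mulE; do 3![rewrite ?swap3 ?swap3S].
Qed.

Ltac word2_eq p := match goal with |- ?f (word2 ?a ?q _ _ _) = ?f (word2 ?a ?q' _ _ _) =>
    have -> : q = q' by let j := fresh "j" in apply/funext => j /=; move: (p j) => ?;
      rewrite /sw; colour_cases end.

Lemma e_odd_x a : e_odd a * (x_odd a - x_even a) = 0.
Proof.
apply: (@linop2_eq a) => f p b c r; rewrite !linopE !op2.
under eq_bigr do rewrite !linopE !op2 !(big_mkcond (fun d => d != _)).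
rewrite sumrB [X in _ - X]exchange_big; apply/eqP; rewrite subr_eq0; apply/eqP.
apply: eq_bigr => d _; apply: eq_bigr => d' _; rewrite eq_sym; case: eqP => //= _.
by word2_eq p.
Qed.

Lemma x_e_odd a : (x_odd a - x_even a) * e_odd a = 0.
Proof.
apply: (@linop2_eq a) => f p b c r; rewrite !linopE !op2.
under eq_bigr do rewrite !op2.
by under [X in _ - X]eq_bigr do rewrite !op2; rewrite subrr.
Qed.

Lemma e_even_x a : e_even a * (x_even a - x_odd a.+1) = 0.
Proof.
apply: (@linop2_eq a) => f p b c r; rewrite !linopE !op2; case: eqVneq => // ->.
rewrite !linopE !op2; apply/eqP; rewrite subr_eq0; apply/eqP; apply: eq_bigr => d _.
by rewrite swR.
Qed.

Lemma x_e_even a : (x_even a - x_odd a.+1) * e_even a = 0.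
Proof.
apply: (@linop2_eq a) => f p b c r; rewrite !linopE !op2.
apply/eqP; rewrite subr_eq0; apply/eqP.
under eq_bigr do rewrite !op2; under [in RHS]eq_bigr do rewrite !op2.
rewrite -!big_mkcondr /=.
have [->|bc] := eqVneq b c.
  rewrite !big1 // => d /andP[dc /eqP]; first by rewrite swR => dE; rewrite dE eqxx in dc.
  by move=> dE; rewrite dE eqxx in dc.
(* For distinct b, c the condition of [e_even] leaves one term in each sum, d = c in the first and d
   = b in the second; both give the letters c, c and exchange b, c in the prefix. *)
rewrite (big_pred1 c) => [|d]; last first.
  by apply: andb_idl => /eqP ->; rewrite eq_sym.
rewrite (big_pred1 b) => [|d] /=.
  by rewrite swL; word2_eq p.
rewrite /sw; colour_cases; by rewrite ?eq_sym.
Qed.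

Let swD a b c : c != a -> c != b -> sw a b c = c.
Proof. by rewrite /sw => /negbTE -> /negbTE ->. Qed.

Lemma x_odd_rec a : x_odd a.+1 = tau_even a * x_odd a * tau_even a
  + e_even a * e_odd a * tau_even a + tau_even a * e_odd a * e_even a - tau_even a.
Proof.
apply: (@linop2_eq a) => f p b c r; rewrite !linopE !op2.
case: eqVneq => [->|bc].
  rewrite add0r subr0 addr0 big_mkcond; apply: eq_bigr => d _; rewrite op2.
  by case: eqVneq => //= dc; rewrite swR.
under [in RHS]eq_bigr do rewrite op2 (negbTE bc).
under [X in _ + X - _]eq_bigr do rewrite op2.
(* The term d = b on the left is the surviving e-summand, and d = c on the right cancels
   [- tau_even]; the others match because conjugating the transposition of d, b by that of b, c
   gives that of d, c. *)
rewrite sum_pick addr0 (bigD1 b) //= [in RHS](bigD1 c) 1?eq_sym //= swL.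
set S := \sum_(d < N.+1 | _) _; set S' := (X in _ + X + _ - _).
have -> : S = S'.
  apply: eq_big => [d|d /andP[dc db]]; first by rewrite andbC.
  by rewrite (@swD d c b) // 1?eq_sym //; word2_eq p.
have -> : f (word2 a (sw b c \o (sw c b \o (sw b c \o p))) b c r) =
  f (word2 a (sw b c \o p) b c r) by word2_eq p.
by ring.
Qed.

Lemma x_even_rec a : x_even a.+1 = tau_odd a * x_even a * tau_odd a
  + e_even a * e_odd a.+1 * tau_odd a * e_odd a.+1 * e_even a + tau_odd a.
Proof.
apply: (@linop2_eq a) => f p b c r; rewrite !linopE !op2.
case: eqVneq => [->|bc].
  rewrite add0r addr0 big_mkcond; apply: eq_bigr => d _; rewrite op2 if_neg eq_sym.
  case: eqVneq => // dc; rewrite op2; under eq_bigr do rewrite op2.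
  by rewrite sum_pick' swR; word2_eq p.
under [in RHS]eq_bigr do rewrite op2.
(* The colour d = b gives the summand [tau_odd] on the left, while on the right the outer [tau_odd]
   kills it. *)
rewrite addr0 (bigD1 b) //= [in RHS](bigD1 b) //= eqxx swL.
set S := \sum_(d < N.+1 | _) _; set S' := (X in _ + X + _).
have -> : S = S'.
  apply: eq_bigr => d /andP[dc db].
  by rewrite (negbTE db) (@swD d c b) // 1?eq_sym //; word2_eq p.
by ring.
Qed.

Lemma x_even_tau_even a : x_even a = tau_even a * x_even a * tau_even a
  + e_even a * e_odd a * tau_even a + tau_even a * e_odd a * e_even a.
Proof.
apply: (@linop2_eq a) => f p b c r; rewrite !linopE !op2.
case: eqVneq => [->|bc].
  rewrite add0r addr0 big_mkcond; apply: eq_bigr => d _; rewrite op2.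
  by case: eqVneq.
under [in RHS]eq_bigr do rewrite op2.
under [X in _ + X]eq_bigr do rewrite op2.
rewrite sum_pick addr0 (bigD1 c) 1?eq_sym //= [in RHS](bigD1 c) 1?eq_sym //= eqxx.
set S := \sum_(d < N.+1 | _) _; set S' := (X in _ + X + _).
have -> : S = S'.
  by apply: eq_bigr => d /andP[db dc]; rewrite (negbTE dc); word2_eq p.
rewrite (_ : f (word2 a (sw c b \o p) c c r) = f (word2 a (sw b c \o p) c c r)).
  by ring.
by word2_eq p.
Qed.

Lemma x_odd_tau_odd a : x_odd a.+1 = tau_odd a * x_odd a.+1 * tau_odd a
  + e_even a * e_odd a.+1 * tau_odd a + tau_odd a * e_odd a.+1 * e_even a.
Proof.
apply: (@linop2_eq a) => f p b c r; rewrite !linopE !op2.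
case: eqVneq => [->|bc].
  rewrite add0r addr0 big_mkcond; apply: eq_bigr => d _; rewrite op2 eq_sym.
  by case: eqVneq => //= dc; rewrite swR; word2_eq p.
under [in RHS]eq_bigr do rewrite op2.
under [X in _ + X]eq_bigr do rewrite op2.
rewrite sum_pick' addr0 (bigD1 b) //= [in RHS](bigD1 c) 1?eq_sym //= !swL eqxx.
set S := \sum_(d < N.+1 | _) _; set S' := (X in _ + X + _).
have -> : S = S'.
  apply: eq_big => [d|d /andP[dc db]]; first by rewrite andbC.
  rewrite (@swD d c b) // 1?eq_sym // (@swD d b c) // 1?eq_sym // (eq_sym c) (negbTE bc).
  by word2_eq p.
by ring.
Qed.

Definition tensor_tau i : A := if odd i then tau_odd i./2.-1 else tau_even i./2.-1.
Definition tensor_e j : A := if odd j then e_odd j./2 else e_even j./2.-1.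
Definition tensor_x r : A := if odd r then x_odd r./2 else x_even r./2.-1.
(** The first x acts as the scalar N, the number of colours other than the first letter, and the
    square of the first e is N+1 times itself; this forces the value of z_l. *)
Definition tensor_z l : A := linop_C word0 (N.+1 * N ^ l)%:R.

Lemma tensor_tau_even a : tensor_tau a.*2.+2 = tau_even a.
Proof. by rewrite /tensor_tau /= negbK odd_double doubleK. Qed.
Lemma tensor_tau_odd a : tensor_tau a.*2.+3 = tau_odd a.
Proof. by rewrite /tensor_tau /= negbK odd_double uphalf_double. Qed.
Lemma tensor_e_odd a : tensor_e a.*2.+1 = e_odd a.
Proof. by rewrite /tensor_e /= odd_double uphalf_double. Qed.
Lemma tensor_e_even a : tensor_e a.*2.+2 = e_even a.
Proof. by rewrite /tensor_e /= negbK odd_double doubleK. Qed.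
Lemma tensor_x_odd a : tensor_x a.*2.+1 = x_odd a.
Proof. by rewrite /tensor_x /= odd_double uphalf_double. Qed.
Lemma tensor_x_even a : tensor_x a.*2.+2 = x_even a.
Proof. by rewrite /tensor_x /= negbK odd_double doubleK. Qed.

Let tensorE := (tensor_tau_even, tensor_tau_odd, tensor_e_odd, tensor_e_even,
  tensor_x_odd, tensor_x_even, (fun a => tensor_tau_even a.+1),
  (fun a => tensor_tau_odd a.+1), (fun a => tensor_e_odd a.+1),
  (fun a => tensor_e_even a.+1), (fun a => tensor_x_odd a.+1), (fun a => tensor_x_even a.+1)).

Lemma x_odd0 : x_odd 0 = linop_C word0 N%:R.
Proof.
apply: linop_eq => f w; rewrite linop_CE /= (eq_bigr (fun=> f w)) => [|c _].
  by rewrite sumr_const cardC1 card_ord mulr_natl.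
by congr f; apply/funext => j.
Qed.

(** [e_even a] modifies no letter, so only the letters that [S] modifies matter, not those that it
    reads. *)
Lemma e_even_comm m i a (S : A) : inner m i S -> (m <= a)%N -> S * e_even a = e_even a * S.
Proof.
move=> iS ma; apply: (inner_outer_comm ma (leq_addl a i) iS).
exact: outer_e_even (leq_addr _ _).
Qed.

Ltac inner_tac := first [apply: inner_tau_even | apply: inner_tau_odd | apply: inner_e_even
  | apply: inner_e_odd | apply: inner_x_odd | apply: inner_x_even].
Ltac outer_tac := first [apply: outer_tau_even | apply: outer_tau_odd
  | apply: outer_e_odd | apply: outer_x_odd | apply: outer_x_even].
Ltac far1 := first [ (apply: e_even_comm; [inner_tac | by lia])
  | (apply: inner_outer_comm; [| | inner_tac | outer_tac]; by lia) ].
Ltac far := match goal with |- ?S ?a * ?T ?b = _ => case: (ltngtP a b) => ?; subst end;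
  first [by [] | by exfalso; simpl in *; lia | far1 | apply/esym; far1].

Let parity i : (0 < i)%N -> exists a, i = a.*2.+1 \/ i = a.*2.+2.
Proof.
case: i => // i _; exists i./2.
by have := odd_double_half i; case: (odd i) => E; [right|left]; lia.
Qed.

(* The relations make the index i positive. *)
Ltac pos i := let i' := fresh i in rename i into i'; destruct i' as [|i];
  [by exfalso; simpl in *; lia | rewrite ?doubleS ?succnK].
Ltac parities i := let a := fresh "a" in
  have [a [?|?]] : exists a, i = a.*2.+1 \/ i = a.*2.+2
    by [apply: parity; simpl in *; lia]; subst i.

Lemma tensor_rel k u v : aff_rel k tensor_tau tensor_e tensor_x tensor_z u v -> u = v.
Proof.
case=> [i /andP[i1 ik]|i /andP[i1 ik]|i j d ij|i j d ij ij'|i j d ij ij'|i /andP[i1 ik]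
  |i /andP[i1 ik]|i /andP[i1 ik]|i /andP[i1 ik]|i /andP[i1 ik]|i /andP[i1 ik]|i /andP[i1 ik]
  |i /andP[i1 ik]|i /andP[i1 ik]|i j d ij|i j d ij ij'|i j d ij|i j d ij ij'|i j d ij
  |i /andP[i1 ik]|i /andP[i1 ik]|i /andP[i1 ik]|i /andP[i1 ik]
  |i j d|i j d ij ij' ij''|i j d ij ij'|i d|i d|i d|i d|i d|i d|i d|i d
  |i /andP[i1 ik]|i /andP[i1 ik]|l l1|l w].
- by pos i; rewrite !tensorE tau_even_sqr.
- by pos i; rewrite !tensorE tau_odd_sqr.
- by pos i; pos j; rewrite !tensorE; far.
- by pos i; pos j; rewrite !tensorE; far.
- by pos i; pos j; rewrite !tensorE; far.
- by pos i; rewrite !tensorE swap_braid.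
- by pos i; rewrite !tensorE e_odd_sqr /tensor_z expn0 muln1.
- by pos i; rewrite !tensorE e_even_sqr.
- by pos i; rewrite !tensorE tau_odd_e_even.
- by pos i; rewrite !tensorE e_even_tau_odd.
- by pos i; rewrite !tensorE tau_even_e_even.
- by pos i; rewrite !tensorE e_even_tau_even.
- by pos i; rewrite !tensorE tau_e_e.
- by pos i; rewrite !tensorE e_e_tau.
- by parities i; parities j; rewrite !tensorE; far.
- by pos i; pos i; pos j; rewrite !tensorE; far.
- by pos i; pos i; pos j; rewrite !tensorE; far.
- by pos i; pos j; rewrite !tensorE; far.
- by pos i; pos j; rewrite !tensorE; far.
- by parities i; rewrite !tensorE ?e_odd_even_odd // e_even_oddS_even.
- by parities i; rewrite !tensorE ?e_even_odd_even // e_oddS_even_oddS.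
- by pos i; rewrite !tensorE tau_e_odd_tau.
- by pos i; pos i; rewrite !tensorE tau_e_even_tau.
- by parities i; parities j; rewrite !tensorE; far.
- by parities i; [pos a|]; parities j; rewrite !tensorE; far.
- by parities i; parities j; rewrite !tensorE; far.
- by pos i; pos i; rewrite !tensorE tau_even_braid.
- by pos i; pos i; rewrite !tensorE tau_odd_braid.
- by pos i; pos i; rewrite !tensorE tau_odd_even_odd.
- by pos i; pos i; rewrite !tensorE tau_even_odd_even.
- by pos i; rewrite !tensorE -x_odd_rec.
- by pos i; rewrite !tensorE -x_even_rec.
- by pos i; rewrite !tensorE -x_even_tau_even.
- by pos i; rewrite !tensorE -x_odd_tau_odd.
- by parities i; rewrite !tensorE ?e_odd_x ?e_even_x.
- by parities i; rewrite !tensorE ?x_e_odd ?x_e_even.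
- rewrite (tensor_e_odd 0) (tensor_x_odd 0) x_odd0 -rmorphXn /=.
  rewrite -linop_C_comm -mulrA -expr2 e_odd_sqr mulrA -rmorphM /=.
  by rewrite /tensor_z natrM natrX mulrC.
- exact: linop_C_comm.
Qed.
End TensorOperators.

(** * Partition relations in the affine algebra *)

Section AffineGenerators.
Variables (B : nzRingType) (n : nat) (tau e x z : nat -> B).
Hypothesis H : forall u v, aff_rel n.+1 tau e x z u v -> u = v.

Definition aff_s i := tau i.+1.*2 * tau i.+1.*2.+1 + e i.+1.*2.
Local Notation s := aff_s.
Local Notation t i := (tau i.+1.*2).
Local Notation t' i := (tau i.+1.*2.+1).
Local Notation b i := (e i.+1.*2).
Local Notation p i := (e i.*2.+1).

Let bi i : (i < n)%N -> (1 <= i.+1 <= n.+1.-1)%N. Proof. by []. Qed.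

Let tt i : (i < n)%N -> t i * t i = 1 - b i.
Proof. by move=> /bi ni; rewrite -expr2 (H (ar_tau_even_sqr _ _ _ _ ni)). Qed.
Let tt' i : (i < n)%N -> t' i * t' i = 1 - b i.
Proof. by move=> /bi ni; rewrite -expr2 (H (ar_tau_odd_sqr _ _ _ _ ni)). Qed.

Let tC i j : (i < n)%N -> (j < n)%N -> j != i.+1 -> t' i * t j = t j * t' i.
Proof. by move=> ni nj ij; apply: H; apply: ar_tau_odd_tau_even_comm => //=; lia. Qed.

Let bb i : (i < n)%N -> b i * b i = b i.
Proof. by move=> /bi ni; rewrite -expr2 (H (ar_e_even_sqr _ _ _ _ ni)). Qed.
Let t'b i : (i < n)%N -> t' i * b i = 0.
Proof. by move=> /bi ni; rewrite (H (ar_tau_odd_e_even0 _ _ _ _ ni)). Qed.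
Let bt' i : (i < n)%N -> b i * t' i = 0.
Proof. by move=> /bi ni; rewrite (H (ar_e_even_tau_odd0 _ _ _ _ ni)). Qed.
Let tb i : (i < n)%N -> t i * b i = 0.
Proof. by move=> /bi ni; rewrite (H (ar_tau_even_e_even0 _ _ _ _ ni)). Qed.
Let bt i : (i < n)%N -> b i * t i = 0.
Proof. by move=> /bi ni; rewrite (H (ar_e_even_tau_even0 _ _ _ _ ni)). Qed.

Let pt i j : (i < n)%N -> (j <= n)%N -> j != i -> j != i.+1 -> p j * t i = t i * p j.
Proof.
move=> ni nj ij ij1; apply/esym/H.
by apply: (@ar_tau_even_e_odd_comm _ _ _ _ _ _ i.+1 j.+1) => //=; lia.
Qed.
Let pt' i j : (i < n)%N -> (j <= n)%N -> j != i -> j != i.+1 -> p j * t' i = t' i * p j.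
Proof.
move=> ni nj ij ij1; apply/esym/H.
by apply: (@ar_tau_odd_e_odd_comm _ _ _ _ _ _ i.+2 j.+1) => //=; lia.
Qed.
Let tbC i j : (i < n)%N -> (j < n)%N -> i != j.+1 -> t i * b j = b j * t i.
Proof.
by move=> ni nj ij; apply/H; apply: ar_tau_even_e_even_comm => //=; lia.
Qed.
Let t'bC i j : (i < n)%N -> (j < n)%N -> j != i.+1 -> t' i * b j = b j * t' i.
Proof.
move=> ni nj ij; apply/H.
by apply: (@ar_tau_odd_e_even_comm _ _ _ _ _ _ i.+2 j.+1) => //=; lia.
Qed.
Let eC i j : (0 < i <= n.*2.+1)%N -> (0 < j <= n.*2.+1)%N ->
  (i + 2 <= j)%N || (j + 2 <= i)%N -> e i * e j = e j * e i.
Proof. by move=> ni nj ij; apply: H; apply: ar_e_comm => //=; lia. Qed.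

Let t'C i j : (i < n)%N -> (j < n)%N -> (i.+1 < j)%N -> t' i * t' j = t' j * t' i.
Proof. by move=> ni nj ij; apply: H; apply: ar_tau_odd_comm => //=; lia. Qed.
Let ttC i j : (i < n)%N -> (j < n)%N -> (i.+1 < j)%N -> t i * t j = t j * t i.
Proof. by move=> ni nj ij; apply: H; apply: ar_tau_even_comm => //=; lia. Qed.

(* The relations of x express e_{2i} x_{2i} and e_{2i} x_{2i+1}, which coincide,
   through the other generators. *)
Let b_x i : (i < n)%N -> b i * p i * t i = b i * p i.+1 * t' i.
Proof.
move=> ni; have dx : (1 <= i.+1.*2 <= n.+1.*2.-1)%N by lia.
have := H (ar_e_x_sub0 tau _ _ _ dx); rewrite mulrBr => /eqP; rewrite subr_eq0 => /eqP.
have d1 : all (gen_defined n.+1) [:: GX i.+1.*2; GTau i.+1.*2; GE i.+1.*2; GE i.+1.*2.-1].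
  by rewrite /=; lia.
have d2 : all (gen_defined n.+1) [:: GX i.+1.*2.+1; GTau i.+1.*2.+1; GE i.+1.*2; GE i.+1.*2.+1].
  by rewrite /=; lia.
rewrite {1}(H (ar_x_even_tau_even _ _ _ _ d1)) {1}(H (ar_x_odd_tau_odd _ _ _ _ d2)).
by rewrite !mulrDr !mulrA bb // bt // bt' // !mul0r !add0r !addr0.
Qed.

Let x_b i : (i < n)%N -> t i * p i * b i = t' i * p i.+1 * b i.
Proof.
move=> ni; have dx : (1 <= i.+1.*2 <= n.+1.*2.-1)%N by lia.
have := H (ar_x_sub_e0 tau _ _ _ dx); rewrite mulrBl => /eqP; rewrite subr_eq0 => /eqP.
have d1 : all (gen_defined n.+1) [:: GX i.+1.*2; GTau i.+1.*2; GE i.+1.*2; GE i.+1.*2.-1].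
  by rewrite /=; lia.
have d2 : all (gen_defined n.+1) [:: GX i.+1.*2.+1; GTau i.+1.*2.+1; GE i.+1.*2; GE i.+1.*2.+1].
  by rewrite /=; lia.
rewrite {1}(H (ar_x_even_tau_even _ _ _ _ d1)) {1}(H (ar_x_odd_tau_odd _ _ _ _ d2)).
by rewrite !mulrDl -!mulrA bb // tb // t'b // !mulr0 !add0r.
Qed.

Let tpt i : (i < n)%N -> t i * p i * t i = t' i * p i.+1 * t' i.
Proof. by move=> /bi ni; have := H (ar_tau_e_odd_tau _ _ _ _ ni). Qed.

Let bpb i : (i < n)%N -> b i * p i * b i = b i.
Proof. by move=> ni; apply: H; apply: (@ar_eS_e_eS _ _ _ _ _ _ i.*2.+1); lia. Qed.
Let pbp i : (i < n)%N -> p i * b i * p i = p i.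
Proof. by move=> ni; apply: H; apply: (@ar_e_eS_e _ _ _ _ _ _ i.*2.+1); lia. Qed.
Let bpSb i : (i < n)%N -> b i * p i.+1 * b i = b i.
Proof. by move=> ni; apply: H; apply: (@ar_e_eS_e _ _ _ _ _ _ i.+1.*2); lia. Qed.

Let tt'C i : (i < n)%N -> t' i * t i = t i * t' i.
Proof. by move=> ni; apply: tC => //; lia. Qed.

Let s_sqr i : (i < n)%N -> s i * s i = 1.
Proof.
move=> ni; rewrite /s mulrDl !mulrDr -{1}(tt'C ni) -!mulrA (mulrA (t i) (t i)) tt // bb //.
rewrite t'b // (mulrA (b i)) bt // mul0r mulr0 addr0 add0r mulrBl mul1r bt' // subr0.
by rewrite tt' // subrK.
Qed.

Let comm_s u j : GRing.comm u (t j) -> GRing.comm u (t' j) -> GRing.comm u (b j) ->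
  GRing.comm u (s j).
Proof. by move=> ut ut' ub; apply: commrD => //; apply: commrM. Qed.

Let s_comm i j : (i.+1 < j < n)%N -> s i * s j = s j * s i.
Proof.
move=> /andP[ij nj]; have ni : (i < n)%N by lia.
apply: comm_s; apply: commr_sym; apply: comm_s; apply: commr_sym; rewrite /GRing.comm.
- exact: ttC.
- by apply: tC => //; lia.
- by apply/esym; apply: tbC => //; lia.
- by apply/esym; apply: tC => //; lia.
- exact: t'C.
- by apply/esym; apply: t'bC => //; lia.
- by apply: tbC => //; lia.
- by apply: t'bC => //; lia.
- by apply: eC; lia.
Qed.

Let bbC i : (i.+1 < n)%N -> b i * b i.+1 = b i.+1 * b i.
Proof. by move=> ni; apply: eC; lia. Qed.

(** Together with [sbs'] this gives two expressions for the join of the strands i and i+2;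
    [ar_tau_e_even_tau] equates their first summands, whence [pr_b_shift]. *)
Let sbs i : (i.+1 < n)%N -> s i.+1 * b i * s i.+1 = t i.+1 * b i * t i.+1 + b i * b i.+1.
Proof.
move=> nj; have ni := ltnW nj.
have t'C' : t' i.+1 * b i = b i * t' i.+1 by apply: t'bC => //; lia.
have E1 : t i.+1 * t' i.+1 * b i * (t i.+1 * t' i.+1) = t i.+1 * b i * t i.+1.
  rewrite -[X in _ * X](tt'C nj) -!mulrA (mulrA (t' i.+1) (b i)) t'C' -!mulrA (mulrA (t' i.+1) (t' i.+1)).
  by rewrite tt' // mulrBl mul1r bt // subr0.
have E2 : t i.+1 * t' i.+1 * b i * b i.+1 = 0.
  by rewrite -!mulrA bbC // (mulrA (t' i.+1)) t'b // mul0r mulr0.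
have E3 : b i.+1 * b i * (t i.+1 * t' i.+1) = 0.
  by rewrite -bbC // -mulrA (mulrA (b i.+1)) bt // mul0r mulr0.
have E4 : b i.+1 * b i * b i.+1 = b i * b i.+1 by rewrite -bbC // -mulrA bb.
by rewrite /s mulrDl mulrDr !mulrDl E1 E2 E3 E4 addr0 add0r.
Qed.

Let sbs' i : (i.+1 < n)%N -> s i * b i.+1 * s i = t' i * b i.+1 * t' i + b i * b i.+1.
Proof.
move=> nj; have ni := ltnW nj.
have tC' : t i * b i.+1 = b i.+1 * t i by apply: tbC => //; lia.
have E1 : t i * t' i * b i.+1 * (t i * t' i) = t' i * b i.+1 * t' i.
  rewrite -[X in X * _ * _](tt'C ni) -!mulrA (mulrA (t i) (b i.+1)) tC' -!mulrA (mulrA (t i) (t i)).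
  by rewrite tt // mulrBl mul1r bt' // subr0.
have E2 : t i * t' i * b i.+1 * b i = 0.
  by rewrite -!mulrA -bbC // (mulrA (t' i)) t'b // mul0r mulr0.
have E3 : b i * b i.+1 * (t i * t' i) = 0.
  by rewrite bbC // -mulrA (mulrA (b i)) bt // mul0r mulr0.
have E4 : b i * b i.+1 * b i = b i * b i.+1 by rewrite bbC // -mulrA bb.
by rewrite /s mulrDl mulrDr !mulrDl E1 E2 E3 E4 addr0 add0r.
Qed.

(** The product of the tau-parts is reduced by [tpt]; the mixed terms are where [b_x] and [x_b],
    hence the relations of x, enter. *)
Let sps i : (i < n)%N -> s i * p i * s i = p i.+1.
Proof.
move=> ni.
have E1 : t i * t' i * p i * (t i * t' i) =
    p i.+1 - b i * p i.+1 - p i.+1 * b i + b i.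
  transitivity (t' i * (t i * p i * t i) * t' i).
    by rewrite -[X in X * _ * _](tt'C ni) !mulrA.
  rewrite tpt // !mulrA tt' // -mulrA tt' // mulrBr mulr1 !mulrBl mul1r bpSb //.
  by rewrite opprB addrA addrAC.
have E2 : t i * t' i * p i * b i = p i.+1 * b i - b i.
  rewrite -[X in X * _ * _](tt'C ni) -2!mulrA (mulrA (t i)) x_b // !mulrA tt' //.
  by rewrite !(mulrBl, mul1r) bpSb.
have E3 : b i * p i * (t i * t' i) = b i * p i.+1 - b i.
  by rewrite mulrA b_x // -mulrA tt' // mulrBr mulr1 bpSb.
rewrite /s mulrDl mulrDr !mulrDl E1 E2 E3 bpb // subrK.
by rewrite (addrC (b i * _)) (addrA _ (- b i)) addrK addrAC subrK subrK.
Qed.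

Let p_b_comm i j : (i < n)%N -> (j <= n)%N -> j != i -> j != i.+1 -> p j * b i = b i * p j.
Proof. by move=> ni nj ij ij1; apply: eC; lia. Qed.

Lemma aff_partition_relations :
  partition_relations n s (fun i => e i.+1.*2) (fun i => e i.*2.+1) (z 0).
Proof.
split.
- exact: s_sqr.
- exact: s_comm.
- by move=> i ni; apply: H; apply: (@ar_s_braid _ _ _ _ _ _ i.+1); lia.
- exact: bb.
- move=> i j ni nj; have [-> //|ij] := eqVneq i j; apply: eC; lia.
- by move=> i ni; rewrite /s mulrDr mulrA bt // mul0r add0r bb.
- by move=> i ni; rewrite /s mulrDl -mulrA t'b // mulr0 add0r bb.
- move=> i ni; apply: comm_s; rewrite /GRing.comm.
  + by apply/esym; apply: (@tbC i 0) => //; lia.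
  + by apply/esym; apply: (@t'bC i 0) => //; lia.
  + by apply: (@eC 2 i.+1.*2); lia.
- move=> i ni; have ni' := ltnW ni.
  have E : s i.+1 * b i * s i.+1 = s i * b i.+1 * s i.
    rewrite sbs // sbs' //; congr (_ + _); apply: H.
    by apply: (@ar_tau_e_even_tau _ _ _ _ _ _ i.+2); lia.
  have := congr1 (fun u => s i * u * s i.+1) E; rewrite /= !mulrA s_sqr // mul1r.
  by rewrite -!mulrA s_sqr // mulr1.
- by move=> i ni; rewrite -expr2; apply: H; apply: (@ar_e_odd_sqr _ _ _ _ _ _ i.+1).
- move=> i j ni nj; have [-> //|ij] := eqVneq i j; apply: eC; lia.
- by move=> i ni; rewrite -(sps ni) -mulrA s_sqr // mulr1.
- move=> i j ni nj ij ij1; apply: comm_s; rewrite /GRing.comm.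
  + exact: pt.
  + exact: pt'.
  + exact: p_b_comm.
- by move=> n1; apply: (@eC 5 2); lia.
- by move=> n0; apply: (pbp n0).
- by move=> n0; apply: (bpb n0).
- move=> n0; have E := H (@ar_tau_e_e _ _ _ _ x z _ (bi n0)); rewrite /= -!mulrA in E.
  rewrite /s -tt'C // mulrDl -mulrA [X in _ * X + _]E mulrA tt' //.
  by rewrite mulrBl mul1r subrK.
- by move=> w; apply: H; apply: ar_z_central.
Qed.
End AffineGenerators.

Lemma aff_rel_image (A A' : nzRingType) (f : {rmorphism A -> A'}) k (tau e x z : nat -> A) :
  (forall u v, aff_rel k tau e x z u v -> f u = f v) -> (forall u, exists v, u = f v) ->
  forall u v, aff_rel k (f \o tau) (f \o e) (f \o x) (f \o z) u v -> u = v.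
Proof.
move=> key surj u v; case.
(* This is [ar_z_central], the one relation that quantifies over ring elements and so requires
   surjectivity. *)
38: by move=> l w; have [w' ->] := surj w; rewrite -!(rmorphM f); apply: key; constructor.
all: intros; rewrite /=; try rewrite -[in RHS](rmorph1 f); try rewrite -[in RHS](rmorph0 f);
  do 5![try rewrite -?(rmorphXn f) -?(rmorphM f) -?(rmorphN f) -?(rmorphD f)];
  apply: key; by econstructor.
Qed.

(** The images need to agree on defined indices only: outside the range [gen] is 0, while the tensor
    operators are not. *)
Lemma aff_rel_morph (A A' : nzRingType) (f : {rmorphism A -> A'}) k
    (tau e x z : nat -> A) (tau' e' x' z' : nat -> A') : (0 < k)%N ->
  (forall i, gen_defined k (GTau i) -> f (tau i) = tau' i) ->
  (forall i, gen_defined k (GE i) -> f (e i) = e' i) ->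
  (forall i, gen_defined k (GX i) -> f (x i) = x' i) ->
  (forall i, f (z i) = z' i) ->
  (forall u v, aff_rel k tau' e' x' z' u v -> u = v) ->
  forall u v, aff_rel k tau e x z u v -> f u = f v.
Proof.
move=> k0 ft fe fx fz H u v; case; intros.
all: rewrite ?(rmorphXn f, rmorphM f, rmorphB f, rmorphD f, rmorph1 f, rmorph0 f) /=.
all: rewrite ?ft ?fe ?fx ?fz; try by (simpl in *; lia).
all: apply: H; by econstructor.
Qed.

(** * The tensor representation of the affine algebra *)

Section AffineAlgebra.
Variables (K : comNzRingType) (n : nat).
Local Notation k := n.+1.
Local Notation F := (free_aff K k).
Local Notation Q := (aff_part_alg K k).
Local Notation pi := (@aff_pi K k).
Local Notation lift q := (generic_quotient.repr (q : Quotient.quot (@aff_ideal K k))).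

Lemma aff_liftK (q : Q) : pi (lift q) = q.
Proof. exact: generic_quotient.reprK. Qed.

Lemma aff_algebra_rel (u v : Q) :
  aff_rel k (aff_tau K k) (aff_e K k) (aff_x K k) (aff_z K k) u v -> u = v.
Proof.
apply: (@aff_rel_image _ _ pi) => [a c ac|q]; first exact/aff_pi_eq/tsi_rel.
by exists (lift q); apply/esym/aff_liftK.
Qed.

Section TensorRepresentation.
Variable N : nat.
Local Notation A := (linop_ring K (word0 N)).

Definition gen_op (g : generator) : A :=
  match g with
  | GTau i => tensor_tau K N i
  | GE j => tensor_e K N j
  | GX r => tensor_x K N r
  | GZ l => tensor_z K N l
  end.

Definition monom_op (m : {fmonom {g : generator | gen_defined k g}}) : A :=
  \prod_(g <- fmonom_val m) gen_op (val g).

Let monom_op_morph : mmorphism monom_op.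
Proof.
split=> [m m'|]; last by rewrite /monom_op fm1 big_nil.
by rewrite /monom_op fmM big_cat.
Qed.
HB.instance Definition _ := isMultiplicative.Build _ A monom_op monom_op_morph.

Definition free_op (u : F) : A := mmap (@linop_C K _ (word0 N)) monom_op u.

Fact free_op_zmod_morphism : zmod_morphism free_op.
Proof. exact: mmapB. Qed.
Fact free_op_monoid_morphism : monoid_morphism free_op.
Proof.
have [fM f1] := @commr_mmap_is_multiplicative _ _ A (@linop_C K _ (word0 N)) monom_op
  (fun g m m' => linop_C_comm _ _); by split.
Qed.
HB.instance Definition _ := GRing.isZmodMorphism.Build F A free_op free_op_zmod_morphism.
HB.instance Definition _ := GRing.isMonoidMorphism.Build F A free_op free_op_monoid_morphism.

Lemma free_opZ c u : free_op (c *: u) = linop_C (word0 N) c * free_op u.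
Proof. exact: mmapZ. Qed.

Lemma free_op_gen g : free_op (gen K k g) = if gen_defined k g then gen_op g else 0.
Proof.
rewrite /gen; case: insubP => [h dg hE|/negbTE ->]; last by rewrite rmorph0.
rewrite dg /free_op mmapU; transitivity (1 * monom_op (fmu h)).
  by congr (_ * _); apply: (rmorph1 (@linop_C K _ (word0 N))).
by rewrite mul1r /monom_op fmU big_seq1 hE.
Qed.

Lemma free_op_ideal u : two_sided_ideal (@free_rel K k) u -> free_op u = 0.
Proof.
elim=> [a c ac||a c _ a0 _ c0|a c b _ c0]; rewrite ?rmorph0 //.
- rewrite rmorphB; apply/eqP; rewrite subr_eq0; apply/eqP.
  apply: (aff_rel_morph (ltn0Sn n) _ _ _ _ (@tensor_rel K N k) ac) => [i d|i d|i d|l].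
  + by have := free_op_gen (GTau i); rewrite d.
  + by have := free_op_gen (GE i); rewrite d.
  + by have := free_op_gen (GX i); rewrite d.
  + exact: (free_op_gen (GZ l)).
- by rewrite rmorphB /= a0 c0 subrr.
- by rewrite !rmorphM /= c0 mulr0 mul0r.
Qed.

Definition aff_op (q : Q) : A := free_op (lift q).

Lemma aff_op_pi u : aff_op (pi u) = free_op u.
Proof.
apply/eqP; rewrite -subr_eq0 -rmorphB; apply/eqP/free_op_ideal/aff_pi_eq.
exact: aff_liftK.
Qed.

Fact aff_op_zmod_morphism : zmod_morphism aff_op.
Proof. by move=> a c; rewrite -(aff_liftK a) -(aff_liftK c) -rmorphB !aff_op_pi rmorphB. Qed.
Fact aff_op_monoid_morphism : monoid_morphism aff_op.
Proof.
split=> [|a c]; first by rewrite -(rmorph1 pi) aff_op_pi rmorph1.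
by rewrite -(aff_liftK a) -(aff_liftK c) -rmorphM !aff_op_pi rmorphM.
Qed.
HB.instance Definition _ := GRing.isZmodMorphism.Build Q A aff_op aff_op_zmod_morphism.
HB.instance Definition _ := GRing.isMonoidMorphism.Build Q A aff_op aff_op_monoid_morphism.

Lemma aff_opZ c q : aff_op (c *: q) = linop_C (word0 N) c * aff_op q.
Proof. by rewrite -(aff_liftK q) -linearZ !aff_op_pi free_opZ. Qed.

Lemma aff_op_tau i : gen_defined k (GTau i) -> aff_op (aff_tau K k i) = tensor_tau K N i.
Proof. by move=> di; rewrite aff_op_pi free_op_gen di. Qed.
Lemma aff_op_e i : gen_defined k (GE i) -> aff_op (aff_e K k i) = tensor_e K N i.
Proof. by move=> di; rewrite aff_op_pi free_op_gen di. Qed.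
Lemma aff_op_z l : aff_op (aff_z K k l) = tensor_z K N l.
Proof. by rewrite aff_op_pi free_op_gen. Qed.

End TensorRepresentation.
End AffineAlgebra.

(** * Diagrams as operators *)

Section Colourings.
Variable n : nat.
Local Notation I := 'I_n.+1.

Definition colour (C : Type) (w u : I -> C) (v : vertex n.+1) : C :=
  match v with inl i => w i | inr i => u i end.

(** The matrix entry of [d] at the top colouring [w] and the bottom colouring [u] in the classical
    action on tensor powers of the permutation module. *)
Definition constant_on_blocks (C : eqType) (d : diagram n.+1) (w u : I -> C) : bool :=
  [forall v, forall v', same d v v' ==> (colour w u v == colour w u v')].

Definition compatible (C : eqType) (q : word n) (w u : I -> C) : bool :=
  [&& all (fun e => w e.1 == w e.2) (wtop q), all (fun e => u e.1 == u e.2) (wbot q) &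
      [forall i, (i \notin wcut q) ==> (w i == u (wperm q i))]].

Lemma constant_on_blocksP (C : eqType) d (w u : I -> C) :
  reflect (forall v v', same d v v' -> colour w u v = colour w u v') (constant_on_blocks d w u).
Proof.
apply: (iffP forallP) => [h v v' vv'|h v].
  by have /forallP/(_ v')/implyP/(_ vv')/eqP := h v.
by apply/forallP => v'; apply/implyP => /h ->.
Qed.

Lemma compatibleP (C : eqType) (q : word n) (w u : I -> C) :
  reflect [/\ forall e, e \in wtop q -> w e.1 = w e.2,
              forall e, e \in wbot q -> u e.1 = u e.2 &
              forall i, i \notin wcut q -> w i = u (wperm q i)] (compatible q w u).
Proof.
apply: (iffP and3P) => [[/allP h1 /allP h2 /forallP h3]|[h1 h2 h3]].
  split=> [e /h1/eqP|e /h2/eqP|i iJ] //; by apply/eqP; have /implyP := h3 i; apply.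
split; [by apply/allP => e /h1/eqP|by apply/allP => e /h2/eqP|].
by apply/forallP => i; apply/implyP => /h3/eqP.
Qed.

(** [presents] only tests two-valued colourings; an arbitrary colouring is reduced to the indicators
    of its single colours. *)
Lemma compatible_presents (C : eqType) d q (w u : I -> C) :
  presents d q -> compatible q w u = constant_on_blocks d w u.
Proof.
move=> dq; pose ind a v := colour w u v == a.
apply/compatibleP/constant_on_blocksP => [[h1 h2 h3] v v' vv'|h].
  suff /dq/(_ _ _ vv') : respects q (ind (colour w u v)) by rewrite /ind eqxx => /esym/eqP.
  by split=> [e /h1 E|e /h2 E|i /h3 E]; rewrite /ind /= E.
have rq a : respects q (ind a) by apply/dq => v v' /h E; rewrite /ind E.
split=> [e eL|e eM|i iJ].
- by have [h1 _ _] := rq (w e.2); have := h1 e eL; rewrite /ind /= eqxx => /eqP.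
- by have [_ h1 _] := rq (u e.2); have := h1 e eM; rewrite /ind /= eqxx => /eqP.
- by have [_ _ h1] := rq (u (wperm q i)); have := h1 i iJ; rewrite /ind /= eqxx => /eqP.
Qed.

Lemma presents_compatible d q :
  (forall w u : I -> bool, compatible q w u = constant_on_blocks d w u) -> presents d q.
Proof.
move=> h c; pose w i := c (inl i); pose u i := c (inr i).
have cE v : colour w u v = c v by case: v.
split=> [[h1 h2 h3] v v' vv'|hc].
  rewrite -!cE; apply: (constant_on_blocksP _ _ _ _) vv'.
  by rewrite -h; apply/compatibleP.
have /compatibleP[h1 h2 h3] : compatible q w u.
  by rewrite h; apply/constant_on_blocksP => v v' /hc; rewrite !cE.
by split.
Qed.

Lemma constant_on_blocks_sat d (f g : {set I}) :
  constant_on_blocks d (fun i => i \in f) (fun i => i \in g) = sat d f g.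
Proof.
have E v : colour (fun i => i \in f) (fun i => i \in g) v = (v \in join f g).
  by rewrite inE; case: v.
by apply: eq_forallb => v; apply: eq_forallb => v'; rewrite !E.
Qed.

Lemma constant_on_blocks_inj (C D : eqType) (h : C -> D) d (w u : I -> C) : injective h ->
  constant_on_blocks d (h \o w) (h \o u) = constant_on_blocks d w u.
Proof.
move=> hI; have E v : colour (h \o w) (h \o u) v = h (colour w u v) by case: v.
by apply: eq_forallb => v; apply: eq_forallb => v'; rewrite !E (inj_eq hI).
Qed.

Lemma compatible_inj (C D : eqType) (h : C -> D) q (w u : I -> C) : injective h ->
  compatible q (h \o w) (h \o u) = compatible q w u.
Proof.
move=> hI; rewrite /compatible; congr [&& _, _ & _].
- by apply: eq_all => e /=; rewrite (inj_eq hI).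
- by apply: eq_all => e /=; rewrite (inj_eq hI).
- by apply: eq_forallb => i; rewrite /= (inj_eq hI).
Qed.

(* Unitriangularity with respect to refinement: the colouring of the vertices
   by the blocks of d is constant on the blocks of the refinements of d only. *)
Lemma constant_on_blocks_free (K : comNzRingType) N (a : diagram n.+1 -> K) :
  (n.+1 + n.+1 <= N.+1)%N ->
  (forall w u : {ffun I -> 'I_N.+1}, \sum_d a d * (constant_on_blocks d w u)%:R = 0) ->
  forall d, a d = 0.
Proof.
move=> nN h; pose pairs d := [set vv : vertex n.+1 * vertex n.+1 | same d vv.1 vv.2].
move=> d; have [m] := ubnP #|pairs d|; elim: m d => // m IHm d dm.
pose rep v : vertex n.+1 := odflt v [pick v' in pblock d v].
have repP v : same d v (rep v).
  by rewrite /rep; case: pickP => [//|/(_ v)]; rewrite -[v \in _]/(same d v v) same_refl.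
have rep_eq v v' : (rep v == rep v') = same d v v'.
  apply/eqP/idP => [E|vv'].
    by apply: same_trans (repP v) _; rewrite E same_sym.
  have /and3P[_ tr _] := blocksP d; rewrite /rep (same_pblock tr vv').
  by case: pickP => // /(_ v'); rewrite -[v' \in _]/(same d v v') vv'.
pose num (v : vertex n.+1) : 'I_N.+1 := inord (enum_rank v).
have num_inj : injective num.
  have cV (v : vertex n.+1) : (enum_rank v < N.+1)%N.
    by apply: leq_trans (ltn_ord _) _; rewrite card_sum !card_ord.
  by move=> v v' /(congr1 val); rewrite /= !inordK // => /val_inj/enum_rank_inj.
pose lab v := num (rep v).
have lab_eq v v' : (lab v == lab v') = same d v v' by rewrite (inj_eq num_inj) rep_eq.
have := h [ffun i => lab (inl i)] [ffun i => lab (inr i)].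
have cE v : colour [ffun i => lab (inl i)] [ffun i => lab (inr i)] v = lab v.
  by case: v => i /=; rewrite ffunE.
have cP c : constant_on_blocks c [ffun i => lab (inl i)] [ffun i => lab (inr i)] =
    (pairs c \subset pairs d).
  apply/constant_on_blocksP/subsetP => [hc [v v']|hc v v' vv'].
    by rewrite !inE /= => /hc; rewrite !cE => /eqP; rewrite lab_eq.
  by rewrite !cE; apply/eqP; rewrite lab_eq; have := hc (v, v'); rewrite !inE; apply.
rewrite (bigD1 d) //= cP subxx mulr1 big1 ?addr0 // => c cd; rewrite cP.
case: (boolP (pairs c \subset pairs d)) => [cdp|]; last by rewrite mulr0.
rewrite IHm ?mul0r // -ltnS; apply: leq_trans dm; rewrite ltnS; apply: proper_card.
rewrite properEneq cdp andbT; apply: contraNneq cd => E; apply/eqP/same_inj => v v'.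
by have /setP/(_ (v, v')) := E; rewrite !inE.
Qed.

End Colourings.

(** * Matrix entries of normal forms *)

Section WordAction.
Variables (K : comNzRingType) (n N : nat).
Local Notation I := 'I_n.+1.
Local Notation C := 'I_N.+1.
Local Notation W := (nat -> C).
Local Notation A := (linop_ring K (word0 N)).
Variables (B : nzRingType) (s b p : nat -> B) (z : B) (op : {rmorphism B -> A}).
Hypothesis R : partition_relations n s b p z.
Hypothesis op_s : forall i, (i < n)%N -> op (s i) = tau_even K N i * tau_odd K N i + e_even K N i.
Hypothesis op_b : forall i, (i < n)%N -> op (b i) = e_even K N i.
Hypothesis op_p : forall i, (i <= n)%N -> op (p i) = e_odd K N i.
Local Notation T := (@perm_lift n B s).

Let T1 : T 1%g = 1. Proof. exact: perm_lift1 (pr_s_comm R) (pr_s_braid R). Qed.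
Let Tadj i f : (i < n)%N -> T (adj n i * f)%g = s i * T f.
Proof. exact: perm_lift_adjM (pr_s_sqr R) (pr_s_comm R) (pr_s_braid R) i f. Qed.

Let opM x y f w : op (x * y) f w = op x (op y f) w. Proof. by rewrite rmorphM. Qed.
Let op1 f w : op 1 f w = f w. Proof. by rewrite rmorph1. Qed.

Definition override (u : I -> C) (w : W) : W :=
  fun j => if (j < n.+1)%N then u (inord j) else w j.

Definition perm_word (f : 'S_n.+1) (w : W) : W := override (fun i => w (f^-1%g i)) w.

Let overrideE u w (i : I) : override u w i = u i.
Proof. by rewrite /override ltn_ord inord_val. Qed.

Let override_id (w : W) : override (fun i => w i) w = w.
Proof. by apply/funext => j; rewrite /override; case: ltnP => // jn; rewrite inordK. Qed.

Let override2 u u' (w : W) : override u (override u' w) = override u w.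
Proof. by apply/funext => j; rewrite /override; case: ltnP. Qed.

Let op_swap i f w : (i < n)%N -> op (s i) f w = f (perm_word (adj n i) w).
Proof.
move=> ni; rewrite op_s //; transitivity (f (word2 i w (w i.+1) (w i) w)); first by rewrite -swap2 -word2E.
congr f; apply/funext => j.
rewrite /perm_word /override /adj tpermV /word2.
have iK : (inord i : I) = i :> nat by rewrite inordK // ltnS ltnW.
have i1K : (inord i.+1 : I) = i.+1 :> nat by rewrite inordK.
case: (ltnP j n.+1) => jn; last first.
  by repeat (case: ifP => //; try lia).
have jK : (inord j : I) = j :> nat by rewrite inordK.
case: tpermP => [/(congr1 val)|/(congr1 val)|ji ji1]; rewrite /= ?jK ?iK ?i1K.
- by move=> ->; rewrite ltnn eqxx.
- by move=> ->; rewrite ltnNge leqnSn (gtn_eqF (ltnSn i)) eqxx.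
- have /eqP nji : j <> i by move=> E; apply: ji; rewrite E.
  have /eqP nji1 : j <> i.+1 by move=> E; apply: ji1; rewrite E.
  by rewrite (negbTE nji) (negbTE nji1); case: ifP.
Qed.

Lemma op_perm (g : 'S_n.+1) f w : op (T g) f w = f (perm_word g w).
Proof.
elim/adj_ind: g w => [|i g ni _ IHg] w.
  rewrite T1 op1; congr f; rewrite -[LHS]override_id /perm_word invg1.
  by congr override; apply/funext => i; rewrite perm1.
rewrite Tadj // opM op_swap // IHg; congr f.
rewrite /perm_word override2; congr override; apply/funext => j.
by rewrite overrideE invMg permM.
Qed.

Lemma op_bb (i j : I) f w : op (bb s b i j) f w = if w i == w j then f w else 0.
Proof.
have [->|ij] := eqVneq i j; first by rewrite bbii op1 eqxx.
have /frames[n0 [g gE]] : uniq [:: i; j] by rewrite /= inE ij.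
have [g0 g1] := (gE 0%N isT, gE 1%N isT).
have E := join_perm_shift R (inord 0) (inord 1) g.
rewrite /= in g0 g1 n0; have n0' : (0 < n)%N by [].
rewrite g0 g1 (bb_adj R n0') in E.
(* The test word is moved by the inverse of [g] in advance, so that [T g] brings it back to [w]. *)
have : op (b 0 * T g) f (perm_word g^-1%g w) =
       op (T g * bb s b i j) f (perm_word g^-1%g w) by rewrite E.
rewrite !opM op_b // [LHS]/= !op_perm.
have -> : perm_word g (perm_word g^-1 w) = w.
  rewrite /perm_word override2 -[RHS]override_id; congr override; apply/funext => a.
  by rewrite /perm_word overrideE invgK permKV.
move=> <-.
have pw (a : I) : perm_word g^-1 w a = w (g a) by rewrite /perm_word overrideE invgK.
by have := (pw (inord 0), pw (inord 1)); rewrite g0 g1 !inordK // => -[-> ->].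
Qed.

Lemma op_joins L f w :
  op (joins s b L) f w = if all (fun e : I * I => w e.1 == w e.2) L then f w else 0.
Proof.
elim: L w => [|e L IHL] w; first by rewrite /joins big_nil op1.
by rewrite joins_cons opM op_bb IHL /=; case: eqP.
Qed.

Lemma op_cuts (J : {set I}) f (w : W) : op (cuts p J) f w =
  \sum_(u : {ffun I -> C} | [forall i, (i \notin J) ==> (w i == u i)]) f (override u w).
Proof.
transitivity (\sum_(u : {ffun I -> C} | [forall i, (i \notin enum J) ==> (w i == u i)]) f (override u w));
  last by apply: eq_bigl => u; apply: eq_forallb => i; rewrite mem_enum.
rewrite /cuts; elim: (enum J) (enum_uniq J) w => [_|i t IHt /= /andP[it ut]] w.
  rewrite big_nil op1 (big_pred1 [ffun i : I => w i]) => [|u] /=.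
    by congr f; rewrite -[LHS]override_id; congr override; apply/funext => i; rewrite ffunE.
  apply/forallP/eqP => [wu|->] //=; last by move=> i; rewrite ffunE.
  by apply/ffunP => i; rewrite ffunE; apply/eqP; have := wu i; rewrite eq_sym.
rewrite big_cons opM op_p ?leq_ord // [LHS]/= (partition_big (fun u : {ffun I -> C} => u i) xpredT) //=.
apply: eq_bigr => c _; rewrite IHt //; apply: eq_big => [u|u _].
  apply/forallP/andP => [wu|[/forallP wu /eqP uc] j]; last first.
    apply/implyP => jt; rewrite /upd; case: (eqVneq (j : nat) i) => [ji|ji].
      by rewrite (val_inj ji) uc.
    by have := wu j; rewrite inE negb_or -val_eqE ji jt.
  have := wu i; rewrite it /upd eqxx => /eqP <-; split=> //.
  apply/forallP => j; apply/implyP; rewrite inE negb_or => /andP[ji jt].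
  by have := wu j; rewrite jt /upd (negbTE ji : ((j : nat) == i) = false).
congr f; apply/funext => j; rewrite /override /upd; case: ltnP => // nj.
by rewrite gtn_eqF // (leq_trans (ltn_ord i)).
Qed.

Lemma op_word q f (w : W) : op (word_eval s b p q) f w =
  \sum_(u : {ffun I -> C}) (compatible q (fun i => w i) u)%:R * f (override u w).
Proof.
rewrite /word_eval !opM op_joins /compatible.
case: ifP => wtop_ok; last by rewrite big1 // => u _; rewrite mul0r.
(* [op_cuts] sums over colourings indexed by top positions; composing with [wperm q] indexes them by
   bottom positions. *)
rewrite op_cuts (reindex (fun u : {ffun I -> C} => [ffun i => u (wperm q i)])) /=; last first.
  exists (fun u => [ffun i => u ((wperm q)^-1%g i)]) => u _; apply/ffunP => i;
    by rewrite !ffunE ?permK ?permKV.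
rewrite big_mkcond; apply: eq_bigr => u _; rewrite op_perm op_joins.
have -> : perm_word (wperm q) (override [ffun i => u (wperm q i)] w) = override u w.
  rewrite /perm_word override2; congr override; apply/funext => i.
  by rewrite overrideE ffunE permKV.
have -> : all (fun e : I * I => override u w e.1 == override u w e.2) (wbot q) =
    all (fun e => u e.1 == u e.2) (wbot q).
  by apply: eq_all => e; rewrite !overrideE.
under eq_forallb do rewrite ffunE.
by rewrite andbC; case: forallP; case: all; rewrite ?mul1r ?mul0r.
Qed.

End WordAction.

(** * Normal forms of the generating diagrams *)

Section Generators.
Variable n : nat.
Local Notation I := 'I_n.+1.

Lemma presents_fibre (L : eqType) (f : vertex n.+1 -> L) q :
  (forall e, e \in wtop q -> f (inl e.1) = f (inl e.2)) ->
  (forall e, e \in wbot q -> f (inr e.1) = f (inr e.2)) ->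
  (forall i, i \notin wcut q -> f (inl i) = f (inr (wperm q i))) ->
  (forall c u v, respects q c -> f u = f v -> c u = c v) ->
  presents (fibre_diagram f) q.
Proof.
move=> ft fb fc h c; split=> [cq u v|cf]; first by rewrite same_fibre => /eqP; exact: h.
by split=> [e eq|e eq|i iq]; apply: cf; rewrite same_fibre; apply/eqP;
  [apply: ft|apply: fb|apply: fc].
Qed.

Lemma presents_s i : (i < n)%N ->
  presents (s_diagram n.+1 i.+1) (Word [::] set0 (adj n i) [::]).
Proof.
move=> ni; pose g (v : vertex n.+1) : I := match v with inl j => j | inr j => adj n i j end.
rewrite /s_diagram; set f := (X in fibre_diagram X).
have fg v : f v = (g v).+1 :> nat.
  case: v => // j; rewrite /f /g /adj !eqSS.
  case: tpermP => [->|->|/eqP ji /eqP ji1]; rewrite ?inordK //; try lia.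
  - by rewrite eqxx.
  - by rewrite eqxx gtn_eqF.
  - move: ji ji1; rewrite -!val_eqE /= !inordK //; try lia.
    by move=> /negbTE-> /negbTE->.
have gadj j : g (inr (adj n i j)) = j by rewrite /g /adj tpermK.
apply: presents_fibre => // [j _|c u v [_ _ h] fuv].
  by rewrite -[LHS]/(f _) -[RHS]/(f _) !fg gadj.
have {}h w : c w = c (inl (g w)).
  by case: w => // j; rewrite h ?inE // /g /adj tpermK.
have [/val_inj E] : (g u).+1 = (g v).+1 by rewrite -!fg; exact: fuv.
by rewrite h (h v) E.
Qed.

Lemma presents_e_odd (i : I) :
  presents (e_odd_diagram n.+1 i.+1) (Word [::] [set i] 1%g [::]).
Proof.
apply: presents_fibre => //= [j|c u v [_ _ h]].
  by rewrite inE perm1 eqSS -val_eqE => /negbTE ->.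
have {}h j : j != i -> c (inl j) = c (inr j) by move=> ji; rewrite h ?inE ?perm1.
case: u v => j [] l; rewrite ?eqSS.
- by case=> /val_inj->.
- by case: eqP => // li [/val_inj->]; apply: h; apply/eqP => E; rewrite E in li.
- by case: eqP => // li [/val_inj E]; apply/esym; rewrite E in li *; apply: h; apply/eqP => E'; rewrite E' in li.
- case: eqP => [ji|_]; case: eqP => [li|_] //; last by case=> /val_inj->.
  by move=> _; congr (c (inr _)); apply: val_inj; rewrite /= ji li.
Qed.

Lemma presents_e_even i : (i < n)%N ->
  presents (e_even_diagram n.+1 i.+1) (Word [:: (inord i, inord i.+1)] set0 1%g [::]).
Proof.
move=> ni; apply: presents_fibre => //= [e|j _|c u v [h1 _ h]].
- by rewrite inE => /eqP-> /=; rewrite !inordK ?eqxx ?eqSS ?ltn_eqF //; lia.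
- by rewrite perm1.
have {}h1 := h1 _ (mem_head _ _); rewrite /= in h1.
pose g (v : vertex n.+1) : I := match v with inl j => j | inr j => j end.
have {}h w : c w = c (inl (g w)) by case: w => //= j; rewrite h ?inE ?perm1.
rewrite h (h v); have gE (w : vertex n.+1) : match w with inl r | inr r => if r.+1 == i.+2 then i.+1 else r.+1 end =
    if (g w).+1 == i.+2 then i.+1 else (g w).+1 by case: w.
rewrite !gE !eqSS.
have bE (j : I) : j = i.+1 :> nat -> j = inord i.+1.
  by move=> E; apply: val_inj; rewrite /= inordK.
have aE (j : I) : j = i :> nat -> j = inord i.
  by move=> E; apply: val_inj; rewrite /= inordK //; lia.
case: eqP => [/bE->|_]; case: eqP => [/bE->|_] //.
- by case=> /esym/aE->; rewrite h1.
- by case=> /aE->; rewrite h1.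
- by case=> /val_inj->.
Qed.
End Generators.

(** * The homomorphism *)

Lemma central_morph_twist (K : comNzRingType) (B : nzRingType) (f : {rmorphism {poly K} -> B})
    (z : B) a a' m (u u' v : B) :
  f 'X = z -> (forall c x, f c * x = x * f c) -> u * u' = z ^+ m * v ->
  f (a * a' * 'X ^+ m) * v = f a * u * (f a' * u').
Proof.
move=> fX fC E; rewrite !rmorphM rmorphXn /= fX -mulrA -E.
by rewrite !mulrA -[f a * _ * u]mulrA (fC a') !mulrA.
Qed.

Section DiagramWords.
Variables (K : numDomainType) (n : nat).
Local Notation I := 'I_n.+1.
Local Notation Q := (aff_part_alg K n.+1).
Local Notation s := (aff_s (aff_tau K n.+1) (aff_e K n.+1)).
Local Notation b := (fun i : nat => aff_e K n.+1 i.+1.*2).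
Local Notation p := (fun i : nat => aff_e K n.+1 i.*2.+1).
Local Notation z := (aff_z K n.+1 0).

Lemma aff_algebra_partition_relations : partition_relations n s b p z.
Proof. exact: aff_partition_relations (@aff_algebra_rel K n). Qed.

Local Notation R := aff_algebra_partition_relations.

Definition aff_word (q : word n) : Q := word_eval s b p q.

Lemma aff_op_word N q f (w : nat -> 'I_N.+1) : aff_op N (aff_word q) f w =
  \sum_(u : {ffun I -> 'I_N.+1}) (compatible q (fun i => w i) u)%:R * f (override u w).
Proof.
apply: (op_word R) => i ni.
- rewrite /aff_s rmorphD rmorphM /= !aff_op_tau ?aff_op_e /=; try by lia.
  by rewrite tensor_tau_even tensor_tau_odd tensor_e_even.
- by rewrite /= aff_op_e /=; [rewrite tensor_e_even|lia].
- by rewrite /= aff_op_e /=; [rewrite tensor_e_odd|lia].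
Qed.

(** Applying an operator to the indicator of the words that begin with [v] extracts one matrix
    entry. *)
Let pick_colouring N (v : I -> 'I_N.+1) (a : {ffun I -> 'I_N.+1} -> K) (w : nat -> 'I_N.+1) :
  \sum_u a u * [forall i : I, override u w i == v i]%:R = a (finfun v).
Proof.
rewrite (bigD1 (finfun v)) //= big1 => [|u uv].
  rewrite addr0 (_ : [forall i, _] = true) ?mulr1 //; apply/forallP => i.
  by rewrite /override ltn_ord inord_val ffunE.
rewrite (_ : [forall i, _] = false) ?mulr0 //; apply: contraNF uv => /forallP uv.
apply/eqP/ffunP => i; rewrite ffunE; apply/eqP; have := uv i.
by rewrite /override ltn_ord inord_val.
Qed.

Let aff_opM N x y f (w : nat -> 'I_N.+1) :
  aff_op N (x * y : Q) f w = aff_op N x (aff_op N y f) w.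
Proof. by rewrite rmorphM. Qed.

Let aff_opD N x y f (w : nat -> 'I_N.+1) :
  aff_op N (x + y : Q) f w = aff_op N x f w + aff_op N y f w.
Proof. by rewrite rmorphD. Qed.

Let aff_opZx N c x f (w : nat -> 'I_N.+1) :
  aff_op N (c *: x : Q) f w = c * aff_op N x f w.
Proof. by rewrite aff_opZ. Qed.

Let aff_op_z0 N m x f (w : nat -> 'I_N.+1) :
  aff_op N (z ^+ m * x) f w = N.+1%:R ^+ m * aff_op N x f w.
Proof.
rewrite aff_opM (_ : aff_op N (z ^+ m) = linop_C (word0 N) (N.+1%:R ^+ m)) ?linop_CE //.
rewrite rmorphXn /= aff_op_z /tensor_z expn0 muln1.
exact/esym/(rmorphXn (@linop_C K _ (word0 N))).
Qed.

Definition diagram_word (d : diagram n.+1) : word n := projT1 (cid (presents_exists d)).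

Lemma diagram_wordP d : presents d (diagram_word d).
Proof. exact: projT2 (cid (presents_exists d)). Qed.

Definition aff_basis (d : diagram n.+1) : Q := aff_word (diagram_word d).

Lemma aff_basis_presents d q : presents d q -> aff_basis d = aff_word q.
Proof. by move=> dq; apply: (presents_uniq R _ dq); apply: diagram_wordP. Qed.

Lemma aff_op_basis N d f (w : nat -> 'I_N.+1) : aff_op N (aff_basis d) f w =
  \sum_(u : {ffun I -> 'I_N.+1}) (constant_on_blocks d (fun i => w i) u)%:R * f (override u w).
Proof.
rewrite aff_op_word; apply: eq_bigr => u _.
by rewrite (compatible_presents _ _ (diagram_wordP d)).
Qed.

Let bit (x : bool) : 'I_2 := if x then ord_max else ord0.
Let bit_inj : injective bit. Proof. by case=> -[]. Qed.

Let bitK (c : 'I_2) : bit (c == ord_max) = c.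
Proof. by apply: val_inj; case: c => -[|[]]. Qed.

Let bits (f : {set I}) : I -> 'I_2 := bit \o (fun i => i \in f).

(* With two colours, both sides of the product formula count the colourings of
   the middle row of the stack of d and d'. *)
Lemma aff_basisM d d' :
  aff_basis d * aff_basis d' = z ^+ nmiddle d d' * aff_basis (compose d d').
Proof.
have [m [q E]] : exists m q, aff_basis d * aff_basis d' = z ^+ m * aff_word q.
  exact: (word_evalM R).
move: (nmiddle d d') (sat_compose d d') => m' sat_dd'.
have fun_finfun (v : I -> 'I_2) : finfun v = v :> (I -> 'I_2).
  by apply/funext => i; rewrite ffunE.
have cst_sat c g h : constant_on_blocks c (bits g) (bits h) = sat c g h.
  by rewrite -constant_on_blocks_sat; apply: constant_on_blocks_inj.
(* The colours are ['I_N.+1], so N = 1 means two colours, and z acts as 2. The same matrix entry is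
   computed from [E] and as an entry of the product of two operators. *)
have count (f h : {set I}) : (2 ^ m * compatible q (fun i => i \in f) (fun i => i \in h) =
    2 ^ m' * sat (compose d d') f h)%N.
  pose w (j : nat) := bits f (inord j).
  have wE : (fun i : I => w i) = bits f by apply/funext => i; rewrite /w inord_val.
  have ovr (u : I -> 'I_2) : (fun i : I => override u w i) = u.
    by apply/funext => i; rewrite /override ltn_ord inord_val.
  pose phi (w' : nat -> 'I_2) : K := [forall i : I, w' i == bits h i]%:R.
  have : aff_op 1 (aff_basis d * aff_basis d') phi w =
      2%:R ^+ m * (compatible q (bits f) (finfun (bits h)))%:R.
    by rewrite E aff_op_z0 aff_op_word pick_colouring wE.
  have -> : compatible q (bits f) (finfun (bits h)) =
      compatible q (fun i => i \in f) (fun i => i \in h).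
    by rewrite fun_finfun; apply: (compatible_inj q _ _ bit_inj).
  have -> : aff_op 1 (aff_basis d * aff_basis d') phi w =
      \sum_(g : {set I}) (sat d f g * sat d' g h)%:R.
    rewrite aff_opM aff_op_basis wE.
    rewrite (reindex (fun g : {set I} => [ffun i => bits g i])) /=; last first.
      exists (fun u : {ffun I -> 'I_2} => [set i | u i == ord_max]) => [g|u] _.
        by apply/setP => i; rewrite inE ffunE /bits /=; case: (i \in g).
      by apply/ffunP => i; rewrite ffunE /bits /= inE bitK.
    apply: eq_bigr => g _; rewrite natrM fun_finfun cst_sat; congr (_ * _).
    by rewrite aff_op_basis pick_colouring !fun_finfun ovr cst_sat.
  rewrite -natr_sum sat_dd' -natrX -natrM => /eqP.
  by rewrite eqr_nat => /eqP.
(* The constant colouring respects every word and diagram, so at the empty sets only the powers of 2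
   remain. *)
have m_eq : m = m'.
  have := count set0 set0; rewrite sat00 (_ : compatible _ _ _ = true).
    move=> E0.
    have E1 : (2 ^ m = 2 ^ m')%N by move: E0; clear; case: (2 ^ m)%N (2 ^ m')%N => [|?] [|?]; lia.
    exact: (expnI _ E1).
  by apply/compatibleP; split=> *; rewrite !inE.
suff dq : presents (compose d d') q by rewrite (aff_basis_presents dq) -m_eq; exact: E.
apply: presents_compatible => w u.
have set_fun (v : I -> bool) : v = (fun i => i \in [set i | v i]).
  by apply/funext => i; rewrite inE.
rewrite (set_fun w) (set_fun u) constant_on_blocks_sat.
have := count [set i | w i] [set i | u i]; rewrite m_eq => /eqP.
rewrite eqn_pmul2l; last by rewrite expn_gt0.
by case: (compatible _ _ _); case: (sat _ _ _).
Qed.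

Local Notation ev := (@horner_alg K Q z).

Lemma ev_comm a x : ev a * x = x * ev a.
Proof.
elim/poly_ind: a => [|a c IHa]; first by rewrite rmorph0 mul0r mulr0.
rewrite rmorphD rmorphM /= horner_algX horner_algC mulrDl mulrDr.
by rewrite -mulrA (pr_z_central R) !mulrA IHa mulr_algl mulr_algr.
Qed.

Lemma aff_op_ev N a x f (w : nat -> 'I_N.+1) :
  aff_op N (ev a * x) f w = a.[N.+1%:R] * aff_op N x f w.
Proof.
elim/poly_ind: a x f w => [|a c IHa] x f w.
  by rewrite rmorph0 mul0r rmorph0 horner0 mul0r.
rewrite rmorphD rmorphM /= horner_algX horner_algC mulrDl -mulrA mulr_algl.
by rewrite aff_opD IHa -[z]expr1 aff_op_z0 expr1 aff_opZx hornerD hornerM hornerX hornerC mulrDl -mulrA.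
Qed.

Definition part_aff (x : polypart_alg K n.+1) : Q := \sum_d ev (x d) * aff_basis d.

Fact part_aff_zmod_morphism : zmod_morphism part_aff.
Proof.
move=> x y; rewrite /part_aff -sumrB; apply: eq_bigr => d _.
by rewrite !ffunE rmorphB mulrBl.
Qed.

Fact part_aff_scalable : scalable part_aff.
Proof.
move=> c x; rewrite /part_aff scaler_sumr; apply: eq_bigr => d _.
rewrite ffunE -[_ *: x d]/(c%:P * x d) rmorphM /= horner_algC.
by rewrite -scalerAl mul1r scalerAl.
Qed.
HB.instance Definition _ := GRing.isZmodMorphism.Build _ Q part_aff part_aff_zmod_morphism.
HB.instance Definition _ := GRing.isScalable.Build K _ Q *:%R part_aff part_aff_scalable.

Lemma part_aff_delta a d :
  part_aff (a *: part_basis 'X d : part_alg ('X : {poly K}) n.+1) = ev a * aff_basis d.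
Proof.
rewrite /part_aff (bigD1 d) //= big1 => [|d' d'd].
  by rewrite addr0 ffunE delta_at eqxx -[_ *: _]/(a * 1) mulr1.
rewrite ffunE delta_at (negbTE d'd) -[_ *: _]/(a * 0) mulr0.
by rewrite (rmorph0 ev) mul0r.
Qed.

Lemma part_aff_basis d : part_aff (part_basis 'X d) = aff_basis d.
Proof.
have := part_aff_delta 1 d; rewrite scale1r => ->.
by rewrite (rmorph1 ev) mul1r.
Qed.

Lemma part_aff_z : part_aff (part_z K n.+1) = z * aff_basis (id_diagram n.+1).
Proof. by rewrite [LHS]part_aff_delta horner_algX. Qed.

Lemma presents_id : presents (id_diagram n.+1) (Word [::] set0 1%g [::]).
Proof.
apply: presents_compatible => w u; apply/compatibleP/constant_on_blocksP => /= [[_ _ h] v v'|h].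
  by rewrite same_fibre => /eqP; case: v v' => i [] j /= -> //; rewrite h ?inE ?perm1.
by split=> // i _; rewrite perm1; apply: (h (inl i) (inr i)); rewrite same_fibre.
Qed.

Lemma aff_basis1 : aff_basis (id_diagram n.+1) = 1.
Proof.
rewrite (aff_basis_presents presents_id) /aff_word /word_eval /= /joins !big_nil.
rewrite /cuts enum_set0 big_nil (perm_lift1 (pr_s_comm R) (pr_s_braid R)).
by rewrite !mulr1.
Qed.

Fact part_aff_monoid_morphism : monoid_morphism part_aff.
Proof.
split; first by rewrite [LHS]part_aff_basis aff_basis1.
move=> x y; rewrite [x * y]/(part_mul _ _) /part_mul /twisted_mul.
rewrite [LHS](raddf_sum part_aff) /part_aff mulr_suml; apply: eq_bigr => d _.
rewrite [LHS](raddf_sum part_aff) mulr_sumr; apply: eq_bigr => d' _.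
rewrite [LHS]part_aff_delta.
have := central_morph_twist (f := ev) (x d) (y d') (horner_algX z) ev_comm (aff_basisM d d'). exact.
Qed.
HB.instance Definition _ := GRing.isMonoidMorphism.Build _ Q part_aff part_aff_monoid_morphism.

Definition part_aff_morphism : {lrmorphism polypart_alg K n.+1 -> Q} := part_aff.

Lemma part_aff_inj : injective part_aff.
Proof.
apply: (raddf_inj (f := part_aff)) => x x0; apply/ffunP => d; rewrite ffunE.
have root_x N : (n.+1 + n.+1 <= N.+1)%N -> (x d).[N.+1%:R] = 0.
  move=> nN; move: d; apply: (constant_on_blocks_free (a := fun d => (x d).[N.+1%:R]) nN) => v u.
  pose w (j : nat) := v (inord j).
  have wE : (fun i : I => w i) = v by apply/funext => i; rewrite /w inord_val.
  pose phi (w' : nat -> 'I_N.+1) : K := [forall i : I, w' i == u i]%:R.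
  have E0 : aff_op N (part_aff x) phi w = 0 by rewrite x0 rmorph0.
  rewrite -[RHS]E0 (big_morph (fun y => aff_op N y phi w)
    (fun y y' => aff_opD y y' phi w) (id1 := 0)); last by rewrite rmorph0.
  apply: eq_bigr => c _; rewrite aff_op_ev; congr (_ * _).
  rewrite aff_op_basis pick_colouring wE; congr (nat_of_bool _)%:R.
  by congr constant_on_blocks; apply/funext => i; rewrite ffunE.
have [//|xd0] := eqVneq (x d) 0.
(* The points are 2k + m with k = n + 1: all are large enough for [root_x], they are distinct in a
   [numDomainType], and there are more of them than the degree. *)
have := max_poly_roots xd0 (rs := [seq (n + n.+1 + m).+1%:R | m <- iota 0 (size (x d))]).
rewrite size_map size_iota ltnn => H; suff : false by []; apply: H.
  by apply/allP => _ /mapP[m _ ->]; apply/rootP; apply: root_x; lia.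
by rewrite map_inj_uniq ?iota_uniq // => m m' /eqP; rewrite eqr_nat eqSS eqn_add2l => /eqP.
Qed.

Lemma part_aff_s i : (i < n)%N -> part_aff (part_s K n.+1 i.+1) = s i.
Proof.
move=> ni; rewrite [LHS]part_aff_basis (aff_basis_presents (presents_s ni)).
rewrite /aff_word /word_eval /= /joins !big_nil /cuts enum_set0 big_nil !mul1r mulr1.
exact: perm_lift_adj (pr_s_sqr R) (pr_s_comm R) (pr_s_braid R) i ni.
Qed.

Lemma part_aff_e_odd (i : I) : part_aff (part_e K n.+1 i.*2.+1) = aff_e K n.+1 i.*2.+1.
Proof.
rewrite /part_e /= odd_double /= doubleK [LHS]part_aff_basis.
rewrite (aff_basis_presents (presents_e_odd i)) /aff_word /word_eval /= /joins !big_nil.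
by rewrite /cuts enum_set1 big_seq1 (perm_lift1 (pr_s_comm R) (pr_s_braid R)) mul1r !mulr1.
Qed.

Lemma part_aff_e_even i : (i < n)%N -> part_aff (part_e K n.+1 i.+1.*2) = aff_e K n.+1 i.+1.*2.
Proof.
move=> ni; rewrite /part_e odd_double /= half_double [LHS]part_aff_basis.
rewrite (aff_basis_presents (presents_e_even ni)) /aff_word /word_eval /= /joins.
rewrite big_seq1 big_nil /cuts enum_set0 big_nil (perm_lift1 (pr_s_comm R) (pr_s_braid R)).
by rewrite !mulr1; exact: (bb_adj R ni).
Qed.

End DiagramWords.

From mathcomp Require Import complex.

Theorem proposition3p1p5 (R : realType) (k : nat) (hk : (1 <= k)%N) :
  exists iota : {lrmorphism polypart_alg R[i] k -> aff_part_alg R[i] k},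
    [/\ injective iota,
        iota (part_z R[i] k) = aff_z R[i] k 0,
        forall i : nat, (1 <= i <= k.-1)%N ->
          iota (part_s R[i] k i) =
            aff_tau R[i] k i.*2 * aff_tau R[i] k i.*2.+1 + aff_e R[i] k i.*2
      & forall i : nat, (1 <= i <= k.*2.-1)%N ->
          iota (part_e R[i] k i) = aff_e R[i] k i].
Proof.
case: k hk => // n _; exists (part_aff_morphism R[i] n); split.
- exact: part_aff_inj.
- by rewrite [LHS]part_aff_z aff_basis1 mulr1.
- by case=> // i /= ni; exact: part_aff_s.
move=> i i_bounds; have [j [E|E]] : exists j, i = j.*2.+1 \/ i = j.+1.*2.
  by exists i.-1./2; lia.
- have jn : (j < n.+1)%N by lia.
  by rewrite E; exact: (part_aff_e_odd R[i] (Ordinal jn)).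
- by rewrite E; apply: part_aff_e_even; lia.
Qed.
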